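(* Let $k \geq 12$ be an integer with $k \equiv 0 \pmod{4}$. Then \[ \frac{(k-1)^{2}}{16 \pi^{2}} < A(k) \leq \frac{1}{7316} k^{4} (\log k + \log \log k)^{2}. \]
   Context: $M_k$ denotes the complex vector space of holomorphic modular forms of weight $k$ for $\mathrm{SL}_2(\mathbb{Z})$, with Fourier expansions $f(z)=\sum_{n\ge 0} a(n)q^n$, $q=e^{2\pi i z}$. For $f \in M_k$ with real coefficients, $\mathcal{N}(f)$ is the smallest integer $r\ge 0$ with $a(r)<0$ if such $r$ exists, and $\mathcal{N}(f)=\infty$ otherwise. For $k \equiv 0 \pmod 4$, $A(k) = \max\{\mathcal{N}(f) : f \in M_k,\ \mathcal{N}(f)<\infty\}$; equivalently, $A(k)$ is the least integer such that whenever the coefficients $a(1),\dots,a(A(k))$ of a form $f = 1+\sum_{n\ge1}a(n)q^n \in M_k$ are nonnegative, all coefficients of $f$ are nonnegative, and this maximum exists. *)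

(* Defs.v *)
From Stdlib Require Import Reals.
From Coquelicot Require Import Coquelicot.
Open Scope R_scope.

Definition inH (z : C) : Prop := 0 < Im z.

Definition cexp (w : C) : C := (exp (Re w) * cos (Im w), exp (Re w) * sin (Im w)).

Definition qpar (z : C) : C := cexp (Cmult (0, 2 * PI) z).

Definition is_modular_form (k : nat) (f : C -> C) : Prop :=
  (forall z, inH z -> ex_derive (K := C_AbsRing) (V := C_NormedModule) f z) /\
  (forall z, inH z -> f (Cplus z 1) = f z) /\
  (forall z, inH z -> f (Copp (Cinv z)) = Cmult (pow_n (K := C_Ring) z k) (f z)) /\
  (* holomorphic at the cusp: bounded as Im z -> +oo *)
  (exists M : R, forall z, 1 <= Im z -> Cmod (f z) <= M).

Definition has_q_expansion (f : C -> C) (a : nat -> R) : Prop :=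
  forall z, inH z ->
    is_series (K := C_AbsRing) (V := C_NormedModule)
      (fun n => Cmult (RtoC (a n)) (pow_n (K := C_Ring) (qpar z) n)) (f z).

Definition first_neg (a : nat -> R) (r : nat) : Prop :=
  a r < 0 /\ forall m, (m < r)%nat -> 0 <= a m.

Definition is_A (k : nat) (A : nat) : Prop :=
  (exists f a, is_modular_form k f /\ has_q_expansion f a /\ first_neg a A) /\
  (forall f a r, is_modular_form k f -> has_q_expansion f a -> first_neg a r -> (r <= A)%nat).

(* Main.v *)
Require Import Defs.
From Stdlib Require Import Reals Lra Lia ZArith Classical ClassicalEpsilon.
From Coquelicot Require Import Coquelicot.
Open Scope R_scope.

(** Both bounds rest on the Poincare series P_m (m = 0: the Eisenstein series; m = 1: a cusp form), the sum of (c z + d)^-k e(m gamma z) over the bottom rows (c, d). Expanding e(m gamma z) in powers of 1/(c z + d) and applying the Lipschitz formula expresses its n-th coefficient through Bessel functions J_(k-1)(4 pi sqrt(mn)/c).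

Lower bound: for 4 pi sqrt(n) <= k - 1 a Riccati barrier shows that the c = 1 term of the n-th coefficient of P_1 is positive and dominates all others. As P_1 is a nonzero cusp form, some coefficient is negative, necessarily with a larger index.

Upper bound: on the segment from the Eisenstein series to a form whose first negative coefficient has index r, the last form with nonnegative coefficients has a vanishing coefficient of some index n >= r. If f = 1 + ... has nonnegative coefficients, comparing f(is) with f(i/s) = s^k f(is) for s = k (log k + log log k - 1) / (2 pi) bounds f(i/s) by about s^k, which bounds the invariant function y^(k/2) |f - E| on the whole upper half-plane and hence, by Hecke's argument, the coefficients of f - E by about s^k n^(k/2). A vanishing coefficient of f makes that of f - E as large as (2 pi)^k n^(k-1) / (k-1)!, so n is small. *)

(** * Complex series *)

(** The hypothesis 4 | k makes i^k = 1, so f(i/y) = y^k f(iy) holds on the imaginary axis without a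
    sign and positivity passes between y and 1/y. The height s is dictated by exp(log k + log log k
    - 1) = k log k / e: it makes s^k e^(-2 pi s) the k-th power of a number below 0.61, so that the
    nonconstant terms at is, multiplied by s^k, are a small fraction of those at i/s. In the final
    comparison n^(k/2 - 1) is left on one side, and the constant 7316 leaves the geometric factor
    ((4 pi^2 e)^2 / 7316)^(k/2), at least (3/2)^(k/2), on the other. It has to pay for the missing
    power of n and for all numerical losses. In weight 12 the lower bound is below 1, and the
    barrier behind it does not reach the first coefficient of P_1. A second barrier, continued past
    the end of the first, shows that this coefficient is positive, hence that P_1 is not zero. *)

Notation sums := (is_series (K := C_AbsRing) (V := C_NormedModule)).

(** The last index is excluded, so that concatenation and splitting into residue classes carry no
    off-by-one. *)
Fixpoint csum (u : nat -> C) (n : nat) : C :=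
  match n with O => 0%C | S m => (csum u m + u m)%C end.

Lemma C_ext (x y : C) : Re x = Re y -> Im x = Im y -> x = y.
Proof. destruct x, y; simpl; intros; subst; reflexivity. Qed.

Lemma Cmod_minus_sym (x y : C) : Cmod (x - y)%C = Cmod (y - x)%C.
Proof. rewrite <- Cmod_opp. f_equal. ring. Qed.

Lemma Cmod_reverse_triangle (x y : C) : Cmod x - Cmod y <= Cmod (x + y)%C.
Proof.
  pose proof (Cmod_triangle (x + y)%C (- y)%C) as H.
  rewrite Cmod_opp in H. replace (x + y + - y)%C with x in H by ring. lra.
Qed.

Lemma Im_le_Cmod (z : C) : Rabs (Im z) <= Cmod z.
Proof. eapply Rle_trans; [apply Rmax_r | apply Rmax_Cmod]. Qed.

Lemma Cmod_le_Re_Im (z : C) : Cmod z <= Rabs (Re z) + Rabs (Im z).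
Proof.
  assert (H := Cmod2_alt z).
  pose proof (Cmod_ge_0 z). pose proof (Rabs_pos (Re z)). pose proof (Rabs_pos (Im z)).
  apply Rsqr_incr_0; [|lra|lra]. rewrite !Rsqr_pow2, H.
  rewrite <- (pow2_abs (Re z)), <- (pow2_abs (Im z)). nra.
Qed.

Lemma sum_n_csum (u : nat -> C) (n : nat) :
  sum_n (G := C_AbelianMonoid) u n = csum u (S n).
Proof.
  induction n as [|n IH].
  - rewrite sum_O. simpl. ring.
  - rewrite sum_Sn, IH. reflexivity.
Qed.

Lemma sums_eps (u : nat -> C) (l : C) :
  sums u l <->
  (forall eps, 0 < eps -> exists N, forall n, (N <= n)%nat -> Cmod (csum u n - l) < eps).
Proof.
  split.
  - intros H eps He.
    assert (HL := proj1 (filterlim_locally_ball_norm (K := C_AbsRing) (U := C_NormedModule)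
       (F := eventually) (sum_n u) l) H (mkposreal eps He)).
    destruct HL as [N HN]. exists (S N). intros n Hn.
    destruct n as [|n]; [lia|]. specialize (HN n ltac:(lia)).
    rewrite <- sum_n_csum. exact HN.
  - intros H.
    apply (proj2 (filterlim_locally_ball_norm (K := C_AbsRing) (U := C_NormedModule)
       (F := eventually) (sum_n u) l)).
    intros eps. destruct (H eps (cond_pos eps)) as [N HN]. exists N. intros n Hn.
    specialize (HN (S n) ltac:(lia)). rewrite <- sum_n_csum in HN. exact HN.
Qed.

Lemma csum_ext (u v : nat -> C) (n : nat) :
  (forall i, (i < n)%nat -> u i = v i) -> csum u n = csum v n.
Proof.
  induction n as [|n IH]; intros H; simpl; [reflexivity|].
  rewrite IH by (intros; apply H; lia). rewrite H by lia. reflexivity.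
Qed.

Lemma csum_plus (u v : nat -> C) (n : nat) :
  csum (fun i => (u i + v i)%C) n = (csum u n + csum v n)%C.
Proof. induction n as [|n IH]; simpl; [ring|]. rewrite IH. ring. Qed.

Lemma csum_scal (c : C) (u : nat -> C) (n : nat) :
  csum (fun i => (c * u i)%C) n = (c * csum u n)%C.
Proof. induction n as [|n IH]; simpl; [ring|]. rewrite IH. ring. Qed.

Lemma csum_opp (u : nat -> C) (n : nat) :
  csum (fun i => (- u i)%C) n = (- csum u n)%C.
Proof. induction n as [|n IH]; simpl; [ring|]. rewrite IH. ring. Qed.

Lemma csum_add (u : nat -> C) (n m : nat) :
  csum u (n + m) = (csum u n + csum (fun i => u (n + i)%nat) m)%C.
Proof.
  induction m as [|m IH]; simpl.
  - rewrite Nat.add_0_r. ring.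
  - rewrite Nat.add_succ_r. simpl. rewrite IH. ring.
Qed.

Lemma csum_const (c : C) (n : nat) : csum (fun _ => c) n = (RtoC (INR n) * c)%C.
Proof.
  induction n as [|n IH]; [simpl; ring|].
  simpl csum. rewrite IH, S_INR, RtoC_plus. ring.
Qed.

Lemma csum_zero (u : nat -> C) (n : nat) :
  (forall i, (i < n)%nat -> u i = 0%C) -> csum u n = 0%C.
Proof.
  induction n as [|n IH]; intros H; simpl; [reflexivity|].
  rewrite IH by (intros; apply H; lia). rewrite H by lia. ring.
Qed.

Lemma csum_swap (a : nat -> nat -> C) (n m : nat) :
  csum (fun i => csum (a i) m) n = csum (fun j => csum (fun i => a i j) n) m.
Proof.
  induction n as [|n IH]; simpl.
  - symmetry. apply csum_zero. reflexivity.
  - rewrite IH, csum_plus. reflexivity.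
Qed.

(* [sum_f_R0 p n - p n] is the sum of [p i] over [i < n], as [sum_f_R0] includes the last index. *)
Lemma csum_Cmod_le (u : nat -> C) (p : nat -> R) (n : nat) :
  (forall i, (i < n)%nat -> Cmod (u i) <= p i) ->
  Cmod (csum u n) <= sum_f_R0 p n - p n.
Proof.
  induction n as [|n IH]; intros H; simpl.
  - rewrite Cmod_0. lra.
  - eapply Rle_trans; [apply Cmod_triangle|].
    specialize (IH ltac:(intros; apply H; lia)). specialize (H n ltac:(lia)). lra.
Qed.

Lemma csum_group (u : nat -> C) (c n : nat) :
  csum u (c * n) = csum (fun r => csum (fun l => u (r + c * l)%nat) n) c.
Proof.
  rewrite csum_swap. induction n as [|n IH]; simpl.
  - rewrite Nat.mul_0_r. reflexivity.
  - rewrite Nat.mul_succ_r, csum_add, IH. f_equal.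
    apply csum_ext. intros i _. f_equal. lia.
Qed.

Lemma Re_csum (u : nat -> C) (n : nat) :
  Re (csum u (S n)) = sum_n (fun i => Re (u i)) n.
Proof.
  induction n as [|n IH]; [rewrite sum_O; apply Rplus_0_l|].
  rewrite sum_Sn, <- IH. reflexivity.
Qed.

Lemma Im_csum (u : nat -> C) (n : nat) :
  Im (csum u (S n)) = sum_n (fun i => Im (u i)) n.
Proof.
  induction n as [|n IH]; [rewrite sum_O; apply Rplus_0_l|].
  rewrite sum_Sn, <- IH. reflexivity.
Qed.

Lemma is_series_eps (a : nat -> R) (l : R) :
  is_series a l <->
  (forall eps, 0 < eps -> exists N, forall n, (N <= n)%nat -> Rabs (sum_n a n - l) < eps).
Proof.
  split.
  - intros H eps He.
    destruct (proj1 (filterlim_locally (F := eventually) (sum_n a) l) H (mkposreal eps He))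
      as [N HN].
    exists N. intros n Hn. exact (HN n Hn).
  - intros H. apply (proj2 (filterlim_locally (F := eventually) (sum_n a) l)).
    intros eps. destruct (H eps (cond_pos eps)) as [N HN]. exists N. exact HN.
Qed.

Lemma sums_Re_Im (u : nat -> C) (l : C) :
  sums u l <->
  is_series (fun n => Re (u n)) (Re l) /\ is_series (fun n => Im (u n)) (Im l).
Proof.
  rewrite sums_eps, !is_series_eps. split.
  - intros H; split; intros eps He; destruct (H eps He) as [N HN]; exists N; intros n Hn;
      specialize (HN (S n) ltac:(lia)); eapply Rle_lt_trans; try exact HN.
    + rewrite <- Re_csum. eapply Rle_trans; [|apply re_le_Cmod]. apply Req_le. reflexivity.
    + rewrite <- Im_csum. eapply Rle_trans; [|apply Im_le_Cmod]. apply Req_le. reflexivity.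
  - intros [H1 H2] eps He.
    destruct (H1 (eps / 2) ltac:(lra)) as [N1 HN1].
    destruct (H2 (eps / 2) ltac:(lra)) as [N2 HN2].
    exists (S (N1 + N2)). intros n Hn. destruct n as [|n]; [lia|].
    specialize (HN1 n ltac:(lia)). specialize (HN2 n ltac:(lia)).
    eapply Rle_lt_trans; [apply Cmod_le_Re_Im|].
    rewrite <- Re_csum in HN1. rewrite <- Im_csum in HN2.
    change (Re (csum u (S n) - l)) with (Re (csum u (S n)) - Re l).
    change (Im (csum u (S n) - l)) with (Im (csum u (S n)) - Im l). lra.
Qed.

Lemma ex_series_mult_l (c : R) (p : nat -> R) : ex_series p -> ex_series (fun n => c * p n).
Proof. apply (ex_series_scal_l (K := R_AbsRing) (V := R_NormedModule)). Qed.

Lemma ex_series_dominated (p q : nat -> R) : (forall n, Rabs (p n) <= q n) -> ex_series q -> ex_series p.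
Proof. apply (ex_series_le (K := R_AbsRing) (V := R_CompleteNormedModule)). Qed.

(** Total, as [Series] is: the value is informative only together with a proof of [sums]. *)
Definition CSeries (u : nat -> C) : C :=
  (Series (fun n => Re (u n)), Series (fun n => Im (u n))).

Lemma sums_CSeries (u : nat -> C) (l : C) : sums u l -> CSeries u = l.
Proof.
  intros H. apply sums_Re_Im in H. destruct H as [H1 H2].
  apply C_ext; simpl; apply is_series_unique; assumption.
Qed.

Lemma sums_unique (u : nat -> C) (l l' : C) : sums u l -> sums u l' -> l = l'.
Proof.
  intros H H'. rewrite <- (sums_CSeries _ _ H). apply sums_CSeries. exact H'.
Qed.

Lemma sums_ext (u v : nat -> C) (l : C) :
  (forall n, u n = v n) -> sums u l -> sums v l.
Proof. apply (is_series_ext (K := C_AbsRing) (V := C_NormedModule)). Qed.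

Lemma sums_plus (u v : nat -> C) (l m : C) :
  sums u l -> sums v m -> sums (fun n => (u n + v n)%C) (l + m)%C.
Proof. apply (is_series_plus (K := C_AbsRing) (V := C_NormedModule)). Qed.

Lemma sums_scal (c : C) (u : nat -> C) (l : C) :
  sums u l -> sums (fun n => (c * u n)%C) (c * l)%C.
Proof. apply (is_series_scal (K := C_AbsRing) (V := C_NormedModule)). Qed.

Lemma sums_opp (u : nat -> C) (l : C) :
  sums u l -> sums (fun n => (- u n)%C) (- l)%C.
Proof. apply (is_series_opp (K := C_AbsRing) (V := C_NormedModule)). Qed.

Lemma sums_incr_n (u : nat -> C) (l : C) (N : nat) :
  sums u l -> sums (fun n => u (N + n)%nat) (l - csum u N)%C.
Proof.
  rewrite !sums_eps. intros H eps He. destruct (H eps He) as [M HM].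
  exists M. intros n Hn. specialize (HM (N + n)%nat ltac:(lia)).
  rewrite csum_add in HM.
  replace (csum (fun n => u (N + n)%nat) n - (l - csum u N))%C
    with (csum u N + csum (fun n => u (N + n)%nat) n - l)%C by ring. exact HM.
Qed.

Lemma sums_incr_1 (u : nat -> C) (l : C) :
  sums u l -> sums (fun n => u (S n)) (l - u 0%nat)%C.
Proof.
  intros H. apply (sums_incr_n _ _ 1) in H. simpl in H.
  replace (l - u 0%nat)%C with (l - (0 + u 0%nat))%C by ring. exact H.
Qed.

Lemma sums_finite (u : nat -> C) (N : nat) :
  (forall n, (N <= n)%nat -> u n = 0%C) -> sums u (csum u N).
Proof.
  intros H. apply sums_eps. intros eps He. exists N. intros n Hn.
  replace n with (N + (n - N))%nat by lia. rewrite csum_add.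
  rewrite (csum_zero (fun i => u (N + i)%nat)) by (intros; apply H; lia).
  replace (csum u N + 0 - csum u N)%C with (RtoC 0) by ring. rewrite Cmod_0. exact He.
Qed.

Lemma sums_csum (u : nat -> nat -> C) (l : nat -> C) (N : nat) :
  (forall j, (j < N)%nat -> sums (u j) (l j)) ->
  sums (fun n => csum (fun j => u j n) N) (csum l N).
Proof.
  induction N as [|N IH]; intros H; simpl.
  - apply (sums_finite (fun _ => 0%C) 0). reflexivity.
  - apply sums_plus; [apply IH; intros; apply H; lia | apply H; lia].
Qed.

Lemma sums_Cconj (u : nat -> C) (l : C) :
  sums u l -> sums (fun n => Cconj (u n)) (Cconj l).
Proof.
  rewrite !sums_Re_Im. intros [H1 H2]. split; [exact H1|].
  apply (is_series_ext (fun n => opp (Im (u n)))); [reflexivity|].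
  apply (is_series_opp (fun n => Im (u n)) (Im l)). exact H2.
Qed.

Lemma sums_RtoC (a : nat -> R) (l : R) :
  is_series a l -> sums (fun n => RtoC (a n)) (RtoC l).
Proof.
  intros H. apply sums_Re_Im. split; [exact H|].
  apply is_series_eps. intros eps He. exists 0%nat. intros n _. simpl.
  rewrite sum_n_Reals. rewrite sum_eq_R0 by reflexivity.
  rewrite Rminus_0_r, Rabs_R0. exact He.
Qed.

Lemma sums_Rabs (u : nat -> C) (p : nat -> R) :
  (forall n, Cmod (u n) <= p n) -> ex_series p -> sums u (CSeries u).
Proof.
  intros H Hp. apply sums_Re_Im. split; simpl; apply Series_correct;
    apply (ex_series_dominated _ p); auto;
    intros n; eapply Rle_trans; [apply re_le_Cmod|apply H|apply Im_le_Cmod|apply H].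
Qed.

Lemma partial_sum_le_Series (p : nat -> R) (n : nat) :
  (forall i, 0 <= p i) -> ex_series p -> sum_f_R0 p n <= Series p.
Proof.
  intros Hp He. rewrite (Series_incr_n p (S n)) by (auto; lia). simpl.
  assert (0 <= Series (fun k => p (S (n + k)))); [|lra].
  replace 0 with (Series (fun _ => 0)).
  - apply Series_le; [intros; split; [lra|apply Hp]|].
    apply (ex_series_incr_n p (S n)). exact He.
  - apply is_series_unique. apply is_series_eps. intros eps Heps. exists 0%nat. intros m _.
    rewrite sum_n_Reals, sum_eq_R0 by reflexivity. rewrite Rminus_0_r, Rabs_R0. exact Heps.
Qed.

Lemma sums_bound (u : nat -> C) (l : C) (p : nat -> R) :
  sums u l -> (forall n, Cmod (u n) <= p n) -> ex_series p -> Cmod l <= Series p.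
Proof.
  intros H Hu Hp. apply Rnot_lt_le. intros Hlt.
  destruct (proj1 (sums_eps u l) H (Cmod l - Series p) ltac:(lra)) as [N HN].
  specialize (HN N (le_n N)).
  assert (Hp0 : forall i, 0 <= p i) by (intros; eapply Rle_trans; [apply Cmod_ge_0|apply Hu]).
  pose proof (csum_Cmod_le u p N (fun i _ => Hu i)) as H1.
  pose proof (partial_sum_le_Series p N Hp0 Hp) as H2. specialize (Hp0 N).
  pose proof (Cmod_triangle (csum u N) (l - csum u N)%C) as H3.
  replace (csum u N + (l - csum u N))%C with l in H3 by ring.
  rewrite (Cmod_minus_sym l) in H3. lra.
Qed.

Lemma Series_tail_eps (p : nat -> R) : ex_series p ->
  forall eps, 0 < eps -> exists N, forall n, (N <= n)%nat ->
  Rabs (Series (fun k => p (n + k)%nat)) < eps.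
Proof.
  intros Hp eps He.
  destruct (proj1 (is_series_eps p _) (Series_correct p Hp) eps He) as [N HN].
  exists (S N). intros n Hn. destruct n as [|n]; [lia|].
  specialize (HN n ltac:(lia)). rewrite sum_n_Reals in HN.
  rewrite (Series_incr_n p (S n)) in HN by (auto; lia). simpl in HN.
  rewrite <- Rabs_Ropp. eapply Rle_lt_trans; [|exact HN]. apply Req_le. f_equal. simpl. ring.
Qed.

Lemma ex_series_tail (p : nat -> R) (n : nat) :
  ex_series p -> ex_series (fun k => p (n + k)%nat).
Proof. apply ex_series_incr_n. Qed.

Lemma sums_tail_bound (u : nat -> C) (l : C) (p : nat -> R) (N : nat) :
  sums u l -> (forall n, Cmod (u n) <= p n) -> ex_series p ->
  Cmod (l - csum u N) <= Series (fun k => p (N + k)%nat).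
Proof.
  intros H Hu Hp. apply (sums_bound (fun n => u (N + n)%nat)).
  - apply sums_incr_n. exact H.
  - intros. apply Hu.
  - apply ex_series_tail. exact Hp.
Qed.

(** Fubini's theorem under a product majorant. The sum of the first n columns differs from the sum
    of all rows by at most the sum of [p] times the tail of [q] from n on, which tends to 0. *)
Lemma sums_swap (a : nat -> nat -> C) (p q : nat -> R) (r c : nat -> C) :
  (forall i j, Cmod (a i j) <= p i * q j) ->
  (forall i, 0 <= p i) -> ex_series p -> ex_series q ->
  (forall i, sums (a i) (r i)) -> (forall j, sums (fun i => a i j) (c j)) ->
  sums r (CSeries r) /\ sums c (CSeries r).
Proof.
  intros Ha Hp0 Hp Hq Hr Hc.
  assert (Hscal : forall i, ex_series (fun j => p i * q j)).
  { intros i. exact (ex_series_mult_l (p i) q Hq). }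
  assert (HpQ : forall Q, ex_series (fun i => p i * Q)) by (intros; apply ex_series_scal_r, Hp).
  assert (Hrp : forall i, Cmod (r i) <= p i * Series q).
  { intros i. rewrite <- Series_scal_l. apply (sums_bound (a i)); auto. }
  assert (HS := sums_Rabs r _ Hrp (HpQ _)).
  split; [exact HS|].
  apply sums_eps. intros eps He.
  set (P := Series p).
  assert (HP : 0 <= P).
  { eapply Rle_trans; [|apply (partial_sum_le_Series p 0 Hp0 Hp)]. simpl. apply Hp0. }
  destruct (Series_tail_eps q Hq (eps / (P + 1))) as [N HN].
  { apply Rdiv_lt_0_compat; lra. }
  exists N. intros n Hn. specialize (HN n Hn).
  set (T := Series (fun k => q (n + k)%nat)) in *.
  assert (Hdiff : sums (fun i => (r i + - csum (a i) n)%C) (CSeries r + - csum c n)%C).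
  { apply sums_plus; [exact HS|]. apply sums_opp. apply sums_csum. intros j _. apply Hc. }
  apply sums_bound with (p := fun i => p i * T) in Hdiff.
  - rewrite Series_scal_r in Hdiff. fold P in Hdiff.
    rewrite Cmod_minus_sym. eapply Rle_lt_trans; [exact Hdiff|].
    pose proof (Rle_abs T).
    apply Rle_lt_trans with (P * (eps / (P + 1))); [nra|].
    apply Rmult_lt_reg_r with (P + 1); [lra|]. field_simplify; [nra|lra].
  - intros i. unfold T. rewrite <- Series_scal_l.
    apply (sums_tail_bound (a i) (r i) (fun j => p i * q j)); auto.
  - apply HpQ.
Qed.

(** * Termwise limits and regrouping of series *)

Definition Clim (u : nat -> C) (l : C) : Prop :=
  forall eps, 0 < eps -> exists N, forall n, (N <= n)%nat -> Cmod (u n - l) < eps.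

Lemma Clim_csum (a : nat -> nat -> C) (A : nat -> C) (N : nat) :
  (forall l, Clim (fun M => a M l) (A l)) ->
  Clim (fun M => csum (a M) N) (csum A N).
Proof.
  intros H. induction N as [|N IH]; simpl; intros eps He.
  - exists 0%nat. intros. replace (0 - 0)%C with (RtoC 0) by ring. rewrite Cmod_0. exact He.
  - destruct (IH (eps / 2) ltac:(lra)) as [N1 H1].
    destruct (H N (eps / 2) ltac:(lra)) as [N2 H2].
    exists (N1 + N2)%nat. intros n Hn.
    specialize (H1 n ltac:(lia)). specialize (H2 n ltac:(lia)).
    replace (csum (a n) N + a n N - (csum A N + A N))%C
      with ((csum (a n) N - csum A N) + (a n N - A N))%C by ring.
    eapply Rle_lt_trans; [apply Cmod_triangle|]. lra.
Qed.

(** Cut the finite sums at a fixed n: the head converges term by term, and the rest is at most the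
    tail of [D], uniformly in M. The M-th sum has M terms and is eventually equal to [v], the shape
    in which a distribution relation provides it. *)
Lemma tannery (a : nat -> nat -> C) (A : nat -> C) (D : nat -> R) (v : C) :
  (forall l, Clim (fun M => a M l) (A l)) ->
  (exists M0, forall M l, (M0 <= M)%nat -> (l < M)%nat -> Cmod (a M l) <= D l) ->
  ex_series D -> (exists M0, forall M, (M0 <= M)%nat -> csum (a M) M = v) ->
  sums A v.
Proof.
  intros HA [M0 HD] HDs [M1 Hv].
  apply sums_eps. intros eps He.
  destruct (Series_tail_eps D HDs (eps / 2) ltac:(lra)) as [N HN].
  exists N. intros n Hn. specialize (HN n Hn).
  destruct (Clim_csum a A n HA (eps / 2) ltac:(lra)) as [M2 HM2].
  set (M := (M0 + M1 + M2 + n + 1)%nat).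
  specialize (HM2 M ltac:(unfold M; lia)).
  assert (E := Hv M ltac:(unfold M; lia)).
  replace M with (n + (M - n))%nat in E at 2 by (unfold M; lia).
  rewrite csum_add in E.
  assert (Ht : Cmod (csum (fun i => a M (n + i)%nat) (M - n)) <= Series (fun k => D (n + k)%nat)).
  { apply (sums_bound (fun i => if (i <? M - n)%nat then a M (n + i)%nat else 0%C)).
    - rewrite (csum_ext _ (fun i => if (i <? M - n)%nat then a M (n + i)%nat else 0%C)).
      + apply sums_finite. intros i Hi. apply Nat.ltb_ge in Hi. rewrite Hi. reflexivity.
      + intros i Hi. apply Nat.ltb_lt in Hi. rewrite Hi. reflexivity.
    - intros i. destruct (Nat.ltb_spec i (M - n)).
      + apply HD; unfold M in *; lia.
      + rewrite Cmod_0. eapply Rle_trans; [apply Cmod_ge_0|apply (HD (M + n + i + 1)%nat); unfold M; lia].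
    - apply ex_series_tail. exact HDs. }
  replace (csum A n - v)%C with
    (- (csum (a M) n - csum A n) + - csum (fun i => a M (n + i)%nat) (M - n))%C
    by (rewrite <- E; ring).
  eapply Rle_lt_trans; [apply Cmod_triangle|]. rewrite !Cmod_opp.
  pose proof (Rle_abs (Series (fun k => D (n + k)%nat))). lra.
Qed.

(** Both sides are the limit of the partial sums of [u] at multiples of [c]. *)
Lemma sums_group (u : nat -> C) (S : C) (c : nat) (s : nat -> C) :
  (0 < c)%nat -> sums u S -> (forall r, (r < c)%nat -> sums (fun l => u (r + c * l)%nat) (s r)) ->
  csum s c = S.
Proof.
  intros Hc HS Hs.
  assert (H := sums_csum (fun r l => u (r + c * l)%nat) s c Hs).
  apply (sums_unique (fun l => csum (fun r => u (r + c * l)%nat) c)); [exact H|].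
  apply sums_eps. intros eps He. destruct (proj1 (sums_eps u S) HS eps He) as [N HN].
  exists N. intros n Hn. specialize (HN (c * n)%nat ltac:(nia)).
  rewrite csum_group, csum_swap in HN. exact HN.
Qed.

(** * The complex exponential *)

Lemma pow_n_Cpow (z : C) (n : nat) : pow_n (K := C_Ring) z n = (z ^ n)%C.
Proof. induction n as [|n IH]; [reflexivity|]. simpl. rewrite IH. reflexivity. Qed.

Lemma cexp_plus (w v : C) : cexp (w + v)%C = (cexp w * cexp v)%C.
Proof.
  destruct w as [a b], v as [c d]. unfold cexp, Cplus, Cmult, Re, Im; simpl.
  rewrite exp_plus, cos_plus, sin_plus. f_equal; ring.
Qed.

Lemma cexp_0 : cexp 0 = 1%C.
Proof.
  unfold cexp, RtoC, Re, Im; simpl. rewrite exp_0, cos_0, sin_0. f_equal; ring.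
Qed.

Lemma Cmod_cexp (w : C) : Cmod (cexp w) = exp (Re w).
Proof.
  unfold cexp, Cmod; simpl.
  rewrite !Rmult_1_r.
  replace (_ + _) with (Rsqr (exp (Re w)) * (Rsqr (sin (Im w)) + Rsqr (cos (Im w))))
    by (unfold Rsqr; ring).
  rewrite sin2_cos2, Rmult_1_r. apply sqrt_Rsqr. left. apply exp_pos.
Qed.

Lemma cexp_pow (w : C) (n : nat) : (cexp w ^ n)%C = cexp (INR n * w)%C.
Proof.
  induction n as [|n IH].
  - simpl. rewrite <- cexp_0. f_equal. ring.
  - rewrite Cpow_S, IH, <- cexp_plus, S_INR, RtoC_plus. f_equal. ring.
Qed.

Lemma Cconj_cexp (w : C) : Cconj (cexp w) = cexp (Cconj w).
Proof.
  destruct w as [a b]. unfold Cconj, cexp, Re, Im; simpl. rewrite cos_neg, sin_neg.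
  f_equal; ring.
Qed.

Lemma Re_mult_cexp_derive (c w : C) (t : R) :
  is_derive (fun t : R => Re (c * cexp (t * w))%C) t (Re (c * w * cexp (t * w))%C).
Proof.
  destruct c as [c1 c2], w as [a b]. unfold cexp, Re, Im, Cmult, RtoC; simpl.
  auto_derive; [exact I|].
  unfold Rminus. rewrite !Rmult_0_l, !Ropp_0, !Rplus_0_r, !Rmult_1_l. apply Rminus_diag_uniq. ring.
Qed.

Lemma Derive_n_Re_cexp (c w : C) (n : nat) (t : R) :
  ex_derive_n (fun t : R => Re (c * cexp (t * w))%C) n t /\
  Derive_n (fun t : R => Re (c * cexp (t * w))%C) n t = Re (c * w ^ n * cexp (t * w))%C.
Proof.
  revert t. induction n as [|n IH]; intros t.
  - split; [exact I|]. change (w ^ 0)%C with (RtoC 1). rewrite Cmult_1_r. reflexivity.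
  - pose proof (Re_mult_cexp_derive (c * w ^ n)%C w t) as E.
    replace (c * w ^ n * w)%C with (c * w ^ S n)%C in E by (rewrite Cpow_S; ring).
    assert (E' : is_derive (Derive_n (fun t : R => Re (c * cexp (t * w))%C) n) t
                 (Re (c * w ^ S n * cexp (t * w))%C)).
    { eapply is_derive_ext; [|exact E]. intros s. symmetry. apply IH. }
    split.
    + simpl. eexists. exact E'.
    + simpl. apply is_derive_unique. exact E'.
Qed.

Lemma pow_div_fact_le_exp (x : R) (n : nat) : 0 <= x -> x ^ n / INR (fact n) <= exp x.
Proof.
  intros Hx.
  assert (Hs : is_series (fun n => x ^ n / INR (fact n)) (exp x)).
  { pose proof (is_exp_Reals x) as H. apply is_pseries_R in H.
    refine (is_series_ext _ _ _ _ H). intros m. simpl. unfold Rdiv. ring. }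
  rewrite <- (is_series_unique _ _ Hs).
  assert (Hp : forall i, 0 <= x ^ i / INR (fact i)).
  { intros i. apply Rmult_le_pos; [apply pow_le, Hx|left; apply Rinv_0_lt_compat, INR_fact_lt_0]. }
  eapply Rle_trans; [|apply (partial_sum_le_Series _ n Hp); eexists; exact Hs].
  destruct n as [|n]; [simpl; lra|]. rewrite tech5.
  assert (0 <= sum_f_R0 (fun n0 => x ^ n0 / INR (fact n0)) n) by (apply cond_pos_sum; exact Hp).
  lra.
Qed.

Lemma is_series_exp (x : R) : is_series (fun n => x ^ n / INR (fact n)) (exp x).
Proof.
  pose proof (is_exp_Reals x) as H. apply is_pseries_R in H.
  refine (is_series_ext _ _ _ _ H). intros m. simpl. unfold Rdiv. ring.
Qed.

(** Taylor-Lagrange for the real function Re (c e^(tw)) on [0, 1]: the remainder is at most |c|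
    e^|w| |w|^(n+1) / (n+1)!. The factor [c] is there for the imaginary part, which is the case c =
    -i. *)
Lemma Re_cexp_series (c w : C) :
  is_series (fun n => Re (c * (w ^ n * / INR (fact n)))%C) (Re (c * cexp w)%C).
Proof.
  apply is_series_eps. intros eps He.
  set (K := Cmod c * exp (Cmod w)).
  assert (HK : 0 <= K) by (apply Rmult_le_pos; [apply Cmod_ge_0|left; apply exp_pos]).
  assert (Hlim := ex_series_lim_0 _ (ex_intro _ _ (is_series_exp (Cmod w)))).
  apply is_lim_seq_spec in Hlim.
  assert (HK1 : 0 < eps / (K + 1)) by (apply Rdiv_lt_0_compat; lra).
  destruct (Hlim (mkposreal _ HK1)) as [N HN]. exists N. intros n Hn.
  specialize (HN (S n) ltac:(lia)). simpl pos in HN. rewrite Rminus_0_r in HN.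
  destruct (Taylor_Lagrange (fun t : R => Re (c * cexp (t * w))%C) n 0 1 ltac:(lra)) as [zeta [Hz E]].
  { intros t _ k _. apply Derive_n_Re_cexp. }
  replace (1 * w)%C with w in E by ring. rewrite E.
  rewrite (proj2 (Derive_n_Re_cexp c w (S n) zeta)).
  rewrite sum_n_Reals.
  replace (sum_f_R0 (fun m => (1 - 0) ^ m / INR (fact m) *
      Derive_n (fun t : R => Re (c * cexp (t * w))%C) m 0) n)
    with (sum_f_R0 (fun n => Re (c * (w ^ n * / INR (fact n)))%C) n).
  2:{ apply sum_eq. intros i _. rewrite (proj2 (Derive_n_Re_cexp c w i 0)).
      replace (RtoC 0 * w)%C with (RtoC 0) by ring. rewrite cexp_0, Rminus_0_r, pow1.
      rewrite <- RtoC_inv by apply INR_fact_neq_0.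
      destruct (w ^ i)%C as [a b], c as [c1 c2].
      unfold Re, Cmult, RtoC; simpl. field. apply INR_fact_neq_0. }
  unfold Rminus at 1. rewrite Ropp_plus_distr, <- Rplus_assoc, Rplus_opp_r, Rplus_0_l, Rabs_Ropp.
  rewrite Rminus_0_r, pow1.
  rewrite Rabs_mult.
  assert (H1 : Rabs (Re (c * w ^ S n * cexp (zeta * w))%C) <= K * Cmod w ^ S n).
  { eapply Rle_trans; [apply re_le_Cmod|]. rewrite !Cmod_mult, Cmod_pow, Cmod_cexp.
    unfold K. replace (Cmod c * exp (Cmod w) * Cmod w ^ S n)
      with (Cmod c * Cmod w ^ S n * exp (Cmod w)) by ring.
    apply Rmult_le_compat_l.
    - apply Rmult_le_pos; [apply Cmod_ge_0|apply pow_le, Cmod_ge_0].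
    - assert (Hre : Re (zeta * w)%C <= Cmod w).
      { replace (Re (zeta * w)%C) with (zeta * Re w)
          by (destruct w; unfold Re, Cmult, RtoC; simpl; ring).
        pose proof (re_le_Cmod w) as Hw. pose proof (Rle_abs (Re w)).
        pose proof (Cmod_ge_0 w). nra. }
      destruct Hre as [Hre|Hre]; [left; apply exp_increasing, Hre|rewrite Hre; right; reflexivity]. }
  assert (Hf := INR_fact_lt_0 (S n)).
  rewrite Rabs_pos_eq in HN.
  2:{ apply Rmult_le_pos; [apply pow_le, Cmod_ge_0|left; apply Rinv_0_lt_compat, Hf]. }
  rewrite Rabs_pos_eq.
  2:{ apply Rmult_le_pos; [lra|left; apply Rinv_0_lt_compat, Hf]. }
  apply Rle_lt_trans with (K * (Cmod w ^ S n / INR (fact (S n)))).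
  - unfold Rdiv. rewrite Rmult_1_l.
    replace (K * (Cmod w ^ S n * / INR (fact (S n)))) with (/ INR (fact (S n)) * (K * Cmod w ^ S n)) by ring.
    apply Rmult_le_compat_l; [left; apply Rinv_0_lt_compat, Hf|exact H1].
  - apply Rle_lt_trans with (K * (eps / (K + 1))).
    + apply Rmult_le_compat_l; [exact HK|left; exact HN].
    + apply Rmult_lt_reg_r with (K + 1); [lra|]. field_simplify; [nra|lra].
Qed.

Lemma cexp_series (w : C) : sums (fun n => (w ^ n * / INR (fact n))%C) (cexp w).
Proof.
  apply sums_Re_Im. split.
  - pose proof (Re_cexp_series 1 w) as H. rewrite Cmult_1_l in H.
    refine (is_series_ext _ _ _ _ H). intros n. rewrite Cmult_1_l. reflexivity.
  - pose proof (Re_cexp_series (- Ci)%C w) as H.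
    replace (Im (cexp w)) with (Re (- Ci * cexp w)%C).
    + refine (is_series_ext _ _ _ _ H). intros n. simpl.
      destruct (w ^ n * / INR (fact n))%C as [a b]. unfold Re, Im; simpl. ring.
    + destruct (cexp w) as [a b]. unfold Re, Im; simpl. ring.
Qed.

Lemma Cmod_cexp_sub_1 (w : C) : Cmod (cexp w - 1 - w)%C <= Cmod w ^ 2 * exp (Cmod w).
Proof.
  assert (H := sums_incr_n _ _ 2 (cexp_series w)).
  replace (cexp w - csum (fun n => (w ^ n * / INR (fact n))%C) 2)%C with (cexp w - 1 - w)%C in H.
  2:{ simpl. field. }
  set (p := fun n => Cmod w ^ 2 * (Cmod w ^ n / INR (fact n))).
  rewrite <- (is_series_unique _ _ (is_series_exp (Cmod w))).
  rewrite <- Series_scal_l.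
  apply (sums_bound _ _ p H).
  - intros n. rewrite Cmod_mult, Cmod_pow, <- RtoC_inv by apply INR_fact_neq_0.
    rewrite Cmod_R, Rabs_pos_eq by (left; apply Rinv_0_lt_compat, INR_fact_lt_0).
    unfold p, Rdiv. rewrite pow_add, Rmult_assoc.
    apply Rmult_le_compat_l; [apply pow_le, Cmod_ge_0|].
    apply Rmult_le_compat_l; [apply pow_le, Cmod_ge_0|].
    apply Rinv_le_contravar; [apply INR_fact_lt_0|].
    apply le_INR, fact_le. lia.
  - apply ex_series_mult_l.
    eexists. apply is_series_exp.
Qed.

Lemma qpar_plus (z w : C) : qpar (z + w)%C = (qpar z * qpar w)%C.
Proof. unfold qpar. rewrite <- cexp_plus. f_equal. ring. Qed.

Lemma qpar_0 : qpar 0 = 1%C.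
Proof. unfold qpar. rewrite Cmult_0_r. apply cexp_0. Qed.

Lemma Cmod_qpar (z : C) : Cmod (qpar z) = exp (- 2 * PI * Im z).
Proof.
  unfold qpar. rewrite Cmod_cexp. f_equal. destruct z as [a b].
  unfold Re, Im, Cmult; simpl. ring.
Qed.

Lemma qpar_pow (z : C) (n : nat) : (qpar z ^ n)%C = qpar (INR n * z)%C.
Proof. unfold qpar. rewrite cexp_pow. f_equal. ring. Qed.

Lemma qpar_nat (n : nat) : qpar (INR n) = 1%C.
Proof.
  replace (RtoC (INR n)) with (INR n * 1)%C by ring.
  rewrite <- qpar_pow. replace (qpar 1) with (RtoC 1); [apply Cpow_1_l|].
  unfold qpar, cexp, Cmult, RtoC, Re, Im; simpl.
  rewrite !Rmult_0_l, !Rmult_1_r, !Rmult_0_r, Rminus_0_l, Rplus_0_l, Ropp_0, exp_0, cos_2PI, sin_2PI.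
  f_equal; ring.
Qed.

Lemma qpar_IZR (l : Z) : qpar (IZR l) = 1%C.
Proof.
  assert (H : forall n : nat, qpar (IZR (Z.of_nat n)) = 1%C)
    by (intros; rewrite <- INR_IZR_INZ; apply qpar_nat).
  destruct (Z_le_dec 0 l).
  - rewrite <- (Z2Nat.id l) by assumption. apply H.
  - assert (E : (qpar (IZR l) * qpar (IZR (- l)))%C = 1%C).
    { rewrite <- qpar_plus, <- RtoC_plus, <- plus_IZR, Z.add_opp_diag_r. apply qpar_0. }
    rewrite <- (Z2Nat.id (- l)), H, Cmult_1_r in E by lia. exact E.
Qed.

Lemma qpar_add_IZR (z : C) (l : Z) : qpar (z + IZR l)%C = qpar z.
Proof. rewrite qpar_plus, qpar_IZR. ring. Qed.

Lemma Cconj_qpar (z : C) : Cconj (qpar z) = qpar (- Cconj z)%C.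
Proof.
  unfold qpar. rewrite Cconj_cexp. f_equal. destruct z as [a b].
  apply C_ext; unfold Cconj, Copp, Cmult, Re, Im; simpl; ring.
Qed.

Lemma Cmod_qpar_lt_1 (z : C) : inH z -> Cmod (qpar z) < 1.
Proof.
  intros H. rewrite Cmod_qpar, <- exp_0. apply exp_increasing.
  unfold inH in H. pose proof PI_RGT_0. nra.
Qed.

Lemma inH_neq_0 (z : C) : inH z -> z <> 0%C.
Proof. unfold inH. intros H E. subst. simpl in H. lra. Qed.

Lemma Im_opp_Cinv (z : C) : z <> 0%C -> Im (- / z)%C = Im z / Cmod z ^ 2.
Proof.
  intros Hz. rewrite Cmod2_alt. apply Cmod_gt_0 in Hz.
  assert (0 < Cmod z ^ 2) by (apply pow_lt; exact Hz). rewrite Cmod2_alt in H.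
  destruct z as [a b]. unfold Im, Re in *; simpl in *. field. nra.
Qed.

Lemma inH_opp_Cinv (z : C) : inH z -> inH (- / z)%C.
Proof.
  intros H. unfold inH. rewrite Im_opp_Cinv by (apply inH_neq_0, H).
  apply Rdiv_lt_0_compat; [exact H|]. apply pow_lt, Cmod_gt_0, inH_neq_0, H.
Qed.

(** * q-series *)

Ltac positivity :=
  repeat match goal with
  | |- 0 <= ?a * ?b => apply Rmult_le_pos
  | |- 0 <= ?a / ?b => apply Rmult_le_pos
  | |- 0 <= ?a ^ ?n => apply pow_le
  | |- 0 <= / ?a => apply Rlt_le, Rinv_0_lt_compat
  | |- 0 <= exp _ => apply Rlt_le, exp_pos
  | |- 0 <= Cmod _ => apply Cmod_ge_0
  | |- 0 <= INR _ => apply pos_INR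
  | |- 0 < ?a * ?b => apply Rmult_lt_0_compat
  | |- 0 < ?a / ?b => apply Rdiv_lt_0_compat
  | |- 0 < ?a ^ ?n => apply pow_lt
  | |- 0 < / ?a => apply Rinv_0_lt_compat
  | |- 0 < exp _ => apply exp_pos
  end; try lra.

(** Equivalent to convergence of the sum of b_n q^n on the whole disc |q| < 1; [qser_sums] and
    [sums_subexp] give the two directions. Stated as growth, it passes at once to linear
    combinations and real parts. *)
Definition subexp (b : nat -> C) : Prop :=
  forall eps, 0 < eps -> exists K, forall n, Cmod (b n) <= K * exp (eps * INR n).

Definition qser (b : nat -> C) (z : C) : C := CSeries (fun n => (b n * qpar z ^ n)%C).

Lemma exp_pow_INR (x : R) (n : nat) : exp x ^ n = exp (x * INR n).
Proof.
  induction n as [|n IH]; [simpl; rewrite Rmult_0_r, exp_0; reflexivity|].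
  rewrite S_INR. simpl pow. rewrite IH, <- exp_plus. f_equal. ring.
Qed.

Lemma exp_le_compat (x y : R) : x <= y -> exp x <= exp y.
Proof. intros [H|H]; [left; apply exp_increasing, H|rewrite H; right; reflexivity]. Qed.

Lemma ex_series_exp_neg (K x : R) : 0 < x -> ex_series (fun n => K * exp (- x * INR n)).
Proof.
  intros Hx. apply ex_series_mult_l.
  apply (ex_series_ext (fun n => exp (- x) ^ n)).
  - intros n. apply exp_pow_INR.
  - apply ex_series_geom. rewrite Rabs_pos_eq by (left; apply exp_pos).
    rewrite <- exp_0. apply exp_increasing. lra.
Qed.

Lemma Cmod_qterm (b z : C) (n : nat) :
  Cmod (b * qpar z ^ n)%C = Cmod b * exp (- (2 * PI * Im z) * INR n).
Proof.
  rewrite Cmod_mult, Cmod_pow, Cmod_qpar, exp_pow_INR. do 2 f_equal. ring.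
Qed.

Lemma subexp_bound (b : nat -> C) (y : R) : subexp b -> 0 < y ->
  exists K, 0 <= K /\
  forall n x, y <= x -> Cmod (b n) * exp (- (2 * PI * x) * INR n) <= K * exp (- (PI * y) * INR n).
Proof.
  intros Hb Hy. pose proof PI_RGT_0 as HPI.
  destruct (Hb (PI * y)) as [K HK]; [apply Rmult_lt_0_compat; assumption|].
  assert (HK0 : 0 <= K).
  { specialize (HK 0%nat). simpl INR in HK. rewrite Rmult_0_r, exp_0, Rmult_1_r in HK.
    eapply Rle_trans; [apply Cmod_ge_0|exact HK]. }
  exists K. split; [exact HK0|]. intros n x Hx.
  replace (- (PI * y) * INR n) with (PI * y * INR n + - (2 * PI * y) * INR n) by ring.
  rewrite exp_plus, <- Rmult_assoc.
  apply Rmult_le_compat; [apply Cmod_ge_0|left; apply exp_pos|apply HK|].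
  apply exp_le_compat. pose proof (pos_INR n).
  apply Rmult_le_compat_r; [assumption|]. nra.
Qed.

Lemma qser_sums (b : nat -> C) (z : C) : subexp b -> inH z ->
  sums (fun n => (b n * qpar z ^ n)%C) (qser b z).
Proof.
  intros Hb Hz. destruct (subexp_bound b (Im z) Hb Hz) as [K [HK0 HK]].
  apply (sums_Rabs _ (fun n => K * exp (- (PI * Im z) * INR n))).
  - intros n. rewrite Cmod_qterm. apply HK. lra.
  - apply ex_series_exp_neg. apply Rmult_lt_0_compat; [apply PI_RGT_0|exact Hz].
Qed.

Lemma qser_bounded (b : nat -> C) (y : R) : subexp b -> 0 < y ->
  exists M, forall z, y <= Im z -> Cmod (qser b z) <= M.
Proof.
  intros Hb Hy. destruct (subexp_bound b y Hb Hy) as [K [HK0 HK]].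
  eexists. intros z Hz.
  apply (sums_bound _ _ (fun n => K * exp (- (PI * y) * INR n)) (qser_sums b z Hb ltac:(unfold inH; lra))).
  - intros n. rewrite Cmod_qterm. apply HK. lra.
  - apply ex_series_exp_neg. apply Rmult_lt_0_compat; [apply PI_RGT_0|exact Hy].
Qed.

Lemma is_derive_quadratic (f : C -> C) (z l : C) (K d : R) :
  0 < d -> (forall h, Cmod h < d -> Cmod (f (z + h) - f z - l * h)%C <= K * Cmod h ^ 2) ->
  is_derive (K := C_AbsRing) (V := C_NormedModule) f z l.
Proof.
  intros Hd H. split.
  - apply (is_linear_scal_l (K := C_AbsRing) (V := C_NormedModule)).
  - intros x Hx. apply (is_filter_lim_locally_unique (K := C_AbsRing) (V := AbsRing_NormedModule C_AbsRing)) in Hx.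
    subst x. intros eps.
    set (K' := Rabs K + 1).
    assert (HK' : 0 < K') by (unfold K'; pose proof (Rabs_pos K); lra).
    assert (Hd' : 0 < Rmin d (eps / K')).
    { apply Rmin_glb_lt; [exact Hd|]. apply Rdiv_lt_0_compat; [apply cond_pos|exact HK']. }
    apply (locally_le_locally_norm (K := C_AbsRing) (V := AbsRing_NormedModule C_AbsRing)).
    exists (mkposreal _ Hd').
    cut (forall y : C, Cmod (y - z)%C < Rmin d (eps / K') ->
           Cmod ((f y - f z) - (y - z) * l)%C <= eps * Cmod (y - z)%C); [intros Hy; exact Hy|].
    intros y Hy.
    assert (H1 := Rmin_l d (eps / K')). assert (H2 := Rmin_r d (eps / K')).
    specialize (H (y - z)%C ltac:(lra)).
    replace (z + (y - z))%C with y in H by ring.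
    replace (f y - f z - (y - z) * l)%C with (f y - f z - l * (y - z))%C by ring.
    eapply Rle_trans; [exact H|].
    pose proof (Cmod_ge_0 (y - z)%C) as H0.
    replace (K * Cmod (y - z)%C ^ 2) with (K * Cmod (y - z)%C * Cmod (y - z)%C) by ring.
    apply Rmult_le_compat_r; [exact H0|].
    apply Rle_trans with (K' * (eps / K')).
    + unfold K'. pose proof (Rle_abs K). fold K'. unfold K' in *. nra.
    + right. field. lra.
Qed.

Lemma sqr_le_exp (x : R) : 0 <= x -> x ^ 2 <= 2 * exp x.
Proof.
  intros Hx. pose proof (pow_div_fact_le_exp x 2 Hx) as H. simpl in H. simpl. lra.
Qed.

(** Termwise differentiation: the remainder of each exponential is quadratic in h by
    [Cmod_cexp_sub_1], with a bound that is summable over n uniformly for |h| < y/4. *)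
Lemma qser_derivable (b : nat -> C) (z : C) : subexp b -> inH z ->
  ex_derive (K := C_AbsRing) (V := C_NormedModule) (qser b) z.
Proof.
  intros Hb Hz. pose proof PI_RGT_0 as HPI. unfold inH in Hz.
  set (y := Im z) in *.
  set (tau := (RtoC (2 * PI) * Ci)%C).
  set (b' := fun n => (b n * (tau * INR n))%C).
  assert (Hpy : 0 < PI * y) by (apply Rmult_lt_0_compat; assumption).
  (* The decay e^(-2 pi y n) is e^(-8 r n). The coefficients cost e^(r n), the factor n^2 another
     e^(r n), and e^(2 pi |h| n) with |h| < y/4 costs e^(2 r n); what remains is below e^(-2 r
     n). *)
  set (r := PI * y / 4).
  assert (Hr : 0 < r) by (unfold r; lra).
  assert (Hmod_tau : Cmod tau = 2 * PI).
  { unfold tau. rewrite Cmod_mult, Cmod_Ci, Cmod_R, Rabs_pos_eq by lra. ring. }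
  destruct (Hb r Hr) as [K HK].
  assert (HK0 : 0 <= K).
  { specialize (HK 0%nat). simpl INR in HK. rewrite Rmult_0_r, exp_0, Rmult_1_r in HK.
    eapply Rle_trans; [apply Cmod_ge_0|exact HK]. }
  set (p := fun n => K * (4 * PI ^ 2 * (2 / r ^ 2)) * exp (- (2 * r) * INR n)).
  assert (Hp : ex_series p) by (apply ex_series_exp_neg; lra).
  assert (Hsq : forall n, INR n ^ 2 <= 2 / r ^ 2 * exp (r * INR n)).
  { intros n. pose proof (pos_INR n).
    pose proof (sqr_le_exp (r * INR n) ltac:(apply Rmult_le_pos; lra)).
    apply Rmult_le_reg_l with (r ^ 2); [apply pow_lt, Hr|].
    replace (r ^ 2 * (2 / r ^ 2 * exp (r * INR n))) with (2 * exp (r * INR n)) by (field; lra).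
    rewrite <- Rpow_mult_distr. assumption. }
  assert (Hd : sums (fun n => (b' n * qpar z ^ n)%C) (CSeries (fun n => (b' n * qpar z ^ n)%C))).
  { apply (sums_Rabs _ (fun n => K * (2 * PI) * (2 / r ^ 2) * exp (- (2 * r) * INR n)));
      [|apply ex_series_exp_neg; lra].
    intros n. rewrite Cmod_qterm. unfold b'. rewrite !Cmod_mult, Hmod_tau, Cmod_R.
    fold y. pose proof (pos_INR n) as Hn. rewrite Rabs_pos_eq by exact Hn.
    assert (Hn2 : INR n <= 2 / r ^ 2 * exp (r * INR n)).
    { eapply Rle_trans; [|apply Hsq]. destruct n; [simpl; lra|].
      rewrite S_INR in *. pose proof (pos_INR n). nra. }
    replace (exp (- (2 * r) * INR n)) with
      (exp (r * INR n) * (exp (r * INR n)* exp (- (2 * PI * y) * INR n)) * exp ((4 * r) * INR n)).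
    2:{ rewrite <- !exp_plus. f_equal. unfold r. field. }
    assert (H1 : 1 <= exp (4 * r * INR n)).
    { rewrite <- exp_0. apply exp_le_compat. apply Rmult_le_pos; lra. }
    apply Rle_trans with (K * (2 * PI) * (2 / r ^ 2) *
       (exp (r * INR n) * (exp (r * INR n) * exp (- (2 * PI * y) * INR n)))).
    2:{ rewrite <- (Rmult_1_r (K * (2 * PI) * (2 / r ^ 2) * _)) at 1.
        rewrite <- !Rmult_assoc. apply Rmult_le_compat_l; [|exact H1].
        positivity. }
    replace (K * (2 * PI) * (2 / r ^ 2) * (exp (r * INR n) * (exp (r * INR n) * exp (- (2 * PI * y) * INR n))))
      with ((K * exp (r * INR n)) * (2 * PI * (2 / r ^ 2 * exp (r * INR n))) * exp (- (2 * PI * y) * INR n)) by ring.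
    apply Rmult_le_compat_r; [left; apply exp_pos|].
    apply Rmult_le_compat; [apply Cmod_ge_0| |apply HK|].
    - apply Rmult_le_pos; lra.
    - apply Rmult_le_compat_l; [lra|exact Hn2]. }
  exists (CSeries (fun n => (b' n * qpar z ^ n)%C)).
  apply (is_derive_quadratic _ _ _ (Series p) (y / 4)); [lra|].
  intros h Hh.
  assert (Hzh : inH (z + h)%C).
  { unfold inH. change (Im (z + h)%C) with (Im z + Im h). fold y.
    pose proof (Im_le_Cmod h) as Hi. pose proof (Rle_abs (- Im h)) as Ha.
    rewrite Rabs_Ropp in Ha. lra. }
  rewrite (Rmult_comm (Series p)). rewrite <- Series_scal_l.
  set (D := CSeries (fun n => (b' n * qpar z ^ n)%C)) in *.
  assert (HS : sums (fun n => (b n * qpar z ^ n * (cexp (tau * h * INR n) - 1 - tau * h * INR n))%C)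
                (qser b (z + h) - qser b z - D * h)%C).
  { replace (qser b (z + h) - qser b z - D * h)%C with
      (qser b (z + h) + - qser b z + (- h) * D)%C by ring.
    apply (sums_ext (fun n => (b n * qpar (z + h) ^ n + - (b n * qpar z ^ n) + (- h) * (b' n * qpar z ^ n))%C)).
    - intros n. rewrite qpar_plus, Cpow_mult_l. unfold b'.
      replace (qpar h ^ n)%C with (cexp (tau * h * INR n)).
      + ring.
      + unfold qpar. rewrite cexp_pow. f_equal.
        unfold tau. replace (0, 2 * PI) with (RtoC (2 * PI) * Ci)%C; [ring|].
        apply C_ext; unfold Re, Im; simpl; ring.
    - apply sums_plus; [apply sums_plus|].
      + apply qser_sums; assumption.
      + apply sums_opp, qser_sums; assumption.
      + apply sums_scal, Hd. }
  apply (sums_bound _ _ (fun n => Cmod h ^ 2 * p n) HS).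
  2:{ apply ex_series_mult_l, Hp. }
  intros n. rewrite Cmod_mult, Cmod_qterm. fold y.
  pose proof (pos_INR n) as Hn. pose proof (Cmod_ge_0 h) as Hh0.
  set (w := (tau * h * INR n)%C).
  assert (Hw : Cmod w = 2 * PI * Cmod h * INR n).
  { unfold w. rewrite !Cmod_mult, Hmod_tau, Cmod_R, Rabs_pos_eq by exact Hn. ring. }
  pose proof (Cmod_cexp_sub_1 w) as H1. rewrite Hw in H1.
  assert (H2 : exp (2 * PI * Cmod h * INR n) <= exp (2 * r * INR n)).
  { apply exp_le_compat. apply Rmult_le_compat_r; [exact Hn|]. unfold r. nra. }
  unfold p.
  replace (Cmod h ^ 2 * (K * (4 * PI ^ 2 * (2 / r ^ 2)) * exp (- (2 * r) * INR n)))
    with ((K * exp (r * INR n)) * exp (- (2 * PI * y) * INR n) *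
          (4 * PI ^ 2 * Cmod h ^ 2 * (2 / r ^ 2 * exp (r * INR n)) * exp (2 * r * INR n)) * exp (2 * r * INR n)).
  2:{ replace (exp (- (2 * r) * INR n)) with
       (exp (r * INR n) * exp (- (2 * PI * y) * INR n) * exp (r * INR n) * exp (2 * r * INR n) * exp (2 * r * INR n)).
      ring. rewrite <- !exp_plus. f_equal. unfold r. field. }
  assert (H3 : 1 <= exp (2 * r * INR n)).
  { rewrite <- exp_0. apply exp_le_compat. apply Rmult_le_pos; lra. }
  match goal with |- _ <= ?X * _ => apply Rle_trans with X end.
  2:{ rewrite <- Rmult_1_r at 1. apply Rmult_le_compat_l; [|exact H3].
      positivity. }
  apply Rmult_le_compat.
  - apply Rmult_le_pos; [apply Cmod_ge_0|left; apply exp_pos].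
  - apply Cmod_ge_0.
  - apply Rmult_le_compat_r; [left; apply exp_pos|apply HK].
  - eapply Rle_trans; [exact H1|].
    apply Rmult_le_compat; [positivity|left; apply exp_pos| |exact H2].
    replace ((2 * PI * Cmod h * INR n) ^ 2) with (4 * PI ^ 2 * Cmod h ^ 2 * INR n ^ 2) by ring.
    apply Rmult_le_compat_l; [|apply Hsq].
    positivity.
Qed.

Lemma qser_periodic (b : nat -> C) (z : C) : qser b (z + 1)%C = qser b z.
Proof. unfold qser. rewrite (qpar_add_IZR z 1). reflexivity. Qed.

(** For a q-series, holomorphy, periodicity and boundedness at the cusp are automatic; only the
    inversion has to be supplied. *)
Lemma qser_modular_form (k : nat) (a : nat -> R) :
  subexp (fun n => RtoC (a n)) ->
  (forall z, inH z -> qser (fun n => RtoC (a n)) (- / z)%C = (z ^ k * qser (fun n => RtoC (a n)) z)%C) ->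
  is_modular_form k (qser (fun n => RtoC (a n))) /\ has_q_expansion (qser (fun n => RtoC (a n))) a.
Proof.
  intros Ha HS. split; [split; [|split; [|split]]|].
  - intros z Hz. apply qser_derivable; assumption.
  - intros z _. apply qser_periodic.
  - intros z Hz. rewrite pow_n_Cpow. apply HS, Hz.
  - destruct (qser_bounded _ 1 Ha ltac:(lra)) as [M HM]. exists M. exact HM.
  - intros z Hz.
    apply (sums_ext (fun n => (RtoC (a n) * qpar z ^ n)%C)).
    + intros n. exact (f_equal (Cmult (a n)) (eq_sym (pow_n_Cpow (qpar z) n))) .
    + apply qser_sums; assumption.
Qed.

(** The terms of a convergent series are bounded; at z = i eps / (2 pi) this bounds b_n by a
    multiple of e^(eps n). *)
Lemma sums_subexp (b : nat -> C) (f : C -> C) :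
  (forall z, inH z -> sums (fun n => (b n * qpar z ^ n)%C) (f z)) -> subexp b.
Proof.
  intros H eps He. pose proof PI_RGT_0 as HPI.
  set (z := (0, eps / (2 * PI)) : C).
  assert (Hz : inH z) by (unfold inH, z; simpl; apply Rdiv_lt_0_compat; lra).
  destruct (proj1 (sums_eps _ _) (H z Hz) 1 ltac:(lra)) as [N HN].
  assert (Hb : exists K, forall n, Cmod (b n * qpar z ^ n)%C <= K).
  { assert (Hfin : exists K, 2 <= K /\ forall n, (n < N)%nat -> Cmod (b n * qpar z ^ n)%C <= K).
    { clear. induction N as [|N [K [HK2 HK]]].
      - exists 2. split; [lra|]. intros; lia.
      - exists (Rmax K (Cmod (b N * qpar z ^ N)%C)). split.
        + eapply Rle_trans; [exact HK2|apply Rmax_l].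
        + intros n Hn. destruct (Nat.eq_dec n N) as [->|]; [apply Rmax_r|].
          eapply Rle_trans; [apply HK; lia|apply Rmax_l]. }
    destruct Hfin as [K [HK2 HK]]. exists K. intros n.
    destruct (Nat.lt_ge_cases n N) as [Hn|Hn]; [apply HK, Hn|].
    pose proof (HN n Hn) as H1. pose proof (HN (S n) ltac:(lia)) as H2. simpl in H2.
    set (t := (b n * qpar z ^ n)%C) in *. set (s := csum _ n) in *.
    replace t with ((s + t - f z) + - (s - f z))%C by ring.
    eapply Rle_trans; [apply Cmod_triangle|]. rewrite Cmod_opp. lra. }
  destruct Hb as [K HK]. exists K. intros n. specialize (HK n).
  rewrite Cmod_qterm in HK.
  replace (- (2 * PI * Im z) * INR n) with (- (eps * INR n)) in HK by (unfold z; simpl; field; lra).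
  rewrite exp_Ropp in HK. pose proof (exp_pos (eps * INR n)).
  apply Rmult_le_reg_r with (/ exp (eps * INR n)); [apply Rinv_0_lt_compat; assumption|].
  eapply Rle_trans; [exact HK|]. right. field. lra.
Qed.

Lemma qpar_frac_neq_1 (x : R) : 0 < Rabs x < 1 -> qpar x <> 1%C.
Proof.
  intros Hx E. pose proof PI_RGT_0 as HPI.
  assert (Hc : cos (2 * (PI * x)) = 1).
  { apply (f_equal Re) in E. revert E. unfold qpar, cexp, Re, Im, Cmult, RtoC; simpl.
    rewrite !Rmult_0_l, !Rmult_0_r, Rminus_0_r, exp_0, Rplus_0_l, Rmult_1_l.
    intros <-. f_equal. ring. }
  rewrite cos_2a_sin in Hc.
  assert (Hs : sin (PI * x) = 0) by nra.
  destruct (Rcase_abs x).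
  - rewrite Rabs_left in Hx by assumption.
    assert (0 < sin (PI * - x)) by (apply sin_gt_0; nra).
    replace (PI * - x) with (- (PI * x)) in H by ring. rewrite sin_neg in H. lra.
  - rewrite Rabs_right in Hx by assumption.
    assert (0 < sin (PI * x)) by (apply sin_gt_0; nra). lra.
Qed.

Lemma csum_geom_root (w : C) (N : nat) : w <> 1%C -> (w ^ N)%C = 1%C ->
  csum (fun j => (w ^ j)%C) N = 0%C.
Proof.
  intros Hw HN.
  assert (H : forall n, ((w - 1) * csum (fun j => (w ^ j)%C) n)%C = (w ^ n - 1)%C).
  { induction n as [|n IH]; simpl; [ring|]. rewrite Cmult_plus_distr_l, IH. ring. }
  specialize (H N). rewrite HN in H.
  assert (Hw' : (w - 1)%C <> 0%C).
  { intros E. apply Hw. replace w with (w - 1 + 1)%C by ring. rewrite E. ring. }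
  replace (csum (fun j => (w ^ j)%C) N) with (/ (w - 1) * ((w - 1) * csum (fun j => (w ^ j)%C) N))%C
    by (field; exact Hw').
  rewrite H. ring.
Qed.

(* Averaging f over the points x + iy with x = j/N isolates, as N grows, the n-th coefficient. *)
Lemma coef_bound (b : nat -> C) (f : C -> C) (y M : R) (n : nat) :
  (forall z, inH z -> sums (fun n => (b n * qpar z ^ n)%C) (f z)) ->
  0 < y -> (forall x, Cmod (f (x, y)) <= M) ->
  Cmod (b n) * exp (- (2 * PI * y) * INR n) <= M.
Proof.
  intros Hf Hy HM. pose proof PI_RGT_0 as HPI.
  pose proof (sums_subexp b f Hf) as Hb.
  destruct (subexp_bound b y Hb Hy) as [K [HK0 HK]].
  set (p := fun m => K * exp (- (PI * y) * INR m)).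
  assert (Hp : ex_series p) by (apply ex_series_exp_neg, Rmult_lt_0_compat; lra).
  apply Rnot_lt_le. intros Hlt.
  set (d := Cmod (b n) * exp (- (2 * PI * y) * INR n) - M) in *.
  destruct (Series_tail_eps p Hp d ltac:(unfold d; lra)) as [N0 HN0].
  set (N := (N0 + n + 1)%nat).
  specialize (HN0 N ltac:(unfold N; lia)).
  assert (HNpos : 0 < INR N) by (apply lt_0_INR; unfold N; lia).
  set (r := fun m => (b m * qpar (0, y) ^ m)%C).
  (* [c m] averages e(j (m - n) / N) over j < N: it is 1 for m = n, 0 for every other m < N because
     then 0 < |m - n| < N, and at most 1 in modulus beyond, where the tail of [p] takes over. *)
  set (c := fun m => csum (fun j => (/ INR N * qpar ((INR j / INR N) * (INR m - INR n))%R)%C) N).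
  assert (Hzj : forall j : nat, inH ((INR j / INR N)%R, y)) by (intros; exact Hy).
  assert (HS : sums (fun m => (r m * c m)%C)
     (csum (fun j => (/ INR N * qpar (- (INR j / INR N * INR n))%R * f ((INR j / INR N)%R, y))%C) N)).
  { assert (H := sums_csum (fun j m => (/ INR N * qpar (- (INR j / INR N * INR n))%R *
         (b m * qpar ((INR j / INR N)%R, y) ^ m))%C)
       (fun j => (/ INR N * qpar (- (INR j / INR N * INR n))%R * f ((INR j / INR N)%R, y))%C) N
       (fun j _ => sums_scal _ _ _ (Hf _ (Hzj j)))).
    refine (sums_ext _ _ _ _ H). intros m. unfold c, r. rewrite <- csum_scal.
    apply csum_ext. intros j _.
    replace (((INR j / INR N)%R, y) : C) with (RtoC (INR j / INR N) + (0, y))%C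
      by (apply C_ext; unfold Re, Im; simpl; ring).
    rewrite qpar_plus, Cpow_mult_l.
    replace (RtoC (INR j / INR N * (INR m - INR n))) with
      (INR m * RtoC (INR j / INR N) + RtoC (- (INR j / INR N * INR n)))%C.
    - rewrite qpar_plus, <- qpar_pow. ring.
    - rewrite <- RtoC_mult, <- RtoC_plus. f_equal. ring. }
  assert (Hcmod : forall x : R, Cmod (qpar x) = 1).
  { intros x. rewrite Cmod_qpar. simpl. rewrite Rmult_0_r, exp_0. reflexivity. }
  assert (HinvN : Cmod (/ INR N)%C = / INR N).
  { rewrite <- RtoC_inv by lra. rewrite Cmod_R, Rabs_pos_eq; [reflexivity|].
    left; apply Rinv_0_lt_compat, HNpos. }
  assert (Hc1 : forall m, Cmod (c m) <= 1).
  { intros m. unfold c. eapply Rle_trans; [apply (csum_Cmod_le _ (fun _ => / INR N))|].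
    - intros i _. rewrite Cmod_mult, HinvN, Hcmod. lra.
    - rewrite sum_cte, S_INR. right. field. lra. }
  assert (Hcn : c n = 1%C).
  { unfold c. rewrite (csum_ext _ (fun _ => (/ INR N)%C)).
    - rewrite csum_const. field. intros E. apply RtoC_inj in E. lra.
    - intros i _. rewrite Rminus_diag, Rmult_0_r, qpar_0. ring. }
  assert (Hc0 : forall m, (m < N)%nat -> m <> n -> c m = 0%C).
  { intros m Hm Hmn. unfold c. rewrite csum_scal.
    rewrite (csum_ext _ (fun j => (qpar ((INR m - INR n) / INR N)%R ^ j)%C)).
    - rewrite csum_geom_root; [ring| |].
      + apply qpar_frac_neq_1. unfold Rdiv. rewrite Rabs_mult.
        rewrite (Rabs_pos_eq (/ INR N)) by (left; apply Rinv_0_lt_compat, HNpos).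
        assert (Habs : 0 < Rabs (INR m - INR n) < INR N).
        { assert (n < N)%nat by (unfold N; lia).
          assert (INR m < INR N) by (apply lt_INR; lia).
          assert (INR n < INR N) by (apply lt_INR; lia).
          pose proof (pos_INR m). pose proof (pos_INR n). split.
          - apply Rabs_pos_lt. intros E. apply Hmn, INR_eq. lra.
          - apply Rabs_def1; lra. }
        split.
        * apply Rmult_lt_0_compat; [lra|apply Rinv_0_lt_compat, HNpos].
        * apply Rmult_lt_reg_r with (INR N); [lra|]. rewrite Rmult_assoc, Rinv_l by lra. lra.
      + rewrite qpar_pow, <- RtoC_mult.
        replace (INR N * ((INR m - INR n) / INR N)) with (IZR (Z.of_nat m - Z.of_nat n)).
        * apply qpar_IZR.
        * rewrite minus_IZR, <- !INR_IZR_INZ. field. lra.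
    - intros j _. rewrite qpar_pow, <- RtoC_mult. do 2 f_equal. field. lra. }
  assert (Hbound : Cmod (csum (fun j => (/ INR N * qpar (- (INR j / INR N * INR n))%R * f ((INR j / INR N)%R, y))%C) N) <= M).
  { eapply Rle_trans; [apply (csum_Cmod_le _ (fun _ => / INR N * M))|].
    - intros i _. rewrite !Cmod_mult, HinvN, Hcmod, Rmult_1_r.
      apply Rmult_le_compat_l; [left; apply Rinv_0_lt_compat, HNpos|apply HM].
    - rewrite sum_cte, S_INR. right. field. lra. }
  assert (Hrm : forall m, Cmod (r m * c m)%C <= p m).
  { intros m. rewrite Cmod_mult. unfold r. rewrite Cmod_qterm. simpl Im.
    specialize (Hc1 m). specialize (HK m y ltac:(lra)).
    assert (0 <= Cmod (b m) * exp (- (2 * PI * y) * INR m))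
      by (apply Rmult_le_pos; [apply Cmod_ge_0|left; apply exp_pos]).
    pose proof (Cmod_ge_0 (c m)). unfold p. nra. }
  pose proof (sums_tail_bound _ _ p N HS Hrm Hp) as Ht.
  set (S0 := csum (fun j => _) N) in *.
  assert (Hsum : csum (fun m => (r m * c m)%C) N = r n).
  { replace N with (n + (1 + N0))%nat by (unfold N; lia). rewrite !csum_add.
    rewrite (csum_zero _ n) by (intros i Hi; rewrite Hc0 by (unfold N; lia); ring).
    rewrite (csum_zero _ N0) by (intros i Hi; rewrite Hc0 by (unfold N; lia); ring).
    simpl. rewrite Nat.add_0_r, Hcn. ring. }
  rewrite Hsum in Ht.
  assert (Hrn : Cmod (r n) = Cmod (b n) * exp (- (2 * PI * y) * INR n)).
  { unfold r. rewrite Cmod_qterm. reflexivity. }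
  pose proof (Cmod_triangle S0 (r n - S0)%C) as Htr.
  replace (S0 + (r n - S0))%C with (r n) in Htr by ring.
  rewrite (Cmod_minus_sym (r n)) in Htr.
  pose proof (Rle_abs (Series (fun k => p (N + k)%nat))). unfold d in *. lra.
Qed.

(** * The Lipschitz formula *)

Lemma pow_le_exp (n : nat) (eps : R) (x : R) : 0 < eps -> 0 <= x ->
  x ^ n <= INR (fact n) / eps ^ n * exp (eps * x).
Proof.
  intros He Hx. pose proof (pow_div_fact_le_exp (eps * x) n ltac:(positivity)) as H.
  rewrite Rpow_mult_distr in H.
  pose proof (INR_fact_lt_0 n). assert (0 < eps ^ n) by (apply pow_lt, He).
  apply Rmult_le_reg_l with (eps ^ n / INR (fact n)); [positivity|].
  replace (eps ^ n / INR (fact n) * (INR (fact n) / eps ^ n * exp (eps * x))) with (exp (eps * x))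
    by (field; lra).
  eapply Rle_trans; [|exact H]. right. field. lra.
Qed.

Lemma subexp_le (b c : nat -> C) : subexp c -> (forall n, Cmod (b n) <= Cmod (c n)) -> subexp b.
Proof.
  intros Hc H eps He. destruct (Hc eps He) as [K HK]. exists K. intros n.
  eapply Rle_trans; [apply H|apply HK].
Qed.

Lemma subexp_S_pow (s : nat) : subexp (fun n => RtoC ((INR n + 1) ^ s)).
Proof.
  intros eps He. exists (INR (fact s) / eps ^ s * exp eps). intros n. pose proof (pos_INR n).
  rewrite Cmod_R, Rabs_pos_eq by positivity.
  eapply Rle_trans; [apply (pow_le_exp s eps); lra|].
  right. rewrite Rmult_assoc, <- exp_plus. do 2 f_equal. ring.
Qed.

Lemma subexp_pow (s : nat) : subexp (fun n => RtoC (INR n ^ s)).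
Proof.
  apply (subexp_le _ _ (subexp_S_pow s)). intros n. pose proof (pos_INR n).
  rewrite !Cmod_R, !Rabs_pos_eq by positivity. apply pow_incr. lra.
Qed.

(* bin i m is the binomial coefficient (m + i choose i). *)
Fixpoint bin (i : nat) (m : nat) : R :=
  match i with O => 1 | S j => bin j m * (INR m + INR j + 1) / (INR j + 1) end.

Lemma bin_pos (i m : nat) : 0 < bin i m.
Proof.
  induction i as [|i IH]; simpl; [lra|]. pose proof (pos_INR i). pose proof (pos_INR m).
  positivity.
Qed.

Lemma bin_le (i m : nat) : bin i m <= (INR m + 1) ^ i.
Proof.
  induction i as [|i IH]; simpl; [lra|]. pose proof (pos_INR i). pose proof (pos_INR m).
  pose proof (bin_pos i m).
  unfold Rdiv. rewrite Rmult_assoc, (Rmult_comm (INR m + 1)).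
  apply Rmult_le_compat; [lra|positivity|exact IH|].
  apply Rmult_le_reg_r with (INR i + 1); [lra|]. rewrite Rmult_assoc, Rinv_l by lra. nra.
Qed.

Lemma subexp_bin (i : nat) : subexp (fun n => RtoC (bin i n)).
Proof.
  apply (subexp_le _ _ (subexp_S_pow i)). intros n. pose proof (pos_INR n).
  rewrite !Cmod_R, !Rabs_pos_eq; [apply bin_le|positivity|left; apply bin_pos].
Qed.

Lemma bin_absorb (i m : nat) : bin i (S m) * (INR m + 1) = bin i m * (INR m + INR i + 1).
Proof.
  induction i as [|i IH]; [simpl; ring|].
  cbn [bin]. rewrite !S_INR. pose proof (pos_INR i). pose proof (pos_INR m).
  replace (bin i (S m) * (INR m + 1 + INR i + 1) / (INR i + 1) * (INR m + 1))
    with (bin i (S m) * (INR m + 1) * ((INR m + 1 + INR i + 1) / (INR i + 1))) by (field; lra).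
  rewrite IH. field. lra.
Qed.

Lemma bin_pascal (i m : nat) : bin (S i) (S m) = bin (S i) m + bin i (S m).
Proof.
  cbn [bin]. rewrite !S_INR. pose proof (pos_INR i). pose proof (bin_absorb i m).
  apply Rmult_eq_reg_r with (INR i + 1); [|lra]. field_simplify; [|lra|lra].
  nra.
Qed.

Lemma bin_0 (i : nat) : bin i 0 = 1.
Proof.
  induction i as [|i IH]; [reflexivity|]. cbn [bin]. rewrite IH. pose proof (pos_INR i).
  simpl. field. lra.
Qed.

Lemma qpar_neq_1 (z : C) : inH z -> (1 - qpar z)%C <> 0%C.
Proof.
  intros Hz E. pose proof (Cmod_qpar_lt_1 z Hz) as H.
  replace (qpar z) with (1 - (1 - qpar z))%C in H by ring. rewrite E in H.
  replace (1 - 0)%C with (RtoC 1) in H by ring. rewrite Cmod_1 in H. lra.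
Qed.

(** By Pascal's rule, multiplication by 1 - q turns the series with coefficients [bin (S i)] into
    the one with coefficients [bin i]. *)
Lemma qser_bin (i : nat) (z : C) : inH z ->
  qser (fun n => RtoC (bin i n)) z = (/ (1 - qpar z) ^ S i)%C.
Proof.
  intros Hz. pose proof (qpar_neq_1 z Hz) as Hne.
  induction i as [|i IH].
  - assert (H := qser_sums _ z (subexp_bin 0) Hz).
    assert (H1 := sums_incr_1 _ _ H). simpl in H1.
    assert (H2 := sums_scal (qpar z) _ _ H).
    set (v := qser (fun n => RtoC (bin 0 n)) z) in *.
    assert (E : (qpar z * v)%C = (v - 1 * 1)%C).
    { apply (sums_unique (fun n => (1 * (qpar z * qpar z ^ n))%C)); [|exact H1].
      refine (sums_ext _ _ _ _ H2). intros n. simpl. ring. }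
    replace v with (v * (1 - qpar z) / (1 - qpar z))%C by (field; exact Hne).
    replace (v * (1 - qpar z))%C with (v - qpar z * v)%C by ring. rewrite E. simpl. field. exact Hne.
  - assert (H := qser_sums _ z (subexp_bin (S i)) Hz).
    assert (H0 := qser_sums _ z (subexp_bin i) Hz). rewrite IH in H0.
    assert (H1 := sums_incr_1 _ _ H). cbv beta in H1.
    assert (H2 := sums_scal (- qpar z)%C _ _ H).
    assert (H3 := sums_plus _ _ _ _ H1 H2).
    assert (H4 := sums_incr_1 _ _ H0). cbv beta in H4.
    set (v := qser (fun n => RtoC (bin (S i) n)) z) in *.
    rewrite bin_0 in H3, H4.
    assert (E : (/ (1 - qpar z) ^ S i - 1 * qpar z ^ 0)%C = (v - 1 * qpar z ^ 0 + - qpar z * v)%C).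
    { apply (sums_unique _ _ _ H4). refine (sums_ext _ _ _ _ H3). intros n. cbv beta.
      rewrite bin_pascal, RtoC_plus, Cpow_S. ring. }
    replace v with (v * (1 - qpar z) / (1 - qpar z))%C by (field; exact Hne).
    replace (v * (1 - qpar z))%C with (v - 1 * qpar z ^ 0 + - qpar z * v + 1 * qpar z ^ 0)%C by ring.
    rewrite <- E. rewrite (Cpow_S _ (S i)). simpl (qpar z ^ 0)%C. field. split; [apply Cpow_nz|]; exact Hne.
Qed.

(** Induction on the exponent, from m bin_i(m) = (i + 1) (bin_(i+1)(m) - bin_i(m)). It makes the sum
    of m^s q^m a polynomial in 1/(1 - q), whose top coefficient s! is all that survives in the limit
    behind the Lipschitz formula. *)
Lemma pow_bin_basis (s : nat) : exists c : nat -> R,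
  (forall m, RtoC (INR m ^ s) = csum (fun i => (c i * bin i m)%C) (S s)) /\ c s = INR (fact s) /\
  (forall i, (s < i)%nat -> c i = 0).
Proof.
  induction s as [|s [c [Hc [Hs H0]]]].
  - exists (fun i => match i with O => 1 | _ => 0 end). split; [|split].
    + intros m. simpl. ring.
    + reflexivity.
    + intros [|i] Hi; [lia|reflexivity].
  - exists (fun i => (match i with O => 0 | S j => INR i * c j end) - INR (S i) * c i).
    split; [|split].
    + intros m. simpl pow. rewrite RtoC_mult, Hc.
      rewrite (csum_ext (fun i => (RtoC (_ - _) * _)%C)
        (fun i => (RtoC (match i with O => 0 | S j => INR i * c j end) * bin i m
                   + - (RtoC (INR (S i) * c i) * bin i m))%C))
        by (intros; rewrite RtoC_minus; ring).
      rewrite csum_plus, csum_opp.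
      change (csum (fun i => (RtoC (INR (S i) * c i) * bin i m)%C) (S (S s))) with
        (csum (fun i => (RtoC (INR (S i) * c i) * bin i m)%C) (S s)
         + RtoC (INR (S (S s)) * c (S s)) * bin (S s) m)%C.
      rewrite (H0 (S s)) by lia.
      rewrite (csum_add _ 1 (S s)). rewrite <- csum_scal.
      replace (csum (fun i => (INR m * (c i * bin i m))%C) (S s)) with
        (csum (fun i => (RtoC (INR (1 + i) * c i) * bin (1 + i) m)%C) (S s) +
         - csum (fun i => (RtoC (INR (S i) * c i) * bin i m)%C) (S s))%C.
      * simpl (csum _ 1). rewrite Rmult_0_r. cbn -[INR bin csum]. ring.
      * rewrite <- csum_opp, <- csum_plus. apply csum_ext. intros i _.
        rewrite <- !RtoC_mult, <- RtoC_opp, <- RtoC_plus. f_equal. change (1 + i)%nat with (S i). cbn [bin].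
        rewrite !S_INR. pose proof (pos_INR i). field. lra.
    + rewrite (H0 (S s)) by lia. rewrite Hs. rewrite fact_simpl, mult_INR. ring.
    + intros [|i] Hi; [lia|]. rewrite (H0 i), (H0 (S i)) by lia. ring.
Qed.

Definition itau : C := (0, 2 * PI).

Lemma inH_add_R (z : C) (x : R) : inH z -> inH (z + x)%C.
Proof. unfold inH. simpl. unfold Im. rewrite Rplus_0_r. tauto. Qed.

Lemma inH_div (z : C) (x : R) : 0 < x -> inH z -> inH (z / x)%C.
Proof.
  unfold inH. intros Hx Hz. unfold Cdiv. rewrite <- RtoC_inv by lra.
  replace (Im (z * (/ x)%R)%C) with (Im z * / x) by (unfold Im, Cmult, RtoC; simpl; ring).
  apply Rdiv_lt_0_compat; assumption.
Qed.

Lemma RtoC_neq_0 (x : R) : x <> 0 -> RtoC x <> 0%C.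
Proof. intros H E. apply H. apply RtoC_inj. exact E. Qed.

(* Sum over m of m^s e(m (w + j) / N), summed over j mod N, keeps the m divisible by N. *)
Lemma qser_pow_distribution (s N : nat) (w : C) : (0 < N)%nat -> inH w ->
  csum (fun j => qser (fun n => RtoC (INR n ^ s)) ((w + INR j) / INR N)%C) N
  = (INR N ^ S s * qser (fun n => RtoC (INR n ^ s)) w)%C.
Proof.
  intros HN Hw. set (L := qser (fun n => RtoC (INR n ^ s))).
  assert (HNr : 0 < INR N) by (apply lt_0_INR, HN).
  assert (HNC : RtoC (INR N) <> 0%C) by (apply RtoC_neq_0; lra).
  assert (Hj : forall j : nat, inH ((w + INR j) / INR N)%C)
    by (intros; apply inH_div; [lra|apply inH_add_R, Hw]).
  set (u := fun m => csum (fun j => (INR m ^ s * qpar ((w + INR j) / INR N) ^ m)%C) N).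
  assert (Hu : sums u (csum (fun j => L ((w + INR j) / INR N)%C) N)).
  { apply (sums_csum (fun j m => (INR m ^ s * qpar ((w + INR j) / INR N) ^ m)%C)).
    intros j _. refine (sums_ext _ _ _ _ (qser_sums _ _ (subexp_pow s) (Hj j))).
    intros n. rewrite RtoC_pow. reflexivity. }
  assert (Hu' : forall m, u m = (INR m ^ s * qpar (w / INR N) ^ m *
       csum (fun j => (qpar (INR m / INR N)%R ^ j)%C) N)%C).
  { intros m. unfold u. rewrite <- csum_scal. apply csum_ext. intros j _.
    unfold Cdiv at 1. rewrite Cmult_plus_distr_r, qpar_plus, Cpow_mult_l.
    rewrite (qpar_pow (RtoC (INR m / INR N))), (qpar_pow (INR j * / INR N)%C).
    unfold Rdiv. rewrite RtoC_mult, RtoC_inv by lra. unfold Cdiv.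
    replace (INR j * (INR m * / INR N))%C with (INR m * (INR j * / INR N))%C by ring. ring. }
  apply (sums_group u _ N (fun r => match r with
      | O => (INR N ^ S s * L w)%C | _ => 0%C end)) in Hu; [|exact HN|].
  - rewrite <- Hu. destruct N as [|N]; [lia|].
    rewrite (csum_add _ 1 N). rewrite (csum_zero _ N) by reflexivity. cbn [csum]. ring.
  - intros [|r] Hr.
    + refine (sums_ext _ _ _ _ (sums_scal (INR N ^ S s)%C _ _ (qser_sums _ _ (subexp_pow s) Hw))).
      intros l. cbv beta. rewrite Nat.add_0_l, Hu'.
      rewrite (csum_ext _ (fun _ => 1%C)).
      * rewrite csum_const, !qpar_pow, mult_INR, RtoC_mult, RtoC_pow.
        rewrite Cpow_mult_l. simpl (INR N ^ S s)%C.
        replace (INR N * INR l * (w / INR N))%C with (INR l * w)%C by (field; exact HNC). ring.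
      * intros j _. replace (INR (N * l) / INR N) with (INR l).
        rewrite qpar_nat. apply Cpow_1_l. rewrite mult_INR. field. lra.
    + apply (sums_finite _ 0). intros l _. rewrite Hu'. rewrite csum_geom_root; [ring| |].
      * replace (INR (S r + N * l) / INR N) with (INR (S r) / INR N + IZR (Z.of_nat l)).
        2:{ rewrite <- INR_IZR_INZ, plus_INR, mult_INR. field. lra. }
        rewrite RtoC_plus, qpar_add_IZR. apply qpar_frac_neq_1.
        assert (0 < INR (S r)) by (apply lt_0_INR; lia). apply lt_INR in Hr.
        rewrite Rabs_pos_eq by positivity. split; [positivity|].
        apply Rmult_lt_reg_r with (INR N); [lra|]. unfold Rdiv. rewrite Rmult_assoc, Rinv_l by lra. lra.
      * rewrite qpar_pow, <- RtoC_mult. replace (INR N * (INR (S r + N * l) / INR N)) with (INR (S r + N * l)) by (field; lra).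
        apply qpar_nat.
Qed.

Lemma csum_rev (u : nat -> C) (n : nat) : csum u n = csum (fun i => u (n - 1 - i)%nat) n.
Proof.
  induction n as [|n IH]; [reflexivity|].
  change (csum u n + u n = csum (fun i => u (S n - 1 - i)%nat) (1 + n))%C.
  rewrite csum_add, IH. cbn [csum].
  replace (S n - 1 - 0)%nat with n by lia.
  rewrite (csum_ext (fun i => u (S n - 1 - (1 + i))%nat) (fun i => u (n - 1 - i)%nat)).
  - ring.
  - intros i _. f_equal. lia.
Qed.

(** * Calculus of limits of complex sequences *)

Lemma Clim_const (c : C) : Clim (fun _ => c) c.
Proof.
  intros eps He. exists 0%nat. intros. replace (c - c)%C with (RtoC 0) by ring.
  rewrite Cmod_0. exact He.
Qed.

Lemma Clim_plus (u v : nat -> C) (a b : C) :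
  Clim u a -> Clim v b -> Clim (fun n => (u n + v n)%C) (a + b)%C.
Proof.
  intros Hu Hv eps He. destruct (Hu (eps / 2) ltac:(lra)) as [N1 H1].
  destruct (Hv (eps / 2) ltac:(lra)) as [N2 H2]. exists (N1 + N2)%nat. intros n Hn.
  specialize (H1 n ltac:(lia)). specialize (H2 n ltac:(lia)).
  replace (u n + v n - (a + b))%C with ((u n - a) + (v n - b))%C by ring.
  eapply Rle_lt_trans; [apply Cmod_triangle|]. lra.
Qed.

Lemma Clim_mult (u v : nat -> C) (a b : C) :
  Clim u a -> Clim v b -> Clim (fun n => (u n * v n)%C) (a * b)%C.
Proof.
  intros Hu Hv eps He.
  pose proof (Cmod_ge_0 a) as Ha. pose proof (Cmod_ge_0 b) as Hb.
  set (d := eps / (2 * (Cmod a + Cmod b + 1))).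
  assert (Hd : 0 < d) by (unfold d; positivity).
  destruct (Hu (Rmin d 1)) as [N1 H1]; [apply Rmin_glb_lt; lra|].
  destruct (Hv d Hd) as [N2 H2].
  exists (N1 + N2)%nat. intros n Hn.
  specialize (H1 n ltac:(lia)). specialize (H2 n ltac:(lia)).
  assert (H3 := Rmin_l d 1). assert (H4 := Rmin_r d 1).
  replace (u n * v n - a * b)%C with ((u n - a) * (v n - b) + (a * (v n - b) + (u n - a) * b))%C by ring.
  eapply Rle_lt_trans; [apply Cmod_triangle|].
  eapply Rle_lt_trans; [apply Rplus_le_compat_l, Cmod_triangle|]. rewrite !Cmod_mult.
  pose proof (Cmod_ge_0 (u n - a)%C). pose proof (Cmod_ge_0 (v n - b)%C).
  assert (E : d * (2 * (Cmod a + Cmod b + 1)) = eps) by (unfold d; field; lra).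
  assert (Cmod (u n - a) * Cmod (v n - b) <= 1 * d) by (apply Rmult_le_compat; lra).
  assert (Cmod a * Cmod (v n - b) <= Cmod a * d) by (apply Rmult_le_compat_l; lra).
  assert (Cmod (u n - a) * Cmod b <= d * Cmod b) by (apply Rmult_le_compat_r; lra).
  nra.
Qed.

Lemma Clim_pow (u : nat -> C) (a : C) (k : nat) :
  Clim u a -> Clim (fun n => (u n ^ k)%C) (a ^ k)%C.
Proof.
  intros H. induction k as [|k IH]; [exact (Clim_const 1)|]. exact (Clim_mult _ _ _ _ H IH).
Qed.

Lemma Clim_inv (u : nat -> C) (a : C) : a <> 0%C -> Clim u a -> Clim (fun n => (/ u n)%C) (/ a)%C.
Proof.
  intros Ha H eps He.
  assert (Ha' := proj1 (Cmod_gt_0 a) Ha).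
  set (d := Rmin (Cmod a / 2) (eps * Cmod a ^ 2 / 2)).
  assert (Hd : 0 < d) by (unfold d; apply Rmin_glb_lt; positivity).
  assert (H3 := Rmin_l (Cmod a / 2) (eps * Cmod a ^ 2 / 2)).
  assert (H4 := Rmin_r (Cmod a / 2) (eps * Cmod a ^ 2 / 2)). fold d in H3, H4.
  destruct (H d Hd) as [N HN]. exists N. intros n Hn. specialize (HN n Hn).
  assert (Hun : Cmod a / 2 < Cmod (u n)).
  { pose proof (Cmod_triangle (u n) (a - u n)%C) as Ht.
    replace (u n + (a - u n))%C with a in Ht by ring. rewrite (Cmod_minus_sym a) in Ht. lra. }
  assert (Hne : u n <> 0%C) by (apply Cmod_gt_0; lra).
  replace (/ u n - / a)%C with (- (u n - a) * / (u n * a))%C by (field; split; assumption).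
  rewrite Cmod_mult, Cmod_opp, Cmod_inv, Cmod_mult.
  2:{ intros E. apply (f_equal Cmod) in E. rewrite Cmod_mult, Cmod_0 in E. nra. }
  apply Rmult_lt_reg_r with (Cmod (u n) * Cmod a); [nra|].
  rewrite Rmult_assoc, Rinv_l by nra. nra.
Qed.

Lemma Clim_inv_INR : Clim (fun n => (/ INR (S n))%C) 0%C.
Proof.
  intros eps He. destruct (archimed_cor1 eps He) as [N [HN HN0]]. exists N. intros n Hn.
  replace (/ INR (S n) - 0)%C with (/ INR (S n))%C by ring.
  rewrite Cmod_inv by (apply RtoC_neq_0, not_0_INR; lia).
  rewrite Cmod_R, Rabs_pos_eq by apply pos_INR.
  eapply Rle_lt_trans; [|exact HN].
  apply Rinv_le_contravar; [apply lt_0_INR; lia|apply le_INR; lia].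
Qed.

Lemma Clim_one_sub_qpar (v : C) :
  Clim (fun n => (INR (S n) * (1 - qpar (v / INR (S n))))%C) (- (itau * v))%C.
Proof.
  intros eps He. set (w := (itau * v)%C).
  pose proof (Cmod_ge_0 w) as Hw.
  assert (Hb : 0 < eps / (Cmod w ^ 2 * exp (Cmod w) + 1)).
  { apply Rdiv_lt_0_compat; [lra|]. assert (0 <= Cmod w ^ 2 * exp (Cmod w)) by positivity. lra. }
  destruct (archimed_cor1 _ Hb) as [N [HN HN0]]. exists N. intros n Hn.
  assert (HNn : 0 < INR (S n)) by (apply lt_0_INR; lia).
  assert (HSn : RtoC (INR (S n)) <> 0%C) by (apply RtoC_neq_0; lra).
  assert (Hn1 : / INR (S n) <= / INR N).
  { apply Rinv_le_contravar; [apply lt_0_INR; lia|apply le_INR; lia]. }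
  assert (E : (INR (S n) * (1 - qpar (v / INR (S n))) - - w)%C =
     (- (INR (S n) * (cexp (w / INR (S n)) - 1 - w / INR (S n))))%C).
  { unfold qpar. fold itau. replace (itau * (v / INR (S n)))%C with (w / INR (S n))%C
      by (unfold w; field; exact HSn). field. exact HSn. }
  rewrite E, Cmod_opp, Cmod_mult, Cmod_R, Rabs_pos_eq by lra.
  assert (Hwn : Cmod (w / INR (S n))%C = Cmod w * / INR (S n)).
  { rewrite Cmod_div by exact HSn. rewrite Cmod_R, Rabs_pos_eq by lra. reflexivity. }
  pose proof (Cmod_cexp_sub_1 (w / INR (S n))%C) as H1. rewrite Hwn in H1.
  assert (H2 : exp (Cmod w * / INR (S n)) <= exp (Cmod w)).
  { apply exp_le_compat. rewrite <- (Rmult_1_r (Cmod w)) at 2. apply Rmult_le_compat_l; [exact Hw|].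
    rewrite <- Rinv_1. apply Rinv_le_contravar; [lra|]. rewrite S_INR. pose proof (pos_INR n). lra. }
  apply Rle_lt_trans with (INR (S n) * ((Cmod w * / INR (S n)) ^ 2 * exp (Cmod w))).
  - apply Rmult_le_compat_l; [lra|]. eapply Rle_trans; [exact H1|].
    apply Rmult_le_compat_l; [|exact H2]. apply pow_le. positivity.
  - replace (INR (S n) * ((Cmod w * / INR (S n)) ^ 2 * exp (Cmod w)))
      with (Cmod w ^ 2 * exp (Cmod w) * / INR (S n)) by (field; lra).
    set (B := Cmod w ^ 2 * exp (Cmod w)) in *.
    assert (HB : 0 <= B) by (unfold B; positivity).
    apply Rle_lt_trans with (B * (eps / (B + 1))).
    + apply Rmult_le_compat_l; [exact HB|]. lra.
    + apply Rmult_lt_reg_r with (B + 1); [lra|]. unfold Rdiv.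
      replace (B * (eps * / (B + 1)) * (B + 1)) with (B * eps) by (field; lra). nra.
Qed.

Lemma is_series_telescoping :
  is_series (fun n => / (INR n + 1) - / (INR n + 2)) 1.
Proof.
  apply is_series_eps. intros eps He.
  destruct (archimed_cor1 eps He) as [N [HN HN0]]. exists N. intros n Hn.
  rewrite sum_n_Reals.
  assert (E : forall n, sum_f_R0 (fun n => / (INR n + 1) - / (INR n + 2)) n = 1 - / (INR n + 2)).
  { induction n0 as [|n0 IH]; [simpl; field|]. rewrite tech5, IH, S_INR.
    replace (INR n0 + 1 + 1) with (INR n0 + 2) by ring. ring. }
  rewrite E. replace (1 - / (INR n + 2) - 1) with (- / (INR n + 2)) by ring.
  pose proof (pos_INR n).
  rewrite Rabs_Ropp, Rabs_pos_eq by positivity.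
  eapply Rle_lt_trans; [|exact HN]. apply Rinv_le_contravar; [apply lt_0_INR, HN0|].
  apply le_INR in Hn. lra.
Qed.

Lemma ex_series_inv_pow (r : nat) : (2 <= r)%nat -> ex_series (fun n => / (INR n + 1) ^ r).
Proof.
  intros Hr.
  apply (ex_series_dominated _ (fun n => 2 * (/ (INR n + 1) - / (INR n + 2)))).
  - intros n. pose proof (pos_INR n).
    change (Rabs (/ (INR n + 1) ^ r) <= 2 * (/ (INR n + 1) - / (INR n + 2))).
    rewrite Rabs_pos_eq by positivity.
    apply Rle_trans with (/ (INR n + 1) ^ 2).
    + apply Rinv_le_contravar; [positivity|]. apply Rle_pow; [lra|exact Hr].
    + replace (2 * (/ (INR n + 1) - / (INR n + 2))) with (/ ((INR n + 1) * ((INR n + 2) / 2))) by (field; lra).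
      apply Rinv_le_contravar; [nra|]. simpl. nra.
  - apply ex_series_mult_l.
    eexists. apply is_series_telescoping.
Qed.

(** The range goes beyond 1/2 because the points (w + j) / (2M) have real part up to 1/2 + |Re w| /
    (2M) in modulus. The angle is halved so that the first Taylor bounds for sine and cosine are
    good enough. *)
Lemma sin_half_bound (x : R) : Rabs x <= 6 / 10 -> Rabs x / 2 <= Rabs (sin (PI * x)).
Proof.
  intros Hx. pose proof PI_4 as HP4. pose proof PI2_3_2 as HP3.
  assert (H : forall x, 0 <= x <= 6 / 10 -> x / 2 <= sin (PI * x)).
  { clear x Hx. intros x Hx.
    replace (PI * x) with (2 * (PI * x / 2)) by field. rewrite sin_2a.
    set (t := PI * x / 2). assert (Ht : 0 <= t <= 12 / 10) by (unfold t; nra).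
    assert (Hs : t - t ^ 3 / 6 <= sin t).
    { destruct (pre_sin_bound t 0 ltac:(lra) ltac:(lra)) as [Hl _].
      unfold sin_approx, sin_term in Hl. simpl in Hl. lra. }
    assert (Hc : 1 - t ^ 2 / 2 <= cos t).
    { destruct (pre_cos_bound t 0 ltac:(lra) ltac:(lra)) as [Hl _].
      unfold cos_approx, cos_term in Hl. simpl in Hl. lra. }
    assert (Hs' : t * (76 / 100) <= sin t) by nra.
    assert (Hc' : 28 / 100 <= cos t) by nra.
    assert (x * (15 / 10) / 1 <= 2 * t) by (unfold t; nra).
    assert (t * (76/100) * (28/100) <= sin t * cos t) by (apply Rmult_le_compat; nra).
    assert (3 / 2 * x <= t) by (unfold t; nra). nra. }
  destruct (Rcase_abs x).
  - rewrite Rabs_left in * by assumption. specialize (H (- x) ltac:(lra)).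
    replace (PI * - x) with (- (PI * x)) in H by ring. rewrite sin_neg in H.
    eapply Rle_trans; [exact H|]. rewrite <- Rabs_Ropp. apply Rle_abs.
  - rewrite (Rabs_right x) in * by assumption.
    eapply Rle_trans; [apply H; lra|apply Rle_abs].
Qed.

(** The first bound is 1 - e^(-t) >= t e^(-t) and serves points near an integer; the second comes
    from |1 - q|^2 = (1 - rho^2)^2 + 4 rho^2 sin^2(pi x) with rho = e^(-pi y). *)
Lemma one_sub_qpar_lower (x y : R) : 0 < y -> Rabs x <= 6 / 10 ->
  2 * PI * y * exp (- (2 * PI * y)) <= Cmod (1 - qpar (x, y))%C /\
  exp (- (PI * y)) * Rabs x <= Cmod (1 - qpar (x, y))%C.
Proof.
  intros Hy Hx. pose proof PI_RGT_0 as HPI. split.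
  - pose proof (Cmod_reverse_triangle 1 (- qpar (x, y))%C) as H.
    rewrite Cmod_opp, Cmod_1, Cmod_qpar in H. simpl Im in H.
    replace (-2 * PI * y) with (- (2 * PI * y)) in H by ring.
    eapply Rle_trans; [|exact H].
    pose proof (exp_ineq1_le (2 * PI * y)) as H1.
    pose proof (exp_pos (- (2 * PI * y))).
    assert (exp (2 * PI * y) * exp (- (2 * PI * y)) = 1) by (rewrite <- exp_plus, Rplus_opp_r; apply exp_0).
    nra.
  - pose proof (sin_half_bound x Hx) as Hs.
    set (rho := exp (- (PI * y))). assert (Hrho : 0 < rho) by apply exp_pos.
    set (sn := sin (PI * x)) in *.
    assert (Hsq : Cmod (1 - qpar (x, y))%C ^ 2 = (1 - rho ^ 2) ^ 2 + 4 * rho ^ 2 * sn ^ 2).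
    { rewrite Cmod2_alt. unfold qpar, cexp, Cmult, Re, Im, RtoC; simpl.
      rewrite !Rmult_0_l, Rplus_0_l, Rminus_0_l, !Rmult_1_r.
      replace (exp (- (2 * PI * y))) with (rho * rho).
      2:{ unfold rho. rewrite <- exp_plus. f_equal. ring. }
      replace (2 * PI * x) with (2 * (PI * x)) by ring.
      rewrite cos_2a_sin, sin_2a. fold sn.
      pose proof (sin2_cos2 (PI * x)) as Hsc. unfold Rsqr in Hsc. fold sn in Hsc.
      set (cs := cos (PI * x)) in *.
      assert (Hcc : cs * cs = 1 - sn * sn) by lra.
      transitivity ((1 - rho * rho * (1 - 2 * sn * sn)) ^ 2 + (rho * rho) ^ 2 * (4 * sn * sn) * (cs * cs)); [ring|].
      rewrite Hcc. ring. }
    apply Rsqr_incr_0_var; [|apply Cmod_ge_0]. rewrite !Rsqr_pow2, Hsq.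
    rewrite Rpow_mult_distr, pow2_abs.
    assert (x ^ 2 <= 4 * sn ^ 2).
    { rewrite <- (pow2_abs x), <- (pow2_abs sn). pose proof (Rabs_pos x). nra. }
    assert (0 <= (1 - rho ^ 2) ^ 2) by apply pow2_ge_0.
    assert (0 < rho ^ 2) by (apply pow_lt, Hrho). nra.
Qed.

Notation powser s := (qser (fun n => RtoC (INR n ^ s))).

Lemma powser_bin (s : nat) (c : nat -> R) :
  (forall m, RtoC (INR m ^ s) = csum (fun i => (c i * bin i m)%C) (S s)) ->
  forall u, inH u -> powser s u = csum (fun i => (c i * / (1 - qpar u) ^ S i)%C) (S s).
Proof.
  intros Hc u Hu.
  apply (sums_unique (fun m => (RtoC (INR m ^ s) * qpar u ^ m)%C)).
  - apply qser_sums; [apply subexp_pow|exact Hu].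
  - refine (sums_ext _ _ _ _ (sums_csum (fun i m => (c i * (bin i m * qpar u ^ m))%C) _ (S s) _)).
    + intros m. cbv beta. rewrite Hc.
      rewrite (csum_ext _ (fun j => (qpar u ^ m * (c j * bin j m))%C)) by (intros; ring).
      rewrite csum_scal. ring.
    + intros i _. cbv beta. rewrite <- qser_bin by exact Hu. apply sums_scal.
      apply qser_sums; [apply subexp_bin|exact Hu].
Qed.

(** Expand in powers of 1/(1 - q), q = [qpar u]. Since |1 - q| <= 2, each power up to s + 1 is at
    most a constant times the top one, which the factor N^(-s-1) matches. The constant does not
    depend on N, as Tannery's theorem requires. *)
Lemma powser_scaled_bound (s : nat) : exists B, 0 <= B /\ forall N u X, 0 < N -> inH u ->
  / (N * Cmod (1 - qpar u)%C) <= X -> Cmod (/ N ^ S s * powser s u)%C <= B * X ^ S s.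
Proof.
  destruct (pow_bin_basis s) as [c [Hc _]].
  exists (sum_f_R0 (fun i => Rabs (c i) * 2 ^ s) s). split.
  { apply cond_pos_sum. intros n. apply Rmult_le_pos; [apply Rabs_pos|apply pow_le; lra]. }
  intros N u X HN Hu HX.
  assert (HNC : RtoC N <> 0%C) by (apply RtoC_neq_0; lra).
  pose proof (qpar_neq_1 u Hu) as Hne.
  assert (Hpos := proj1 (Cmod_gt_0 _) Hne).
  set (t := Cmod (1 - qpar u)%C) in *.
  assert (Ht2 : t <= 2).
  { unfold t. eapply Rle_trans; [apply Cmod_triangle|]. rewrite Cmod_opp, Cmod_1.
    pose proof (Cmod_qpar_lt_1 u Hu). lra. }
  assert (HX0 : 0 < X).
  { eapply Rlt_le_trans; [|exact HX]. positivity. }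
  rewrite (powser_bin s c Hc u Hu), <- csum_scal.
  eapply Rle_trans; [apply (csum_Cmod_le _ (fun i => Rabs (c i) * 2 ^ s * X ^ S s))|].
  - intros i Hi. rewrite !Cmod_mult, Cmod_R.
    rewrite Cmod_inv, Cmod_inv by (apply Cpow_nz; assumption).
    rewrite !Cmod_pow, Cmod_R, (Rabs_pos_eq N) by lra. fold t.
    assert (E : / N ^ S s * (Rabs (c i) * / t ^ S i) =
       Rabs (c i) * (t ^ (s - i) * (/ (N * t)) ^ S s)).
    { rewrite pow_inv, Rpow_mult_distr.
      replace (t ^ S s) with (t ^ (s - i) * t ^ S i)
        by (rewrite <- pow_add; f_equal; lia).
      field. repeat split; apply pow_nonzero; lra. }
    rewrite E, Rmult_assoc. apply Rmult_le_compat_l; [apply Rabs_pos|].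
    assert (0 <= / (N * t)) by positivity.
    apply Rmult_le_compat; [apply pow_le; lra|apply pow_le; assumption| |apply pow_incr; lra].
    eapply Rle_trans; [apply pow_incr; split; [lra|exact Ht2]|]. apply Rle_pow; [lra|lia].
  - rewrite tech5. right. rewrite (Rmult_comm (sum_f_R0 _ _) (X ^ S s)), scal_sum. ring.
Qed.

(** Every power of 1/(1 - q) below the top one carries a spare factor 1/N and disappears; the top
    one converges because N (1 - e(v/N)) tends to -2 pi i v. *)
Lemma powser_scaled_lim (s : nat) (v : C) : inH v ->
  Clim (fun n => (/ INR (S n) ^ S s * powser s (v / INR (S n)))%C)
    (INR (fact s) * / (- itau * v) ^ S s)%C.
Proof.
  intros Hv. destruct (pow_bin_basis s) as [c [Hc [Hcs _]]].
  assert (Hvne : (- itau * v)%C <> 0%C).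
  { intros E. apply (f_equal Cmod) in E. rewrite Cmod_mult, Cmod_opp, Cmod_0 in E.
    apply Rmult_integral in E. destruct E as [E|E]; apply Cmod_eq_0 in E.
    - injection E. pose proof PI_RGT_0. lra.
    - exact (inH_neq_0 v Hv E). }
  assert (H := Clim_csum
    (fun n i => (c i * ((/ INR (S n)) ^ (s - i) * (/ (INR (S n) * (1 - qpar (v / INR (S n))))) ^ S i))%C)
    (fun i => (c i * (0 ^ (s - i) * (/ (- itau * v)) ^ S i))%C) (S s)).
  replace (INR (fact s) * / (- itau * v) ^ S s)%C
    with (csum (fun i => (c i * (0 ^ (s - i) * (/ (- itau * v)) ^ S i))%C) (S s)).
  - assert (H' := H ltac:(intros i; apply Clim_mult; [apply Clim_const|]; apply Clim_mult;
      apply Clim_pow; [exact Clim_inv_INR|apply Clim_inv; [exact Hvne|]];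
      replace (- itau * v)%C with (- (itau * v))%C by ring; apply Clim_one_sub_qpar)).
    clear H. intros eps He. destruct (H' eps He) as [N HN]. exists N. intros n Hn.
    specialize (HN n Hn).
    assert (HSn : 0 < INR (S n)) by (apply lt_0_INR; lia).
    assert (HSnC : RtoC (INR (S n)) <> 0%C) by (apply RtoC_neq_0; lra).
    assert (Hu : inH (v / INR (S n))%C) by (apply inH_div; assumption).
    rewrite (powser_bin s c Hc _ Hu), <- csum_scal.
    erewrite csum_ext; [exact HN|]. intros i Hi. cbv beta.
    pose proof (qpar_neq_1 _ Hu) as Hne.
    rewrite !Cpow_inv; try assumption.
    2:{ intros E. apply (f_equal Cmod) in E. rewrite Cmod_mult, Cmod_0 in E.
        apply Rmult_integral in E. destruct E as [E|E]; apply Cmod_eq_0 in E; contradiction. }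
    rewrite Cpow_mult_l.
    replace (INR (S n) ^ S s)%C with (INR (S n) ^ (s - i) * INR (S n) ^ S i)%C
      by (rewrite <- Cpow_add_r; f_equal; lia).
    field. repeat split; apply Cpow_nz; assumption.
  - cbn [csum]. rewrite csum_zero.
    + rewrite Nat.sub_diag, Cpow_inv by exact Hvne. rewrite Hcs. simpl (0 ^ 0)%C. ring.
    + intros i Hi. replace (s - i)%nat with (S (s - i - 1)) by lia. rewrite Cpow_S. ring.
Qed.

Lemma Clim_subseq (u : nat -> C) (a : C) (f : nat -> nat) :
  (forall n, (n <= f n)%nat) -> Clim u a -> Clim (fun n => u (f n)) a.
Proof.
  intros Hf H eps He. destruct (H eps He) as [N HN]. exists N. intros n Hn.
  apply HN. specialize (Hf n). lia.
Qed.

Lemma scaled_one_sub_lower (p y N : R) : 0 < y -> 1 <= N -> Rabs p <= 6 / 10 * N ->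
  2 * PI * y * exp (- (2 * PI * y)) <= N * Cmod (1 - qpar ((p, y) / N))%C /\
  exp (- (PI * y)) * Rabs p <= N * Cmod (1 - qpar ((p, y) / N))%C.
Proof.
  intros Hy HN Hp. pose proof PI_RGT_0 as HPI.
  assert (E : (((p, y) : C) / N)%C = ((p / N)%R, (y / N)%R)).
  { unfold Cdiv. rewrite <- RtoC_inv by lra.
    apply C_ext; unfold Cmult, RtoC, Re, Im; simpl; field; lra. }
  rewrite E.
  assert (HyN : y / N <= y).
  { apply Rmult_le_reg_r with N; [lra|]. unfold Rdiv. rewrite Rmult_assoc, Rinv_l by lra. nra. }
  assert (HpN : Rabs (p / N) = Rabs p / N).
  { unfold Rdiv. rewrite Rabs_mult, (Rabs_pos_eq (/ N)); [reflexivity|positivity]. }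
  destruct (one_sub_qpar_lower (p / N) (y / N)) as [H1 H2].
  - positivity.
  - rewrite HpN. apply Rmult_le_reg_r with N; [lra|]. unfold Rdiv at 1. rewrite Rmult_assoc, Rinv_l by lra. lra.
  - split.
    + apply Rle_trans with (N * (2 * PI * (y / N) * exp (- (2 * PI * (y / N))))).
      * replace (N * (2 * PI * (y / N) * exp (- (2 * PI * (y / N)))))
          with (2 * PI * y * exp (- (2 * PI * (y / N)))) by (field; lra).
        apply Rmult_le_compat_l; [positivity|]. apply exp_le_compat. nra.
      * apply Rmult_le_compat_l; [lra|exact H1].
    + apply Rle_trans with (N * (exp (- (PI * (y / N))) * Rabs (p / N))).
      * rewrite HpN. replace (N * (exp (- (PI * (y / N))) * (Rabs p / N)))
          with (exp (- (PI * (y / N))) * Rabs p) by (field; lra).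
        apply Rmult_le_compat_r; [apply Rabs_pos|]. apply exp_le_compat. nra.
      * apply Rmult_le_compat_l; [lra|exact H2].
Qed.

(* By the distribution relation, the right-hand side at w is an average of its values at the points (w + j) / 2M with -M <= j < M; as M grows each term tends to its polar part at 0, and Tannery's theorem applies. *)
Lemma lipschitz_formula (s : nat) (w : C) : (1 <= s)%nat -> inH w ->
  sums (fun l => (/ (w + INR l) ^ S s + / (w - INR l - 1) ^ S s)%C)
    ((- itau) ^ S s / INR (fact s) * powser s w)%C.
Proof.
  intros Hs Hw. destruct w as [x y]. unfold inH in Hw. simpl in Hw.
  set (w := (x, y) : C) in *.
  assert (Hw' : inH w) by exact Hw.
  pose proof PI_RGT_0 as HPI.
  assert (Hfact : RtoC (INR (fact s)) <> 0%C) by (apply RtoC_neq_0, INR_fact_neq_0).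
  assert (Htau : (- itau)%C <> 0%C).
  { intros E. injection E. lra. }
  assert (Hwl : forall l : nat, inH (w + INR l)%C) by (intros; apply inH_add_R, Hw').
  assert (Hwm : forall l : nat, inH (w - INR l - 1)%C).
  { intros l. replace (w - INR l - 1)%C with (w + (- INR l - 1)%R)%C.
    - apply inH_add_R, Hw'.
    - rewrite RtoC_minus, RtoC_opp. ring. }
  destruct (powser_scaled_bound s) as [B [HB0 HB]].
  set (X := Rabs x). assert (HX : 0 <= X) by apply Rabs_pos.
  set (c1 := 2 * PI * y * exp (- (2 * PI * y))). assert (Hc1 : 0 < c1) by (unfold c1; positivity).
  set (c2 := exp (- (PI * y))). assert (Hc2 : 0 < c2) by (unfold c2; positivity).
  (* For l + 1 <= 2 (X + 1) the vertical bound [c1] is used; for larger l the horizontal one, as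
     then l - X >= (l + 1)/2. *)
  set (kap := Rmin (c1 / (2 * (X + 1))) (c2 / 2)).
  assert (Hk1 := Rmin_l (c1 / (2 * (X + 1))) (c2 / 2)).
  assert (Hk2 := Rmin_r (c1 / (2 * (X + 1))) (c2 / 2)). fold kap in Hk1, Hk2.
  assert (Hkap : 0 < kap).
  { unfold kap. apply Rmin_glb_lt; [|lra]. apply Rdiv_lt_0_compat; lra. }
  assert (Hlow : forall (p N : R) (l : nat), 1 <= N -> Rabs p <= 6 / 10 * N -> INR l - X <= Rabs p ->
     / (N * Cmod (1 - qpar ((p, y) / N))%C) <= / (kap * (INR l + 1))).
  { intros p N l HN Hp Hl. destruct (scaled_one_sub_lower p y N Hw HN Hp) as [H1 H2].
    fold c1 in H1. fold c2 in H2. pose proof (pos_INR l).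
    apply Rinv_le_contravar; [positivity|].
    destruct (Rle_dec (INR l + 1) (2 * (X + 1))) as [Hc|Hc].
    - eapply Rle_trans; [|exact H1].
      apply Rle_trans with (c1 / (2 * (X + 1)) * (2 * (X + 1))).
      + apply Rmult_le_compat; lra.
      + right. field. lra.
    - eapply Rle_trans; [|exact H2].
      apply Rle_trans with (c2 / 2 * (INR l + 1)); [apply Rmult_le_compat_r; lra|]. nra. }
  assert (HT : sums (fun l => (INR (fact s) * / (- itau * (w + INR l)) ^ S s +
                        INR (fact s) * / (- itau * (w - INR l - 1)) ^ S s)%C) (powser s w)).
  (* The number 2M of points is written [S (2 * M - 1)] because the limits above are indexed by the
     successor. *)
  { apply (tannery
      (fun M l => (/ INR (S (2 * M - 1)) ^ S s * powser s ((w + INR l) / INR (S (2 * M - 1))) +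
                   / INR (S (2 * M - 1)) ^ S s * powser s ((w - INR l - 1) / INR (S (2 * M - 1))))%C)
      _ (fun l => 2 * B * (/ kap) ^ S s * / (INR l + 1) ^ S s)).
    - intros l. apply Clim_plus.
      + apply (Clim_subseq (fun n => (/ INR (S n) ^ S s * powser s ((w + INR l) / INR (S n)))%C) _
           (fun M => (2 * M - 1)%nat)); [intros; lia|]. apply powser_scaled_lim, Hwl.
      + apply (Clim_subseq (fun n => (/ INR (S n) ^ S s * powser s ((w - INR l - 1) / INR (S n)))%C) _
           (fun M => (2 * M - 1)%nat)); [intros; lia|]. apply powser_scaled_lim, Hwm.
    - destruct (INR_unbounded (5 * X)) as [M0 HM0]. exists (S M0). intros M l HM Hl.
      replace (S (2 * M - 1)) with (2 * M)%nat by lia.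
      assert (HMr : INR M0 + 1 <= INR M) by (rewrite <- S_INR; apply le_INR; exact HM).
      assert (HlM : INR l + 1 <= INR M) by (rewrite <- S_INR; apply le_INR; exact Hl).
      pose proof (pos_INR l) as Hl0. pose proof (pos_INR M0).
      assert (HN : INR (2 * M) = 2 * INR M) by (rewrite mult_INR; reflexivity).
      assert (HN1 : 1 <= INR (2 * M)) by lra.
      assert (Hx1 : x <= X) by apply Rle_abs.
      assert (Hx2 : - x <= X) by (unfold X; rewrite <- Rabs_Ropp; apply Rle_abs).
      eapply Rle_trans; [apply Cmod_triangle|].
      replace (2 * B * (/ kap) ^ S s * / (INR l + 1) ^ S s) with
        (B * (/ (kap * (INR l + 1))) ^ S s + B * (/ (kap * (INR l + 1))) ^ S s).
      2:{ rewrite Rinv_mult, Rpow_mult_distr, !pow_inv. ring. }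
      apply Rplus_le_compat; apply HB; try lra.
      + apply inH_div; [lra|apply Hwl].
      + replace (w + INR l)%C with (((x + INR l)%R, y) : C)
          by (apply C_ext; unfold w, Re, Im; simpl; ring).
        apply Hlow; [lra| |].
        * apply Rabs_le. lra.
        * pose proof (Rle_abs (x + INR l)). lra.
      + apply inH_div; [lra|apply Hwm].
      + replace (w - INR l - 1)%C with (((x - INR l - 1)%R, y) : C)
          by (apply C_ext; unfold w, Re, Im; simpl; ring).
        apply Hlow; [lra| |].
        * apply Rabs_le. lra.
        * pose proof (Rle_abs (- (x - INR l - 1))) as Ha. rewrite Rabs_Ropp in Ha. lra.
    - apply ex_series_mult_l.
      apply ex_series_inv_pow. lia.
    - exists 1%nat. intros M HM. replace (S (2 * M - 1)) with (2 * M)%nat by lia.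
      assert (HN : 0 < INR (2 * M)) by (apply lt_0_INR; lia).
      assert (HNC : RtoC (INR (2 * M)) <> 0%C) by (apply RtoC_neq_0; lra).
      rewrite csum_plus, !csum_scal.
      rewrite (csum_rev (fun i => powser s ((w - INR i - 1) / INR (2 * M))%C)).
      rewrite <- Cmult_plus_distr_l.
      replace (csum (fun i => powser s ((w + INR i) / INR (2 * M))%C) M +
         csum (fun i => powser s ((w - INR (M - 1 - i) - 1) / INR (2 * M))%C) M)%C
        with (csum (fun j => powser s ((w + INR j) / INR (2 * M))%C) (2 * M)).
      + rewrite qser_pow_distribution by (lia || exact Hw').
        field. apply Cpow_nz; exact HNC.
      + transitivity (csum (fun j => powser s ((w + INR j) / INR (2 * M))%C) (M + M));
          [f_equal; lia|].
        rewrite csum_add. f_equal. apply csum_ext. intros i Hi.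
        (* The points (w - M + i) / (2M) and (w + M + i) / (2M) differ by the period 1. *)
        symmetry. rewrite <- qser_periodic. f_equal.
        rewrite plus_INR, !minus_INR by lia. rewrite mult_INR. simpl (INR 1). simpl (INR 2).
        replace (INR 2) with 2 by reflexivity.
        assert (RtoC (INR M) <> 0%C) by (apply RtoC_neq_0; apply not_0_INR; lia).
        rewrite !RtoC_minus, !RtoC_mult, !RtoC_plus. field.
        assumption. }
  refine (sums_ext _ _ _ _ (sums_scal ((- itau) ^ S s / INR (fact s))%C _ _ HT)).
  intros l. cbv beta. rewrite !Cpow_mult_l.
  field. repeat split; try assumption; apply Cpow_nz; try assumption; apply inH_neq_0; auto.
Qed.

(** * Bessel expansion of the Lipschitz formula *)

(* The normalised Bessel function 0F1(; nu + 1; - t); thus J_nu(x) = (x/2)^nu / nu! * bes nu (x^2/4). *)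
Definition bes (nu : nat) (t : R) : R :=
  Series (fun j => (- t) ^ j * (INR (fact nu) / (INR (fact j) * INR (fact (nu + j))))).

Lemma fact_mul_le (nu j : nat) : (fact nu * fact j <= fact (nu + j))%nat.
Proof.
  induction j as [|j IH]; [rewrite Nat.add_0_r; simpl; lia|].
  rewrite Nat.add_succ_r. rewrite !fact_simpl.
  apply Nat.le_trans with (S j * (fact nu * fact j))%nat; [nia|].
  apply Nat.mul_le_mono; lia.
Qed.

Lemma bes_coef_bound (nu j : nat) :
  0 < INR (fact nu) / (INR (fact j) * INR (fact (nu + j))) <= / INR (fact j) * / INR (fact j).
Proof.
  pose proof (INR_fact_lt_0 nu). pose proof (INR_fact_lt_0 j). pose proof (INR_fact_lt_0 (nu + j)).
  pose proof (le_INR _ _ (fact_mul_le nu j)) as H2. rewrite mult_INR in H2.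
  split; [positivity|].
  apply Rmult_le_reg_r with (INR (fact j) * INR (fact (nu + j))); [positivity|].
  field_simplify; [|lra|lra].
  apply Rmult_le_reg_r with (INR (fact j)); [lra|]. field_simplify; lra.
Qed.

Lemma bes_term_bound (nu j : nat) (t : R) :
  Rabs ((- t) ^ j * (INR (fact nu) / (INR (fact j) * INR (fact (nu + j))))) <=
  Rabs t ^ j / INR (fact j) * / INR (fact j).
Proof.
  destruct (bes_coef_bound nu j) as [H1 H2].
  rewrite Rabs_mult, <- RPow_abs, Rabs_Ropp, (Rabs_pos_eq (_ / _)) by lra.
  unfold Rdiv at 2. rewrite Rmult_assoc.
  apply Rmult_le_compat_l; [apply pow_le, Rabs_pos|exact H2].
Qed.

Lemma ex_series_bes (nu : nat) (t : R) :
  ex_series (fun j => (- t) ^ j * (INR (fact nu) / (INR (fact j) * INR (fact (nu + j))))).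
Proof.
  apply (ex_series_dominated _ (fun j => Rabs t ^ j / INR (fact j))).
  - intros j. eapply Rle_trans; [apply bes_term_bound|].
    pose proof (INR_fact_lt_0 j). pose proof (Rabs_pos t).
    rewrite <- Rmult_1_r. apply Rmult_le_compat_l; [positivity|].
    rewrite <- Rinv_1. apply Rinv_le_contravar; [lra|].
    change 1 with (INR 1). apply le_INR, lt_O_fact.
  - eexists. apply is_series_exp.
Qed.

(** Split X x = (eps x)(X / eps): one of the two factors 1/j! turns the power of eps x into e^(eps
    x), the other sums the powers of X / eps. Thus [bes] grows subexponentially in x. *)
Lemma bes_bound (nu : nat) (X x eps : R) : 0 <= X -> 0 <= x -> 0 < eps ->
  Rabs (bes nu (X * x)) <= exp (X / eps) * exp (eps * x).
Proof.
  intros HX Hx He. unfold bes.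
  assert (Hterm : forall j, Rabs ((- (X * x)) ^ j * (INR (fact nu) / (INR (fact j) * INR (fact (nu + j)))))
      <= exp (eps * x) * ((X / eps) ^ j / INR (fact j))).
  { intros j. eapply Rle_trans; [apply bes_term_bound|].
    pose proof (INR_fact_lt_0 j).
    rewrite Rabs_pos_eq by positivity.
    replace ((X * x) ^ j / INR (fact j) * / INR (fact j)) with
      ((eps * x) ^ j / INR (fact j) * ((X / eps) ^ j / INR (fact j))).
    - apply Rmult_le_compat_r; [positivity|]. apply pow_div_fact_le_exp. positivity.
    - replace (X * x) with ((eps * x) * (X / eps)) by (field; lra).
      rewrite (Rpow_mult_distr (eps * x)). field. lra. }
  assert (Hser : is_series (fun j => exp (eps * x) * ((X / eps) ^ j / INR (fact j)))
     (exp (eps * x) * exp (X / eps))).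
  { apply (is_series_scal_l (K := R_AbsRing) (V := R_NormedModule)). apply is_series_exp. }
  rewrite (Rmult_comm (exp (X / eps))), <- (is_series_unique _ _ Hser).
  eapply Rle_trans; [apply Series_Rabs|].
  - apply (ex_series_dominated _ (fun j => exp (eps * x) * ((X / eps) ^ j / INR (fact j)))); [|eexists; exact Hser].
    intros j. change (Rabs (Rabs ((- (X * x)) ^ j * (INR (fact nu) / (INR (fact j) * INR (fact (nu + j))))))
      <= exp (eps * x) * ((X / eps) ^ j / INR (fact j))).
    rewrite Rabs_Rabsolu. apply Hterm.
  - apply Series_le; [|eexists; exact Hser].
    intros j. split; [apply Rabs_pos|apply Hterm].
Qed.

(** For k = nu + 1 divisible by 4 this is the n-th Fourier coefficient in w of the sum over integers
    l of (w + l)^(-k) e(-mu / (w + l)); the usual factor (-2 pi i)^k is then (2 pi)^k. *)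
Definition kcoef (nu : nat) (mu : R) (n : nat) : R :=
  (2 * PI) ^ S nu / INR (fact nu) * INR n ^ nu * bes nu (4 * PI ^ 2 * mu * INR n).

Lemma kcoef_bound (nu : nat) (M eps : R) : 0 <= M -> 0 < eps ->
  exists K, 0 <= K /\ forall mu n, 0 <= mu <= M -> Rabs (kcoef nu mu n) <= K * exp (eps * INR n).
Proof.
  intros HM He. pose proof PI_RGT_0 as HPI. pose proof (INR_fact_lt_0 nu) as Hf.
  set (K := (2 * PI) ^ S nu / INR (fact nu) * (INR (fact nu) / (eps / 2) ^ nu) * exp (4 * PI ^ 2 * M / (eps / 2))).
  exists K. split; [unfold K; positivity|]. intros mu n Hmu. pose proof (pos_INR n) as Hn.
  unfold kcoef. rewrite !Rabs_mult.
  rewrite (Rabs_pos_eq (_ / _)), (Rabs_pos_eq (INR n ^ nu)) by positivity.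
  assert (H1 := pow_le_exp nu (eps / 2) (INR n) ltac:(lra) Hn).
  assert (H2 := bes_bound nu (4 * PI ^ 2 * mu) (INR n) (eps / 2)
    ltac:(destruct Hmu; positivity) Hn ltac:(lra)).
  assert (H3 : exp (4 * PI ^ 2 * mu / (eps / 2)) <= exp (4 * PI ^ 2 * M / (eps / 2))).
  { apply exp_le_compat. apply Rmult_le_compat_r; [positivity|].
    apply Rmult_le_compat_l; [positivity|lra]. }
  replace (K * exp (eps * INR n)) with
    ((2 * PI) ^ S nu / INR (fact nu) * (INR (fact nu) / (eps / 2) ^ nu * exp (eps / 2 * INR n)) *
       (exp (4 * PI ^ 2 * M / (eps / 2)) * exp (eps / 2 * INR n))).
  2:{ unfold K. replace (eps * INR n) with (eps / 2 * INR n + eps / 2 * INR n) by field.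
      rewrite exp_plus. ring. }
  apply Rmult_le_compat; [positivity|apply Rabs_pos| |].
  - apply Rmult_le_compat_l; [positivity|exact H1].
  - eapply Rle_trans; [exact H2|]. apply Rmult_le_compat_r; [positivity|exact H3].
Qed.

Lemma subexp_kcoef (nu : nat) (mu : R) : 0 <= mu -> subexp (fun n => RtoC (kcoef nu mu n)).
Proof.
  intros Hmu eps He. destruct (kcoef_bound nu mu eps Hmu He) as [K [_ HK]].
  exists K. intros n. rewrite Cmod_R. apply HK. lra.
Qed.

(** The imaginary part controls p, and then the triangle inequality controls q. The constant depends
    on z alone, which yields the absolute convergence of the lattice sums. *)
Lemma linear_form_lower (z : C) : inH z -> exists d, 0 < d /\
  forall p q : R, d * (Rabs p + Rabs q) <= Cmod (p * z + q)%C.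
Proof.
  intros Hz. unfold inH in Hz. set (y := Im z) in *. pose proof (Cmod_ge_0 z) as Hz0.
  set (D := 1 + (1 + Cmod z) / y).
  assert (HD : 0 < D) by (unfold D; assert (0 < (1 + Cmod z) / y) by positivity; lra).
  exists (/ D). split; [positivity|]. intros p q.
  assert (H1 : Rabs p * y <= Cmod (p * z + q)%C).
  { eapply Rle_trans; [|apply Im_le_Cmod].
    replace (Im (p * z + q)%C) with (p * y) by (unfold y, Im; simpl; ring).
    rewrite Rabs_mult, (Rabs_pos_eq y) by lra. lra. }
  assert (H2 : Rabs q - Rabs p * Cmod z <= Cmod (p * z + q)%C).
  { pose proof (Cmod_reverse_triangle q (p * z)%C) as H.
    rewrite Cplus_comm in H. rewrite Cmod_mult, !Cmod_R in H. exact H. }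
  set (t := Cmod (p * z + q)%C) in *.
  assert (H3 : Rabs p <= t / y).
  { apply Rmult_le_reg_r with y; [exact Hz|]. unfold Rdiv. rewrite Rmult_assoc, Rinv_l by lra. lra. }
  apply Rmult_le_reg_l with D; [exact HD|]. rewrite <- Rmult_assoc, Rinv_r by lra.
  unfold D. replace ((1 + (1 + Cmod z) / y) * t) with (t + t / y + Cmod z * (t / y)) by (field; lra).
  assert (Rabs p * Cmod z <= Cmod z * (t / y)) by (rewrite Rmult_comm; apply Rmult_le_compat_l; lra).
  lra.
Qed.

Lemma inv_pow_linear_form_bound (w : C) (nu : nat) : inH w -> exists D, 0 <= D /\ forall l : nat,
  Cmod (/ (w + INR l) ^ S nu)%C <= D * / (INR l + 1) ^ S nu /\
  Cmod (/ (w - INR l - 1) ^ S nu)%C <= D * / (INR l + 1) ^ S nu.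
Proof.
  intros Hw. destruct (linear_form_lower w Hw) as [d [Hd H]].
  exists (/ d ^ S nu). split; [positivity|]. intros l.
  pose proof (pos_INR l) as Hl.
  assert (Hgen : forall v : C, d * (INR l + 1) <= Cmod v ->
     Cmod (/ v ^ S nu)%C <= / d ^ S nu * / (INR l + 1) ^ S nu).
  { intros v Hv. assert (Hv0 : 0 < Cmod v) by (eapply Rlt_le_trans; [|exact Hv]; positivity).
    rewrite Cmod_inv, Cmod_pow by (apply Cpow_nz, Cmod_gt_0, Hv0).
    rewrite <- Rinv_mult, <- Rpow_mult_distr.
    apply Rinv_le_contravar; [apply pow_lt; positivity|]. apply pow_incr.
    split; [positivity|exact Hv]. }
  split; apply Hgen.
  - specialize (H 1 (INR l)). rewrite Rabs_R1, Rabs_pos_eq, Cmult_1_l in H by lra. lra.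
  - specialize (H 1 (- INR l - 1)). rewrite Rabs_R1, Cmult_1_l in H.
    rewrite <- Rabs_Ropp, Rabs_pos_eq in H by lra.
    replace (w - INR l - 1)%C with (w + RtoC (- INR l - 1))%C.
    + eapply Rle_trans; [|exact H]. apply Rmult_le_compat_l; lra.
    + rewrite RtoC_minus, RtoC_opp. ring.
Qed.

Lemma Cmod_itau : Cmod itau = 2 * PI.
Proof.
  replace itau with (RtoC (2 * PI) * Ci)%C by (apply C_ext; unfold Re, Im; simpl; ring).
  pose proof PI_RGT_0. rewrite Cmod_mult, Cmod_Ci, Cmod_R, Rabs_pos_eq; lra.
Qed.

Lemma itau_sqr : (- itau * - itau)%C = RtoC (- (4 * PI ^ 2)).
Proof. unfold itau. apply C_ext; unfold Re, Im; simpl; ring. Qed.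

Lemma itau_pow (k : nat) : (k mod 4 = 0)%nat -> ((- itau) ^ k)%C = RtoC ((2 * PI) ^ k).
Proof.
  intros Hk. rewrite (Nat.div_mod_eq k 4), Hk, Nat.add_0_r.
  rewrite Cpow_mult_r, pow_mult, RtoC_pow. f_equal.
  replace ((- itau) ^ 4)%C with ((- itau * - itau) * (- itau * - itau))%C by (simpl; ring).
  rewrite itau_sqr, <- RtoC_mult. f_equal. ring.
Qed.

Lemma Cmod_ge_Im (v : C) (y : R) : 0 < y -> y <= Im v -> y <= Cmod v.
Proof.
  intros Hy H. eapply Rle_trans; [|apply Im_le_Cmod]. rewrite Rabs_pos_eq; lra.
Qed.

(* Expand e(-mu/v) in powers of 1/v and apply the Lipschitz formula to each power. *)
Lemma bessel_lipschitz (nu : nat) (mu : R) (w : C) :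
  (1 <= nu)%nat -> (S nu mod 4 = 0)%nat -> 0 <= mu -> inH w ->
  sums (fun l => (/ (w + INR l) ^ S nu * qpar (- (mu / (w + INR l))) +
                  / (w - INR l - 1) ^ S nu * qpar (- (mu / (w - INR l - 1))))%C)
    (qser (fun n => RtoC (kcoef nu mu n)) w).
Proof.
  intros Hnu H4 Hmu Hw. pose proof PI_RGT_0 as HPI.
  set (y := Im w). assert (Hy : 0 < y) by exact Hw.
  assert (Hwl : forall l : nat, inH (w + INR l)%C) by (intros; apply inH_add_R, Hw).
  assert (HwmE : forall l : nat, (w - INR l - 1)%C = (w + (- INR l - 1)%R)%C).
  { intros l. rewrite RtoC_minus, RtoC_opp. ring. }
  assert (Hwm : forall l : nat, inH (w - INR l - 1)%C)
    by (intros l; rewrite HwmE; apply inH_add_R, Hw).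
  assert (Hyl : forall l : nat, y <= Cmod (w + INR l)%C).
  { intros l. apply Cmod_ge_Im; [exact Hy|]. unfold y, Im; simpl; lra. }
  assert (Hym : forall l : nat, y <= Cmod (w - INR l - 1)%C).
  { intros l. rewrite HwmE. apply Cmod_ge_Im; [exact Hy|]. unfold y, Im; simpl; lra. }
  set (g := fun j : nat => ((- itau * mu) ^ j * / INR (fact j))%C).
  set (al := fun l j : nat => (g j * (/ (w + INR l) ^ S (nu + j) + / (w - INR l - 1) ^ S (nu + j)))%C).
  set (col := fun j => (g j * ((- itau) ^ S (nu + j) / INR (fact (nu + j)) * powser (nu + j) w))%C).
  assert (Hfac : forall j, RtoC (INR (fact j)) <> 0%C)
    by (intros; apply RtoC_neq_0, INR_fact_neq_0).
  assert (Hg : forall j, Cmod (g j) = (2 * PI * mu) ^ j / INR (fact j)).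
  { intros j. unfold g. rewrite Cmod_mult, Cmod_pow, Cmod_inv, Cmod_mult, Cmod_opp, Cmod_itau, !Cmod_R by apply Hfac.
    rewrite !Rabs_pos_eq; [reflexivity|apply pos_INR|exact Hmu]. }
  destruct (inv_pow_linear_form_bound w nu Hw) as [D [HD0 HD]].
  (* Exchange of l with the power j: |w + l| >= y splits the bound into a convergent sum over l and
     the terms of the series for e^(2 pi mu / y). *)
  destruct (sums_swap al (fun l => 2 * D * / (INR l + 1) ^ S nu)
     (fun j => (2 * PI * mu / y) ^ j / INR (fact j))
     (fun l => (/ (w + INR l) ^ S nu * qpar (- (mu / (w + INR l))) +
                  / (w - INR l - 1) ^ S nu * qpar (- (mu / (w - INR l - 1))))%C) col)
    as [S1 S2].
  - intros l j. unfold al. rewrite Cmod_mult, Hg.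
    destruct (HD l) as [HD1 HD2]. pose proof (INR_fact_lt_0 j).
    assert (Hv : forall v : C, y <= Cmod v -> Cmod (/ v ^ S nu)%C <= D * / (INR l + 1) ^ S nu ->
        Cmod (/ v ^ S (nu + j))%C <= D * / (INR l + 1) ^ S nu * / y ^ j).
    { intros v Hv1 Hv2. assert (Hv0 : v <> 0%C) by (apply Cmod_gt_0; lra).
      replace (/ v ^ S (nu + j))%C with (/ v ^ S nu * / v ^ j)%C.
      2:{ change (S (nu + j)) with (S nu + j)%nat. rewrite Cpow_add_r. field.
          split; apply Cpow_nz, Hv0. }
      rewrite Cmod_mult. apply Rmult_le_compat; try apply Cmod_ge_0; [exact Hv2|].
      rewrite Cmod_inv, Cmod_pow by (apply Cpow_nz, Hv0).
      apply Rinv_le_contravar; [positivity|]. apply pow_incr. lra. }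
    pose proof (Hv _ (Hyl l) HD1) as B1. pose proof (Hv _ (Hym l) HD2) as B2.
    pose proof (Cmod_triangle (/ (w + INR l) ^ S (nu + j)) (/ (w - INR l - 1) ^ S (nu + j)))%C as B3.
    assert (Hy' : 0 < y ^ j) by positivity.
    apply Rle_trans with ((2 * PI * mu) ^ j / INR (fact j) * (2 * (D * / (INR l + 1) ^ S nu * / y ^ j))).
    + apply Rmult_le_compat_l; [positivity|lra].
    + right. unfold Rdiv. rewrite (Rpow_mult_distr (2 * PI * mu)), pow_inv. ring.
  - intros l. pose proof (pos_INR l). positivity.
  - apply ex_series_mult_l, ex_series_inv_pow. lia.
  - eexists. apply is_series_exp.
  - intros l. unfold al, g.
    assert (Hone : forall v : C, v <> 0%C ->
      sums (fun j => ((- itau * mu) ^ j * / INR (fact j) * / v ^ S (nu + j))%C)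
         (/ v ^ S nu * qpar (- (mu / v)))%C).
    { intros v Hv. unfold qpar. fold itau.
      refine (sums_ext _ _ _ _ (sums_scal (/ v ^ S nu)%C _ _ (cexp_series (itau * - (mu / v))%C))).
      intros j. cbv beta. replace (itau * - (mu / v))%C with ((- itau * mu) * / v)%C by (field; exact Hv).
      rewrite (Cpow_mult_l (- itau * mu)), Cpow_inv by exact Hv.
      change (S (nu + j)) with (S nu + j)%nat. rewrite Cpow_add_r. field.
      repeat split; try apply Hfac; apply Cpow_nz, Hv. }
    refine (sums_ext _ _ _ _ (sums_plus _ _ _ _ (Hone _ (inH_neq_0 _ (Hwl l))) (Hone _ (inH_neq_0 _ (Hwm l))))).
    intros j. cbv beta. ring.
  - intros j. unfold al, col. apply sums_scal. apply lipschitz_formula; [lia|exact Hw].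
  - match type of S1 with sums _ ?v => set (V := v) in * end.
    cut (V = qser (fun n => RtoC (kcoef nu mu n)) w); [intros <-; exact S1|]. clear S1.
    set (X := 4 * PI ^ 2 * mu). assert (HX : 0 <= X) by (unfold X; positivity).
    set (gam := fun j => (2 * PI) ^ S nu * ((- X) ^ j * / (INR (fact j) * INR (fact (nu + j))))).
    assert (Hcol : forall j, col j = (gam j * powser (nu + j) w)%C).
    { intros j. unfold col, gam, g.
      change (S (nu + j)) with (S nu + j)%nat. rewrite Cpow_add_r, itau_pow by exact H4.
      rewrite Cpow_mult_l.
      replace (RtoC ((2 * PI) ^ S nu * ((- X) ^ j * / (INR (fact j) * INR (fact (nu + j))))))
        with ((2 * PI)%R ^ S nu * (((- itau * - itau) * mu) ^ j * / (INR (fact j) * INR (fact (nu + j)))))%C.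
      - rewrite !Cpow_mult_l. rewrite !RtoC_pow. field. split; apply Hfac.
      - rewrite itau_sqr, <- !RtoC_mult, <- !RtoC_pow, <- RtoC_inv, <- !RtoC_mult.
        + do 4 f_equal. unfold X. ring.
        + apply Rmult_integral_contrapositive; split; apply INR_fact_neq_0. }
    (* The second exchange, of j with n. Here e^(-2 pi y n) = e^(-4 eps n); n^nu and n^j cost e^(eps
       n) each, the latter with a factor j! / eps^j that one of the two inverse factorials
       absorbs. *)
    set (eps := PI * y / 2). assert (He : 0 < eps) by (unfold eps; positivity).
    destruct (subexp_pow nu eps He) as [K HK].
    assert (HK0 : 0 <= K).
    { specialize (HK 0%nat). simpl INR in HK. rewrite Rmult_0_r, exp_0, Rmult_1_r in HK.
      eapply Rle_trans; [apply Cmod_ge_0|exact HK]. }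
    destruct (sums_swap (fun j n => (gam j * (RtoC (INR n ^ (nu + j)) * qpar w ^ n))%C)
      (fun j => (2 * PI) ^ S nu * ((X / eps) ^ j / INR (fact j)))
      (fun n => K * exp (- (2 * eps) * INR n)) col
      (fun n => (kcoef nu mu n * qpar w ^ n)%C)) as [T1 T2].
    + intros j n. rewrite Cmod_mult, Cmod_qterm. fold y.
      pose proof (INR_fact_lt_0 j) as Hfj. pose proof (pos_INR n) as Hn.
      pose proof (INR_fact_lt_0 (nu + j)) as Hfnj.
      assert (Hgam : Cmod (gam j) <= (2 * PI) ^ S nu * (X ^ j * (/ INR (fact j) * / INR (fact j)))).
      { unfold gam. rewrite Cmod_R, !Rabs_mult. rewrite (Rabs_pos_eq ((2 * PI) ^ S nu)) by positivity.
        apply Rmult_le_compat_l; [positivity|].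
        rewrite <- RPow_abs, Rabs_Ropp, (Rabs_pos_eq X) by exact HX.
        apply Rmult_le_compat_l; [positivity|]. rewrite Rabs_pos_eq by positivity.
        rewrite Rinv_mult. apply Rmult_le_compat_l; [positivity|].
        apply Rinv_le_contravar; [exact Hfj|]. apply le_INR, fact_le. lia. }
      specialize (HK n). rewrite Cmod_R, Rabs_pos_eq in HK by positivity.
      rewrite (Cmod_R (INR n ^ _)), Rabs_pos_eq by positivity.
      pose proof (pow_le_exp j eps (INR n) He Hn) as Hj.
      rewrite pow_add.
      replace ((2 * PI) ^ S nu * ((X / eps) ^ j / INR (fact j)) * (K * exp (- (2 * eps) * INR n)))
        with ((2 * PI) ^ S nu * (X ^ j * (/ INR (fact j) * / INR (fact j))) *
           ((K * exp (eps * INR n)) * (INR (fact j) / eps ^ j * exp (eps * INR n)) * exp (- (2 * PI * y) * INR n))).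
      2:{ replace (exp (- (2 * eps) * INR n)) with
            (exp (eps * INR n) * exp (eps * INR n) * exp (- (2 * PI * y) * INR n)).
          - unfold Rdiv. rewrite (Rpow_mult_distr X), pow_inv. field. split; [lra|apply pow_nonzero; lra].
          - rewrite <- !exp_plus. f_equal. unfold eps. field. }
      apply Rmult_le_compat; [apply Cmod_ge_0|positivity|exact Hgam|].
      apply Rmult_le_compat_r; [positivity|].
      apply Rmult_le_compat; [positivity|positivity|exact HK|exact Hj].
    + intros j. pose proof (INR_fact_lt_0 j). positivity.
    + apply ex_series_mult_l. eexists. apply is_series_exp.
    + apply ex_series_exp_neg. lra.
    + intros j. rewrite Hcol. apply sums_scal. apply qser_sums; [apply subexp_pow|exact Hw].
    + intros n.
      assert (Hb := sums_RtoC _ _ (Series_correct _ (ex_series_bes nu (X * INR n)))).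
      fold (bes nu (X * INR n)) in Hb.
      refine (sums_ext _ _ _ _ _).
      2:{ replace (kcoef nu mu n * qpar w ^ n)%C with
           (((2 * PI) ^ S nu / INR (fact nu) * INR n ^ nu)%R * qpar w ^ n * bes nu (X * INR n))%C.
          - apply sums_scal, Hb.
          - unfold kcoef. fold X. rewrite !RtoC_mult. ring. }
      intros j. cbv beta. unfold gam.
      rewrite (Cmult_comm _ (qpar w ^ n)), <- Cmult_assoc, <- RtoC_mult.
      rewrite (Cmult_comm (RtoC (INR n ^ _))), Cmult_assoc, (Cmult_comm _ (qpar w ^ n)), <- Cmult_assoc, <- RtoC_mult.
      do 2 f_equal. rewrite pow_add, Ropp_mult_distr_l, (Rpow_mult_distr (- X)). field.
      repeat split; apply INR_fact_neq_0.
    + rewrite (sums_unique _ _ _ S2 T1).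
      apply (sums_unique _ _ _ T2). apply qser_sums; [apply subexp_kcoef, Hmu|exact Hw].
Qed.

(** * Poincare series *)

(** An arbitrary choice of top row suffices: by [pterm_eq] the summand does not depend on it. *)
Definition bezout_row (c d : Z) : Z * Z :=
  epsilon (inhabits (0%Z, 0%Z)) (fun ab => (fst ab * d - snd ab * c = 1)%Z).

Lemma bezout_row_spec (c d : Z) : Z.gcd c d = 1%Z ->
  (fst (bezout_row c d) * d - snd (bezout_row c d) * c = 1)%Z.
Proof.
  intros H. unfold bezout_row. apply epsilon_spec.
  destruct (Z.gcd_bezout c d 1 H) as [u [v Huv]]. exists (v, (- u)%Z). simpl. lia.
Qed.

(* The summand (c z + d)^-k e(m gamma z) with bottom row (c, d) of gamma, and k = nu + 1. *)
Definition pterm (nu m : nat) (c d : Z) (z : C) : C :=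
  if Z.eq_dec (Z.gcd c d) 1 then
    let (a, b) := bezout_row c d in
    (/ (IZR c * z + IZR d) ^ S nu *
       qpar (INR m * ((IZR a * z + IZR b) / (IZR c * z + IZR d))))%C
  else 0%C.

Lemma cz_plus_d_neq_0 (c d : Z) (z : C) : inH z -> (c <> 0 \/ d <> 0)%Z ->
  (IZR c * z + IZR d)%C <> 0%C.
Proof.
  intros Hz H E. destruct (linear_form_lower z Hz) as [e [He Hl]].
  specialize (Hl (IZR c) (IZR d)). rewrite E, Cmod_0 in Hl.
  assert (Hp : forall n, n <> 0%Z -> 0 < Rabs (IZR n)) by (intros n Hn; apply Rabs_pos_lt, not_0_IZR, Hn).
  pose proof (Rabs_pos (IZR c)). pose proof (Rabs_pos (IZR d)).
  destruct H as [H|H]; specialize (Hp _ H); nra.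
Qed.

(** Two top rows for the same (c, d) differ by a multiple l (c, d), which moves gamma z by the
    integer l and leaves e(m gamma z) unchanged. *)
Lemma pterm_eq (nu m : nat) (a b c d : Z) (z : C) : inH z -> (a * d - b * c = 1)%Z ->
  pterm nu m c d z = (/ (IZR c * z + IZR d) ^ S nu *
       qpar (INR m * ((IZR a * z + IZR b) / (IZR c * z + IZR d))))%C.
Proof.
  intros Hz Hdet.
  assert (Hg : Z.gcd c d = 1%Z).
  { apply Z.bezout_1_gcd. exists (- b)%Z, a. lia. }
  unfold pterm. destruct (Z.eq_dec (Z.gcd c d) 1) as [_|]; [|contradiction].
  pose proof (bezout_row_spec c d Hg) as H'.
  destruct (bezout_row c d) as [a' b']. simpl in H'.
  assert (Hcd : (IZR c * z + IZR d)%C <> 0%C).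
  { apply cz_plus_d_neq_0; [exact Hz|]. destruct (Z.eq_dec c 0); [right|left; assumption].
    intros ->. subst. lia. }
  f_equal.
  (* The determinant of the two top rows is the multiple by which they differ. *)
  set (l := (a' * b - b' * a)%Z).
  assert (E1 : (a * d = 1 + b * c)%Z) by lia.
  assert (E2 : (a' * d = 1 + b' * c)%Z) by lia.
  assert (Ha : (a = a' + l * c)%Z).
  { transitivity (a' + (a * (b' * c) - a' * (b * c)) * -1)%Z; [|unfold l; ring].
    replace (b * c)%Z with (a * d - 1)%Z by lia. replace (b' * c)%Z with (a' * d - 1)%Z by lia. ring. }
  assert (Hb : (b = b' + l * d)%Z).
  { transitivity (b' + (b * (a' * d) - b' * (a * d)))%Z; [|unfold l; ring].
    rewrite E1, E2. ring. }
  rewrite <- (qpar_add_IZR (INR m * ((IZR a' * z + IZR b') / (IZR c * z + IZR d)))%C (Z.of_nat m * l)).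
  f_equal. rewrite Ha, Hb, !plus_IZR, !mult_IZR, <- INR_IZR_INZ, !RtoC_plus, !RtoC_mult.
  field. exact Hcd.
Qed.

Lemma pterm_not_coprime (nu m : nat) (c d : Z) (z : C) : Z.gcd c d <> 1%Z -> pterm nu m c d z = 0%C.
Proof. intros H. unfold pterm. destruct (Z.eq_dec (Z.gcd c d) 1); [contradiction|reflexivity]. Qed.

(** Composing gamma with z -> -1/z sends the bottom row (c, d) to (d, -c) and the top row (a, b) to
    (b, -a). *)
Lemma pterm_S (nu m : nat) (c d : Z) (z : C) : inH z ->
  pterm nu m c d (- / z)%C = (z ^ S nu * pterm nu m d (- c) z)%C.
Proof.
  intros Hz. pose proof (inH_opp_Cinv z Hz) as Hz'. pose proof (inH_neq_0 z Hz) as Hz0.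
  destruct (Z.eq_dec (Z.gcd c d) 1) as [Hg|Hg].
  - pose proof (bezout_row_spec c d Hg) as H.
    destruct (bezout_row c d) as [a b]. simpl in H.
    assert (Hcd : (c <> 0 \/ d <> 0)%Z) by (destruct (Z.eq_dec c 0); [right; intros ->; subst; lia|left; assumption]).
    assert (Hdc : (IZR d * z + IZR (- c))%C <> 0%C).
    { apply cz_plus_d_neq_0; [exact Hz|lia]. }
    rewrite (pterm_eq nu m a b) by assumption.
    rewrite (pterm_eq nu m b (- a)%Z d (- c)%Z) by (exact Hz || lia).
    assert (E : (IZR c * - / z + IZR d)%C = ((IZR d * z + IZR (- c)) / z)%C).
    { rewrite opp_IZR, RtoC_opp. field. exact Hz0. }
    rewrite E. unfold Cdiv at 1. rewrite Cpow_mult_l, Cpow_inv by exact Hz0.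
    rewrite Cmult_assoc. f_equal.
    + field. split; apply Cpow_nz; assumption.
    + do 2 f_equal. rewrite !opp_IZR, !RtoC_opp in *. field. split; assumption.
  - rewrite !pterm_not_coprime; [ring| |exact Hg].
    rewrite Z.gcd_opp_r, Z.gcd_comm. exact Hg.
Qed.

Lemma pterm_opp (nu m : nat) (c d : Z) (z : C) : inH z -> (S nu mod 4 = 0)%nat ->
  pterm nu m (- c) (- d) z = pterm nu m c d z.
Proof.
  intros Hz H4.
  destruct (Z.eq_dec (Z.gcd c d) 1) as [Hg|Hg].
  - pose proof (bezout_row_spec c d Hg) as H.
    destruct (bezout_row c d) as [a b]. simpl in H.
    assert (Hcd : (IZR c * z + IZR d)%C <> 0%C).
    { apply cz_plus_d_neq_0; [exact Hz|].
      destruct (Z.eq_dec c 0); [right; intros ->; subst; lia|left; assumption]. }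
    rewrite (pterm_eq nu m a b c d) by assumption.
    rewrite (pterm_eq nu m (- a)%Z (- b)%Z) by (exact Hz || lia).
    rewrite !opp_IZR, !RtoC_opp.
    f_equal.
    + f_equal. rewrite (Nat.div_mod_eq (S nu) 4), H4, Nat.add_0_r, !Cpow_mult_r. f_equal. simpl. ring.
    + do 2 f_equal. field. split; [exact Hcd|].
      intros E. apply Hcd.
      replace (IZR c * z + IZR d)%C with (- (- IZR c * z + - IZR d))%C by ring. rewrite E. ring.
  - rewrite !pterm_not_coprime; [reflexivity|exact Hg|].
    rewrite Z.gcd_opp_l, Z.gcd_opp_r. exact Hg.
Qed.

(** Im gamma z = Im z / |cz + d|^2 is positive, so the exponential has modulus at most 1 and only
    the size of cz + d matters. *)
Lemma pterm_bound (nu m : nat) (z : C) : inH z -> exists D, 0 <= D /\ forall c d,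
  (c <> 0 \/ d <> 0)%Z -> Cmod (pterm nu m c d z) <= D * / (Rabs (IZR c) + Rabs (IZR d)) ^ S nu.
Proof.
  intros Hz. destruct (linear_form_lower z Hz) as [e [He Hl]].
  exists (/ e ^ S nu). split; [positivity|]. intros c d Hcd.
  assert (Hpos : 0 < Rabs (IZR c) + Rabs (IZR d)).
  { pose proof (Rabs_pos (IZR c)). pose proof (Rabs_pos (IZR d)).
    destruct Hcd as [H1|H1]; apply not_0_IZR, Rabs_pos_lt in H1; lra. }
  destruct (Z.eq_dec (Z.gcd c d) 1) as [Hg|Hg].
  2:{ rewrite pterm_not_coprime by exact Hg. rewrite Cmod_0. positivity. }
  pose proof (bezout_row_spec c d Hg) as H.
  destruct (bezout_row c d) as [a b]. simpl in H.
  rewrite (pterm_eq nu m a b) by assumption.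
  pose proof (cz_plus_d_neq_0 c d z Hz Hcd) as Hne.
  rewrite Cmod_mult, Cmod_inv, Cmod_pow by (apply Cpow_nz, Hne).
  assert (Hq : Cmod (qpar (INR m * ((IZR a * z + IZR b) / (IZR c * z + IZR d)))%C) <= 1).
  { rewrite Cmod_qpar, <- exp_0. apply exp_le_compat.
    assert (Him : 0 <= Im (INR m * ((IZR a * z + IZR b) / (IZR c * z + IZR d)))%C).
    { replace (Im (INR m * ((IZR a * z + IZR b) / (IZR c * z + IZR d)))%C)
        with (INR m * Im ((IZR a * z + IZR b) / (IZR c * z + IZR d))%C)
        by (unfold Im, Cmult at 2, RtoC; simpl; ring).
      apply Rmult_le_pos; [apply pos_INR|].
      apply Cmod_gt_0 in Hne. assert (Hn2 : 0 < Cmod (IZR c * z + IZR d)%C ^ 2) by (apply pow_lt, Hne).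
      rewrite Cmod2_alt in Hn2.
      assert (Hdet : IZR a * IZR d - IZR b * IZR c = 1) by (rewrite <- !mult_IZR, <- minus_IZR, H; reflexivity).
      unfold inH in Hz. destruct z as [x y]. unfold Im, Re in *; simpl in *.
      match goal with |- 0 <= ?t => replace t with ((IZR a * IZR d - IZR b * IZR c) * y *
        / ((IZR c * x - 0 * y + IZR d) * ((IZR c * x - 0 * y + IZR d) * 1) +
           (IZR c * y + 0 * x + 0) * ((IZR c * y + 0 * x + 0) * 1))) end.
      - rewrite Hdet, Rmult_1_l. positivity.
      - field. lra. }
    pose proof PI_RGT_0. nra. }
  rewrite <- (Rmult_1_r (_ * / (_ + _) ^ S nu)). apply Rmult_le_compat; [|apply Cmod_ge_0| |exact Hq].
  - apply Cmod_gt_0 in Hne. positivity.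
  - rewrite <- Rinv_mult, <- Rpow_mult_distr. apply Rinv_le_contravar; [apply pow_lt; positivity|].
    apply pow_incr. split; [positivity|apply Hl].
Qed.

(* The contribution to the n-th coefficient of all bottom rows (c, d) with c > 0 fixed; the finite sum is a Kloosterman sum. *)
Definition row_coef (nu m c n : nat) : C :=
  (/ INR c ^ S nu * kcoef nu (INR m / INR c ^ 2) n *
   csum (fun r => if Z.eq_dec (Z.gcd (Z.of_nat c) (Z.of_nat r)) 1 then
      qpar (INR m * (IZR (fst (bezout_row (Z.of_nat c) (Z.of_nat r))) / INR c))
      * qpar (INR n * (INR r / INR c)) else 0) c)%C.

Definition pcoef (nu m n : nat) : C :=
  ((if Nat.eq_dec n m then 1 else 0) + CSeries (fun i => row_coef nu m (S i) n))%C.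

Lemma Cmod_qpar_R (x : C) : Im x = 0 -> Cmod (qpar x) = 1.
Proof. intros H. rewrite Cmod_qpar, H, Rmult_0_r. apply exp_0. Qed.

Lemma Im_RtoC (x : R) : Im (RtoC x) = 0.
Proof. reflexivity. Qed.

(** The Kloosterman sum is bounded trivially by the length c of its range, at the cost of one power
    of c. *)
Lemma row_coef_bound (nu m c n : nat) : (1 <= c)%nat ->
  Cmod (row_coef nu m c n) <= / INR c ^ nu * Rabs (kcoef nu (INR m / INR c ^ 2) n).
Proof.
  intros Hc. assert (Hc0 : 0 < INR c) by (apply lt_0_INR; lia).
  assert (HcC : RtoC (INR c) <> 0%C) by (apply RtoC_neq_0; lra).
  unfold row_coef. rewrite !Cmod_mult, Cmod_inv, Cmod_pow, !Cmod_R by (apply Cpow_nz, HcC).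
  rewrite (Rabs_pos_eq (INR c)) by lra.
  match goal with |- _ * Cmod ?s <= _ => assert (Hs : Cmod s <= INR c) end.
  { eapply Rle_trans; [apply (csum_Cmod_le _ (fun _ => 1))|].
    - intros r _. destruct (Z.eq_dec _ _); [|rewrite Cmod_0; lra].
      rewrite Cmod_mult, !Cmod_qpar_R; [lra| |].
      + rewrite <- RtoC_div, <- RtoC_mult by lra. apply Im_RtoC.
      + rewrite <- RtoC_div, <- RtoC_mult by lra. apply Im_RtoC.
    - rewrite sum_cte, S_INR. lra. }
  replace (/ INR c ^ nu * Rabs (kcoef nu (INR m / INR c ^ 2) n))
    with (/ INR c ^ S nu * Rabs (kcoef nu (INR m / INR c ^ 2) n) * INR c).
  - apply Rmult_le_compat_l; [|exact Hs]. apply Rmult_le_pos; [positivity|apply Rabs_pos].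
  - simpl pow. field. split; [apply pow_nonzero|]; lra.
Qed.

Lemma div_sqr_bounds (m c : nat) : (1 <= c)%nat -> 0 <= INR m / INR c ^ 2 <= INR m.
Proof.
  intros Hc. apply le_INR in Hc. change (INR 1) with 1 in Hc. pose proof (pos_INR m).
  split; [positivity|]. rewrite <- (Rmult_1_r (INR m)) at 2.
  apply Rmult_le_compat_l; [lra|]. rewrite <- Rinv_1. apply Rinv_le_contravar; [lra|].
  replace 1 with (1 ^ 2) by ring. apply pow_incr. lra.
Qed.

(** Put d = r + c l and w = z + r/c. Then cz + d = c (w + l) and gamma z = a/c - 1/(c^2 (w + l)), so
    each residue class r gives a Lipschitz sum with mu = m/c^2. The rows with d >= 0 and with d < 0
    form two series, because series run over the natural numbers. *)
Lemma row_sum (nu m c : nat) (z : C) : (1 <= nu)%nat -> (S nu mod 4 = 0)%nat -> (1 <= c)%nat -> inH z ->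
  exists Up Um, sums (fun d => pterm nu m (Z.of_nat c) (Z.of_nat d) z) Up /\
    sums (fun d => pterm nu m (Z.of_nat c) (- Z.of_nat (S d)) z) Um /\
    sums (fun n => (row_coef nu m c n * qpar z ^ n)%C) (Up + Um)%C.
Proof.
  intros Hnu H4 Hc Hz.
  assert (Hc0 : 0 < INR c) by (apply lt_0_INR; lia).
  assert (HcC : RtoC (INR c) <> 0%C) by (apply RtoC_neq_0; lra).
  set (F := fun d => pterm nu m (Z.of_nat c) d z).
  destruct (pterm_bound nu m z Hz) as [D [HD0 HD]].
  assert (HF : forall (d : Z) (l : nat), INR l <= Rabs (IZR d) ->
     Cmod (F d) <= D * / (INR l + 1) ^ S nu).
  { intros d l Hl. pose proof (pos_INR l). eapply Rle_trans; [apply HD; left; lia|].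
    apply Rmult_le_compat_l; [exact HD0|]. apply Rinv_le_contravar; [positivity|].
    apply pow_incr. rewrite <- INR_IZR_INZ, (Rabs_pos_eq (INR c)) by lra.
    apply le_INR in Hc. simpl in Hc. lra. }
  assert (Hser : ex_series (fun l => D * / (INR l + 1) ^ S nu)).
  { apply ex_series_mult_l, ex_series_inv_pow. lia. }
  assert (Habs : forall (d : Z) (l : nat), (Z.of_nat l <= Z.abs d)%Z -> INR l <= Rabs (IZR d)).
  { intros d l Hdl. rewrite <- abs_IZR, INR_IZR_INZ. apply IZR_le, Hdl. }
  assert (HUp := sums_Rabs (fun d => F (Z.of_nat d)) _ (fun d => HF (Z.of_nat d) d (Habs (Z.of_nat d) d ltac:(lia))) Hser).
  assert (HUm := sums_Rabs (fun d => F (- Z.of_nat (S d))%Z) _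
    (fun d => HF (- Z.of_nat (S d))%Z d (Habs (- Z.of_nat (S d))%Z d ltac:(lia))) Hser).
  set (Up := CSeries (fun d => F (Z.of_nat d))) in *.
  set (Um := CSeries (fun d => F (- Z.of_nat (S d))%Z)) in *.
  exists Up, Um. split; [exact HUp|]. split; [exact HUm|].
  assert (Hcl : forall l, (l <= c * l)%nat) by (intros; nia).
  assert (Hp : forall r, (r < c)%nat -> sums (fun l => F (Z.of_nat (r + c * l)))
      (CSeries (fun l => F (Z.of_nat (r + c * l))))).
  { intros r Hr. apply (sums_Rabs _ _ (fun l => HF (Z.of_nat (r + c * l)) l
        (Habs (Z.of_nat (r + c * l)) l ltac:(specialize (Hcl l); lia))) Hser). }
  assert (Hm : forall r, (r < c)%nat -> sums (fun l => F (- Z.of_nat (S (r + c * l)))%Z)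
      (CSeries (fun l => F (- Z.of_nat (S (r + c * l)))%Z))).
  { intros r Hr. apply (sums_Rabs _ _ (fun l => HF (- Z.of_nat (S (r + c * l)))%Z l
        (Habs (- Z.of_nat (S (r + c * l)))%Z l ltac:(specialize (Hcl l); lia))) Hser). }
  assert (E1 := sums_group _ _ c _ Hc HUp Hp).
  assert (E2 := sums_group _ _ c _ Hc HUm Hm).
  rewrite csum_rev in E2. rewrite <- E1, <- E2, <- csum_plus.
  set (mu := INR m / INR c ^ 2). assert (Hmu : 0 <= mu) by apply (div_sqr_bounds m c Hc).
  apply (sums_ext (fun n => csum (fun r => ((/ INR c ^ S nu * kcoef nu mu n *
     (if Z.eq_dec (Z.gcd (Z.of_nat c) (Z.of_nat r)) 1 then
      qpar (INR m * (IZR (fst (bezout_row (Z.of_nat c) (Z.of_nat r))) / INR c))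
      * qpar (INR n * (INR r / INR c)) else 0)) * qpar z ^ n)%C) c)).
  { intros n. unfold row_coef. fold mu. rewrite <- csum_scal.
    rewrite (Cmult_comm (csum _ _)), <- csum_scal. apply csum_ext. intros; ring. }
  apply sums_csum. intros r Hr.
  (* The negative d in the class of r are -(c - 1 - r + c l) - 1 = r + c (-l - 1), hence the
     reversed index. *)
  assert (Hsum := sums_plus _ _ _ _ (Hp r Hr) (Hm (c - 1 - r)%nat ltac:(lia))).
  destruct (Z.eq_dec (Z.gcd (Z.of_nat c) (Z.of_nat r)) 1) as [Hg|Hg].
  - pose proof (bezout_row_spec _ _ Hg) as Hdet.
    destruct (bezout_row (Z.of_nat c) (Z.of_nat r)) as [a b]. simpl fst in *. simpl snd in *.
    set (w := (z + (INR r / INR c)%R)%C).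
    assert (Hw : inH w) by (apply inH_add_R, Hz).
    assert (Hterm : forall l : Z, F (Z.of_nat r + Z.of_nat c * l)%Z =
       (/ INR c ^ S nu * qpar (INR m * (IZR a / INR c)) *
          (/ (w + IZR l) ^ S nu * qpar (- (mu / (w + IZR l)))))%C).
    { intros l. unfold F.
      rewrite (pterm_eq nu m a (b + a * l)%Z) by (exact Hz || lia).
      assert (Hwl : (w + IZR l)%C <> 0%C) by (apply inH_neq_0, inH_add_R, Hw).
      assert (Hdet' : (IZR a * INR r)%C = (1 + IZR b * INR c)%C).
      { rewrite !INR_IZR_INZ, <- !RtoC_mult, <- RtoC_plus. f_equal.
        rewrite <- !mult_IZR, <- plus_IZR. f_equal. lia. }
      assert (Hden : (IZR (Z.of_nat c) * z + IZR (Z.of_nat r + Z.of_nat c * l))%C = (INR c * (w + IZR l))%C).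
      { unfold w. rewrite plus_IZR, mult_IZR, <- !INR_IZR_INZ, RtoC_plus, RtoC_mult, RtoC_div by lra.
        field. exact HcC. }
      rewrite Hden, Cpow_mult_l.
      replace (INR m * ((IZR a * z + IZR (b + a * l)) / (INR c * (w + IZR l))))%C
        with (INR m * (IZR a / INR c) + - (mu / (w + IZR l)))%C.
      - rewrite qpar_plus. field. split; apply Cpow_nz; assumption.
      - unfold mu. rewrite plus_IZR, mult_IZR, RtoC_plus, RtoC_mult, RtoC_div, RtoC_pow
          by (apply pow_nonzero; lra).
        assert (HE : (INR c * (IZR a * z + (IZR b + IZR a * IZR l)))%C = (INR c * IZR a * (w + IZR l) - 1)%C).
        { unfold w. rewrite RtoC_div by lra.
          replace (INR c * IZR a * (z + INR r / INR c + IZR l) - 1)%C with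
            (INR c * IZR a * (z + IZR l) + IZR a * INR r - 1)%C by (field; exact HcC).
          rewrite Hdet'. ring. }
        replace (IZR a * z + (IZR b + IZR a * IZR l))%C with ((INR c * IZR a * (w + IZR l) - 1) / INR c)%C
          by (rewrite <- HE; field; exact HcC).
        field. split; assumption. }
    set (al := (/ INR c ^ S nu * qpar (INR m * (IZR a / INR c)))%C).
    assert (Hval := sums_scal al _ _ (bessel_lipschitz nu mu w Hnu H4 Hmu Hw)).
    assert (Eval : (CSeries (fun l => F (Z.of_nat (r + c * l))) +
      CSeries (fun l => F (- Z.of_nat (S (c - 1 - r + c * l)))%Z))%C = (al * qser (fun n => RtoC (kcoef nu mu n)) w)%C).
    { apply (sums_unique _ _ _ Hsum). refine (sums_ext _ _ _ _ Hval). intros l. cbv beta.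
      replace (Z.of_nat (r + c * l)) with (Z.of_nat r + Z.of_nat c * Z.of_nat l)%Z by lia.
      replace (- Z.of_nat (S (c - 1 - r + c * l)))%Z with (Z.of_nat r + Z.of_nat c * (- Z.of_nat l - 1))%Z by nia.
      rewrite !Hterm. fold al.
      rewrite minus_IZR, opp_IZR, RtoC_minus, RtoC_opp, <- INR_IZR_INZ.
      replace (w + (- INR l - 1))%C with (w - INR l - 1)%C by ring. ring. }
    rewrite Eval.
    refine (sums_ext _ _ _ _ (sums_scal al _ _ (qser_sums _ w (subexp_kcoef nu mu Hmu) Hw))).
    intros n. cbv beta. unfold w, al. rewrite qpar_plus, Cpow_mult_l, (qpar_pow (INR r / INR c)%R).
    rewrite RtoC_div by lra. ring.
  - refine (sums_ext _ _ _ _ Hsum). intros l. cbv beta. unfold F.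
    rewrite !pterm_not_coprime; [ring| |].
    + replace (- Z.of_nat (S (c - 1 - r + c * l)))%Z with (Z.of_nat r + (- Z.of_nat l - 1) * Z.of_nat c)%Z by nia.
      rewrite Z.gcd_add_mult_diag_r. exact Hg.
    + replace (Z.of_nat (r + c * l)) with (Z.of_nat r + Z.of_nat l * Z.of_nat c)%Z by lia.
      rewrite Z.gcd_add_mult_diag_r. exact Hg.
Qed.

(** One bottom row out of each pair of opposite ones with both entries nonzero, the two signs of d
    taken together. In this arrangement z -> -1/z only exchanges i and j. *)
Definition pair_term (nu m i j : nat) (z : C) : C :=
  (pterm nu m (Z.of_nat (S i)) (Z.of_nat (S j)) z + pterm nu m (Z.of_nat (S i)) (- Z.of_nat (S j)) z)%C.

Lemma pair_term_S (nu m i j : nat) (z : C) : inH z -> (S nu mod 4 = 0)%nat ->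
  pair_term nu m i j (- / z)%C = (z ^ S nu * pair_term nu m j i z)%C.
Proof.
  intros Hz H4. unfold pair_term. rewrite !pterm_S by exact Hz.
  rewrite (pterm_opp nu m (Z.of_nat (S j)) (Z.of_nat (S i)) z Hz H4). ring.
Qed.

(** With k = 2h, (c + d)^2 >= c d gives (c + d)^(-k) <= c^(-h) d^(-h), the product majorant that
    [sums_swap] asks for; it is summable as h >= 2. *)
Lemma pair_term_bound (nu m : nat) (z : C) : (3 <= nu)%nat -> (S nu mod 4 = 0)%nat -> inH z ->
  exists p : nat -> R, (forall i, 0 <= p i) /\ ex_series p /\
    forall i j, Cmod (pair_term nu m i j z) <= p i * p j.
Proof.
  intros Hnu H4 Hz. set (h := (S nu / 2)%nat).
  assert (Hh : (S nu = 2 * h)%nat).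
  { unfold h. pose proof (Nat.div_mod_eq (S nu) 4). pose proof (Nat.div_mod_eq (S nu) 2).
    pose proof (Nat.mod_upper_bound (S nu) 2). lia. }
  destruct (pterm_bound nu m z Hz) as [D [HD0 HD]].
  set (D' := 2 * D + 1).
  exists (fun i => D' * / (INR i + 1) ^ h).
  assert (HD' : 1 <= D') by (unfold D'; lra).
  split; [|split].
  - intros i. pose proof (pos_INR i). positivity.
  - apply ex_series_mult_l, ex_series_inv_pow. lia.
  - intros i j. pose proof (pos_INR i) as Hi. pose proof (pos_INR j) as Hj.
    unfold pair_term. eapply Rle_trans; [apply Cmod_triangle|].
    pose proof (HD (Z.of_nat (S i)) (Z.of_nat (S j)) ltac:(lia)) as B1.
    pose proof (HD (Z.of_nat (S i)) (- Z.of_nat (S j))%Z ltac:(lia)) as B2.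
    rewrite opp_IZR, Rabs_Ropp in B2. rewrite <- !INR_IZR_INZ, !S_INR, !Rabs_pos_eq in B1, B2 by lra.
    assert (B3 : / (INR i + 1 + (INR j + 1)) ^ S nu <= / (INR i + 1) ^ h * / (INR j + 1) ^ h).
    { rewrite <- Rinv_mult, <- Rpow_mult_distr, Hh, pow_mult.
      apply Rinv_le_contravar; [apply pow_lt; nra|]. apply pow_incr. nra. }
    assert (B4 : D * / (INR i + 1 + (INR j + 1)) ^ S nu <= D * (/ (INR i + 1) ^ h * / (INR j + 1) ^ h))
      by (apply Rmult_le_compat_l; assumption).
    set (X := / (INR i + 1) ^ h * / (INR j + 1) ^ h) in *.
    assert (HX : 0 <= X) by (unfold X; positivity).
    replace (D' * / (INR i + 1) ^ h * (D' * / (INR j + 1) ^ h)) with (D' * D' * X) by (unfold X; ring).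
    unfold D' in *. nra.
Qed.

Lemma pair_term_sums (nu m : nat) (z : C) : (3 <= nu)%nat -> (S nu mod 4 = 0)%nat -> inH z ->
  let row i := CSeries (fun j => pair_term nu m i j z) in
  let col j := CSeries (fun i => pair_term nu m i j z) in
  (forall i, sums (fun j => pair_term nu m i j z) (row i)) /\
  (forall j, sums (fun i => pair_term nu m i j z) (col j)) /\
  sums row (CSeries row) /\ sums col (CSeries row).
Proof.
  intros Hnu H4 Hz row col.
  destruct (pair_term_bound nu m z Hnu H4 Hz) as [p [Hp0 [Hp HA]]].
  assert (Hrow : forall i, sums (fun j => pair_term nu m i j z) (row i)).
  { intros i. apply (sums_Rabs _ _ (HA i)), (ex_series_mult_l (p i) p Hp). }
  assert (Hcol : forall j, sums (fun i => pair_term nu m i j z) (col j)).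
  { intros j. apply (sums_Rabs _ (fun i => p i * p j)); [intros; apply HA|]. apply ex_series_scal_r, Hp. }
  split; [exact Hrow|]. split; [exact Hcol|].
  exact (sums_swap _ p p _ _ HA Hp0 Hp Hp Hrow Hcol).
Qed.

Lemma row_coef_uniform (nu m : nat) (eps : R) : 0 < eps ->
  exists K, 0 <= K /\ forall i n, Cmod (row_coef nu m (S i) n) <= / (INR i + 1) ^ nu * (K * exp (eps * INR n)).
Proof.
  intros He. destruct (kcoef_bound nu (INR m) eps (pos_INR m) He) as [K [HK0 HK]].
  exists K. split; [exact HK0|]. intros i n. pose proof (pos_INR i).
  eapply Rle_trans; [apply row_coef_bound; lia|]. rewrite S_INR.
  apply Rmult_le_compat_l; [positivity|]. rewrite <- S_INR. apply HK, div_sqr_bounds. lia.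
Qed.

Lemma pcoef_sums (nu m n : nat) : (2 <= nu)%nat ->
  sums (fun i => row_coef nu m (S i) n) (CSeries (fun i => row_coef nu m (S i) n)).
Proof.
  intros Hnu. destruct (row_coef_uniform nu m 1 ltac:(lra)) as [K [HK0 HK]].
  apply (sums_Rabs _ _ (fun i => HK i n)).
  apply ex_series_scal_r. apply ex_series_inv_pow. exact Hnu.
Qed.

Lemma subexp_pcoef (nu m : nat) : (2 <= nu)%nat -> subexp (pcoef nu m).
Proof.
  intros Hnu eps He. destruct (row_coef_uniform nu m eps He) as [K [HK0 HK]].
  set (Z0 := Series (fun i => / (INR i + 1) ^ nu)).
  exists (1 + Z0 * K). intros n. pose proof (pos_INR n). unfold pcoef.
  eapply Rle_trans; [apply Cmod_triangle|].
  assert (H1 : Cmod (if Nat.eq_dec n m then 1 else 0)%C <= exp (eps * INR n)).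
  { destruct (Nat.eq_dec n m); [rewrite Cmod_1|rewrite Cmod_0; left; apply exp_pos].
    rewrite <- exp_0. apply exp_le_compat. positivity. }
  assert (H2 := sums_bound _ _ _ (pcoef_sums nu m n Hnu) (fun i => HK i n)
     ltac:(apply ex_series_scal_r, ex_series_inv_pow, Hnu)).
  rewrite Series_scal_r in H2. fold Z0 in H2. lra.
Qed.

(** The row (0, 1) gives the extra 1 at n = m. The rows with c >= 1 are summed by [row_sum], and
    among their entries d = 0 only (1, 0) is coprime. *)
Lemma qser_pcoef (nu m : nat) (z : C) : (3 <= nu)%nat -> (S nu mod 4 = 0)%nat -> inH z ->
  qser (pcoef nu m) z = (pterm nu m 0 1 z + pterm nu m 1 0 z +
    CSeries (fun i => CSeries (fun j => pair_term nu m i j z)))%C.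
Proof.
  intros Hnu H4 Hz.
  destruct (pair_term_sums nu m z Hnu H4 Hz) as [Hrow [_ [HS _]]].
  set (T := CSeries (fun i => CSeries (fun j => pair_term nu m i j z))) in *.
  assert (Hrs : forall i, sums (fun n => (row_coef nu m (S i) n * qpar z ^ n)%C)
     (pterm nu m (Z.of_nat (S i)) 0 z + CSeries (fun j => pair_term nu m i j z))%C).
  { intros i. destruct (row_sum nu m (S i) z ltac:(lia) H4 ltac:(lia) Hz) as [Up [Um [H1 [H2 H3]]]].
    apply sums_incr_1 in H1.
    assert (E := sums_unique _ _ _ (sums_plus _ _ _ _ H1 H2) (Hrow i)).
    replace (pterm nu m (Z.of_nat (S i)) 0 z + CSeries (fun j => pair_term nu m i j z))%C with (Up + Um)%C; [exact H3|].
    rewrite <- E. simpl (Z.of_nat 0). ring. }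
  assert (Hfirst : sums (fun i => pterm nu m (Z.of_nat (S i)) 0 z) (pterm nu m 1 0 z)).
  { replace (pterm nu m 1 0 z) with (csum (fun i => pterm nu m (Z.of_nat (S i)) 0 z) 1)
      by (cbn [csum]; simpl Z.of_nat; ring).
    apply sums_finite. intros i Hi. apply pterm_not_coprime. rewrite Z.gcd_0_r. lia. }
  pose proof PI_RGT_0 as HPI. unfold inH in Hz. set (y := Im z) in *.
  assert (Hpy : 0 < PI * y) by positivity.
  destruct (row_coef_uniform nu m (PI * y) Hpy) as [K [HK0 HK]].
  assert (Hex : ex_series (fun i => / (INR i + 1) ^ nu)) by (apply ex_series_inv_pow; lia).
  destruct (sums_swap (fun i n => (row_coef nu m (S i) n * qpar z ^ n)%C)
     (fun i => / (INR i + 1) ^ nu) (fun n => K * exp (- (PI * y) * INR n))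
     (fun i => (pterm nu m (Z.of_nat (S i)) 0 z + CSeries (fun j => pair_term nu m i j z))%C)
     (fun n => (CSeries (fun i => row_coef nu m (S i) n) * qpar z ^ n)%C)) as [T1 T2].
  - intros i n. rewrite Cmod_qterm. fold y.
    replace (/ (INR i + 1) ^ nu * (K * exp (- (PI * y) * INR n))) with
      (/ (INR i + 1) ^ nu * (K * exp (PI * y * INR n)) * exp (- (2 * PI * y) * INR n)).
    + apply Rmult_le_compat_r; [positivity|apply HK].
    + rewrite Rmult_assoc, (Rmult_assoc K), <- exp_plus. do 3 f_equal. ring.
  - intros i. pose proof (pos_INR i). positivity.
  - exact Hex.
  - apply ex_series_exp_neg, Hpy.
  - exact Hrs.
  - intros n. cbv beta. rewrite (Cmult_comm (CSeries _)).
    refine (sums_ext _ _ _ _ (sums_scal (qpar z ^ n)%C _ _ (pcoef_sums nu m n ltac:(lia)))).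
    intros i. cbv beta. ring.
  - assert (Etot := sums_unique _ _ _ T1 (sums_plus _ _ _ _ Hfirst HS)).
    rewrite Etot in T2.
    assert (Hdelta : sums (fun n => ((if Nat.eq_dec n m then 1 else 0) * qpar z ^ n)%C) (pterm nu m 0 1 z)).
    { replace (pterm nu m 0 1 z) with
        (csum (fun n => ((if Nat.eq_dec n m then 1 else 0) * qpar z ^ n)%C) (S m)).
      - apply sums_finite. intros n Hn. destruct (Nat.eq_dec n m); [lia|ring].
      - cbn [csum]. rewrite csum_zero.
        + destruct (Nat.eq_dec m m); [|lia].
          rewrite (pterm_eq nu m 1 0) by (exact Hz || reflexivity). rewrite qpar_pow.
          assert (H10 : RtoC 1 <> 0%C) by (apply RtoC_neq_0; lra).
          replace (0 * z + 1)%C with (RtoC 1) by ring.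
          replace ((1 * z + 0) / 1)%C with z by (field; exact H10).
          rewrite Cpow_1_l. replace (/ 1)%C with (RtoC 1) by (field; exact H10). ring.
        + intros i Hi. destruct (Nat.eq_dec i m); [lia|ring]. }
    rewrite <- Cplus_assoc.
    apply (sums_unique (fun n => (pcoef nu m n * qpar z ^ n)%C)).
    + apply qser_sums; [apply subexp_pcoef; lia|exact Hz].
    + refine (sums_ext _ _ _ _ (sums_plus _ _ _ _ Hdelta T2)).
      intros n. cbv beta. unfold pcoef. ring.
Qed.

(** The rows (0, 1) and (1, 0) change places up to sign, and the double series over pairs is
    transposed, which absolute convergence allows. *)
Lemma qser_pcoef_S (nu m : nat) (z : C) : (3 <= nu)%nat -> (S nu mod 4 = 0)%nat -> inH z ->
  qser (pcoef nu m) (- / z)%C = (z ^ S nu * qser (pcoef nu m) z)%C.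
Proof.
  intros Hnu H4 Hz. rewrite !qser_pcoef by (assumption || apply inH_opp_Cinv, Hz).
  rewrite !pterm_S by exact Hz.
  replace (pterm nu m 1 (- 0) z) with (pterm nu m 1 0 z) by reflexivity.
  replace (pterm nu m 0 (- (1)) z) with (pterm nu m 0 1 z) by (symmetry; exact (pterm_opp nu m 0 1 z Hz H4)).
  destruct (pair_term_sums nu m z Hnu H4 Hz) as [_ [Hcol [_ HS]]].
  apply sums_scal with (c := (z ^ S nu)%C) in HS.
  replace (CSeries (fun i => CSeries (fun j => pair_term nu m i j (- / z)%C)))
    with (z ^ S nu * CSeries (fun i => CSeries (fun j => pair_term nu m i j z)))%C; [ring|].
  symmetry. apply sums_CSeries. refine (sums_ext _ _ _ _ HS). intros i. cbv beta.
  symmetry. apply sums_CSeries. refine (sums_ext _ _ _ _ (sums_scal (z ^ S nu)%C _ _ (Hcol i))).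
  intros j. cbv beta. symmetry. apply pair_term_S; assumption.
Qed.

Lemma inH_opp_Cconj (z : C) : inH z -> inH (- Cconj z)%C.
Proof. unfold inH, Im. simpl. lra. Qed.

Lemma qser_Cconj (b : nat -> C) (z : C) : subexp b -> inH z ->
  qser (fun n => Cconj (b n)) z = Cconj (qser b (- Cconj z)%C).
Proof.
  intros Hb Hz. unfold qser at 1. apply sums_CSeries.
  refine (sums_ext _ _ _ _ (sums_Cconj _ _ (qser_sums b _ Hb (inH_opp_Cconj z Hz)))).
  intros n. cbv beta. rewrite Cmult_conj, Cpow_conj, Cconj_qpar. do 3 f_equal.
  apply C_ext; unfold Cconj, Copp, Re, Im; simpl; ring.
Qed.

(* For even k, conjugation f(z) -> conj(f(-conj z)) preserves modularity, so real parts of coefficients are again coefficients of a modular form. *)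
Lemma qser_Re_S (k : nat) (b : nat -> C) : (k mod 4 = 0)%nat -> subexp b ->
  (forall z, inH z -> qser b (- / z)%C = (z ^ k * qser b z)%C) ->
  forall z, inH z -> qser (fun n => RtoC (Re (b n))) (- / z)%C =
    (z ^ k * qser (fun n => RtoC (Re (b n))) z)%C.
Proof.
  intros H4 Hb HS.
  assert (Hhalf : RtoC 2 <> 0%C) by (apply RtoC_neq_0; lra).
  assert (E : forall z, inH z -> qser (fun n => RtoC (Re (b n))) z =
     (/ 2 * (qser b z + Cconj (qser b (- Cconj z))))%C).
  { intros z Hz. rewrite <- qser_Cconj by assumption.
    unfold qser at 1. apply sums_CSeries.
    assert (Hc : subexp (fun n => Cconj (b n))) by (apply (subexp_le _ b Hb); intros; rewrite Cmod_conj; lra).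
    refine (sums_ext _ _ _ _ (sums_scal (/ 2)%C _ _ (sums_plus _ _ _ _ (qser_sums b z Hb Hz) (qser_sums _ z Hc Hz)))).
    intros n. cbv beta.
    replace (RtoC (Re (b n))) with (/ 2 * (b n + Cconj (b n)))%C.
    - ring.
    - rewrite <- RtoC_inv by lra. apply C_ext; unfold Cconj, Re, Im; simpl; field. }
  intros z Hz. pose proof (inH_opp_Cinv z Hz) as Hz'. pose proof (inH_neq_0 z Hz) as Hz0.
  rewrite !E by assumption. rewrite HS by exact Hz.
  replace (- Cconj (- / z))%C with (- / (- Cconj z))%C.
  - rewrite HS by (apply inH_opp_Cconj, Hz). rewrite Cmult_conj, Cpow_conj.
    replace (Cconj (- Cconj z))%C with (- z)%C by (apply C_ext; unfold Cconj, Copp, Re, Im; simpl; ring).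
    replace ((- z) ^ k)%C with (z ^ k)%C; [ring|].
    rewrite (Nat.div_mod_eq k 4), H4, Nat.add_0_r, !Cpow_mult_r. f_equal. simpl. ring.
  - rewrite Copp_conj, Cinv_conj by exact Hz0. field.
    intros E0. apply Hz0. apply Cmod_eq_0. rewrite <- Cmod_conj, E0. apply Cmod_0.
Qed.

Lemma row_coef_1 (nu m n : nat) : row_coef nu m 1 n = RtoC (kcoef nu (INR m) n).
Proof.
  unfold row_coef. cbn [csum]. simpl (Z.gcd _ _). destruct (Z.eq_dec 1 1) as [_|]; [|lia].
  change (INR 1) with 1. change (INR 0) with 0.
  replace (INR m / 1 ^ 2) with (INR m) by field.
  replace (INR m * (IZR (fst (bezout_row (Z.of_nat 1) (Z.of_nat 0))) / 1))%C with
    (RtoC (IZR (Z.of_nat m * fst (bezout_row (Z.of_nat 1) (Z.of_nat 0))))).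
  2:{ rewrite mult_IZR, <- INR_IZR_INZ, RtoC_mult. field. }
  rewrite qpar_IZR. replace (INR n * (0 / 1))%C with (RtoC 0) by field.
  rewrite qpar_0, Cpow_1_l. field.
Qed.

Lemma pcoef_0 (nu m : nat) : (1 <= nu)%nat -> pcoef nu m 0 = (if Nat.eq_dec 0 m then 1%C else 0%C).
Proof.
  intros Hnu. unfold pcoef.
  replace (CSeries (fun i => row_coef nu m (S i) 0)) with (RtoC 0); [ring|].
  symmetry. apply sums_CSeries. apply (sums_finite _ 0). intros i _.
  unfold row_coef, kcoef. simpl (INR 0). rewrite pow_i by lia.
  rewrite Rmult_0_r, Rmult_0_l. ring.
Qed.

(** The contribution of c = 1 to the n-th coefficient of the Eisenstein series, and the yardstick
    for the other terms. *)
Definition eisenstein_weight (nu n : nat) : R := (2 * PI) ^ S nu / INR (fact nu) * INR n ^ nu.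

(** Compared with c = 1 the rows c >= 2 lose a factor c^(-nu), and the sum of (2/c)^nu over c >= 2
    is at most that of 4/(c (c - 1)), which telescopes to 4. *)
Lemma pcoef_estimate (nu m n : nat) : (2 <= nu)%nat ->
  (forall c, (2 <= c)%nat -> Rabs (bes nu (4 * PI ^ 2 * (INR m / INR c ^ 2) * INR n)) <= 1) ->
  Rabs (Re (pcoef nu m n) - ((if Nat.eq_dec n m then 1 else 0) + kcoef nu (INR m) n))
    <= eisenstein_weight nu n * (4 * / 2 ^ nu).
Proof.
  intros Hnu Hbes. pose proof PI_RGT_0 as HPI. pose proof (pos_INR n) as Hn.
  pose proof (INR_fact_lt_0 nu) as Hf.
  assert (HW : 0 <= eisenstein_weight nu n) by (unfold eisenstein_weight; positivity).
  assert (H1 := sums_incr_1 _ _ (pcoef_sums nu m n Hnu)). cbv beta in H1. rewrite row_coef_1 in H1.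
  set (S0 := CSeries (fun i => row_coef nu m (S i) n)) in *.
  assert (Hb : forall i, Cmod (row_coef nu m (S (S i)) n) <=
     eisenstein_weight nu n * (4 * / 2 ^ nu) * (/ (INR i + 1) - / (INR i + 2))).
  { intros i. pose proof (pos_INR i) as Hi.
    eapply Rle_trans; [apply row_coef_bound; lia|].
    unfold kcoef. fold (eisenstein_weight nu n). rewrite Rabs_mult, (Rabs_pos_eq (eisenstein_weight nu n)) by exact HW.
    apply Rle_trans with (/ INR (S (S i)) ^ nu * (eisenstein_weight nu n * 1)).
    - apply Rmult_le_compat_l; [positivity; apply lt_0_INR; lia|].
      apply Rmult_le_compat_l; [exact HW|]. apply Hbes. lia.
    - rewrite Rmult_1_r, Rmult_comm, Rmult_assoc. apply Rmult_le_compat_l; [exact HW|].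
      replace (INR (S (S i))) with (2 * ((INR i + 2) / 2)) by (rewrite !S_INR; field).
      rewrite Rpow_mult_distr, Rinv_mult, (Rmult_comm 4), Rmult_assoc.
      apply Rmult_le_compat_l; [positivity|].
      replace (4 * (/ (INR i + 1) - / (INR i + 2))) with (/ ((INR i + 1) * (INR i + 2) / 4)) by (field; lra).
      apply Rinv_le_contravar; [positivity|].
      apply Rle_trans with (((INR i + 2) / 2) ^ 2); [simpl; nra|].
      apply Rle_pow; [lra|exact Hnu]. }
  assert (H2 := sums_bound _ _ _ H1 Hb).
  rewrite Series_scal_l, (is_series_unique _ _ is_series_telescoping), Rmult_1_r in H2.
  eapply Rle_trans; [|apply H2].
  - eapply Rle_trans; [|apply re_le_Cmod]. right. f_equal. unfold pcoef. fold S0.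
    destruct (Nat.eq_dec n m); unfold Re; simpl; ring.
  - apply ex_series_mult_l. eexists. apply is_series_telescoping.
Qed.

(** * Positivity of Bessel functions *)

Lemma bes_PSeries (nu : nat) (t : R) :
  bes nu t = PSeries (fun j => (- 1) ^ j * (INR (fact nu) / (INR (fact j) * INR (fact (nu + j))))) t.
Proof.
  unfold bes, PSeries. apply Series_ext. intros j.
  replace (- t) with (-1 * t) by ring. rewrite Rpow_mult_distr. ring.
Qed.

Lemma CV_radius_infinite_of_ex_series (a : nat -> R) :
  (forall x, ex_series (fun j => a j * x ^ j)) -> CV_radius a = p_infty.
Proof.
  intros H. destruct (CV_radius a) as [r| |] eqn:E; [|reflexivity|].
  - exfalso. apply (CV_disk_outside a (Rabs r + 1)).
    + rewrite E. simpl. pose proof (Rle_abs r). pose proof (Rle_abs (Rabs r + 1)). lra.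
    + apply ex_series_lim_0, H.
  - exfalso. apply (CV_disk_outside a 1).
    + rewrite E. exact I.
    + apply ex_series_lim_0, H.
Qed.

Lemma is_derive_bes (nu : nat) (t : R) :
  is_derive (bes nu) t (- (bes (S nu) t / (INR nu + 1))).
Proof.
  pose proof (pos_INR nu) as Hnu.
  refine (is_derive_ext _ _ _ _ (fun s => eq_sym (bes_PSeries nu s)) _).
  replace (- (bes (S nu) t / (INR nu + 1))) with
    (PSeries (PS_derive (fun j => (- 1) ^ j * (INR (fact nu) / (INR (fact j) * INR (fact (nu + j)))))) t).
  - apply is_derive_PSeries. rewrite CV_radius_infinite_of_ex_series; [exact I|].
    intros x. refine (ex_series_ext _ _ _ (ex_series_bes nu x)).
    intros j. replace (- x) with (-1 * x) by ring. rewrite Rpow_mult_distr. match goal with |- ?a = ?b => change (@eq R a b) end. ring.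
  - unfold Rdiv. rewrite Ropp_mult_distr_r, bes_PSeries. unfold PSeries.
    rewrite <- Series_scal_r. apply Series_ext. intros j. unfold PS_derive.
    rewrite Nat.add_succ_r. change (S nu + j)%nat with (S (nu + j)).
    rewrite !fact_simpl, !mult_INR, !S_INR, plus_INR.
    pose proof (INR_fact_lt_0 j). pose proof (INR_fact_lt_0 (nu + j)). pose proof (pos_INR j).
    simpl pow. field. repeat split; lra.
Qed.

Lemma bes_recurrence (nu : nat) (t : R) :
  bes nu t = bes (S nu) t - t * bes (S (S nu)) t / ((INR nu + 1) * (INR nu + 2)).
Proof.
  pose proof (pos_INR nu) as Hnu.
  assert (H0 := Series_correct _ (ex_series_bes nu t)).
  assert (H1 := Series_correct _ (ex_series_bes (S nu) t)).
  assert (H2 := Series_correct _ (ex_series_bes (S (S nu)) t)).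
  fold (bes nu t) in H0. fold (bes (S nu) t) in H1. fold (bes (S (S nu)) t) in H2.
  apply sums_RtoC in H0, H1, H2.
  apply sums_incr_1 in H0, H1. simpl (_ ^ 0) in H0, H1.
  rewrite Nat.add_0_r in H0, H1.
  assert (H3 := sums_plus _ _ _ _ H1 (sums_scal (RtoC (- t / ((INR nu + 1) * (INR nu + 2)))) _ _ H2)).
  match type of H0 with sums _ ?x => match type of H3 with sums _ ?y => assert (E : x = y) end end.
  { apply (sums_unique _ _ _ H0). refine (sums_ext _ _ _ _ H3). intros j.
  cbv beta. rewrite <- RtoC_mult, <- RtoC_plus. f_equal.
  rewrite !Nat.add_succ_r. change (S nu + j)%nat with (S (nu + j)). change (S (S nu) + j)%nat with (S (S (nu + j))).
  rewrite !fact_simpl, !mult_INR, !S_INR, plus_INR.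
  pose proof (INR_fact_lt_0 j). pose proof (INR_fact_lt_0 (nu + j)). pose proof (INR_fact_lt_0 nu). pose proof (pos_INR j).
  simpl pow. field. repeat split; lra. }
  apply RtoC_inj.
  replace (RtoC (bes nu t)) with (bes nu t - (1 * (INR (fact nu) / (INR (fact 0) * INR (fact nu))))%R + 1)%C.
  2:{ replace (1 * (INR (fact nu) / (INR (fact 0) * INR (fact nu)))) with 1; [ring|].
      simpl (fact 0). simpl (INR 1). field. apply INR_fact_neq_0. }
  rewrite E.
  replace (1 * (INR (fact (S nu)) / (INR (fact 0) * INR (fact (S nu))))) with 1.
  2:{ simpl (fact 0). simpl (INR 1). field. apply INR_fact_neq_0. }
  rewrite <- RtoC_minus, <- RtoC_mult, <- RtoC_plus, <- RtoC_plus. f_equal. field. lra.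
Qed.

(** With u = [bes nu] and v = [bes (S nu)] / (nu + 1) this is (t^(nu+1) v)' = t^nu u, while
    [is_derive_bes] is u' = -v. This first-order system is the form of Bessel's equation used by the
    barrier. *)
Lemma is_derive_pow_bes (nu : nat) (t : R) :
  is_derive (fun t => t ^ S nu * (bes (S nu) t / (INR nu + 1))) t (t ^ nu * bes nu t).
Proof.
  pose proof (pos_INR nu) as Hnu.
  pose proof (is_derive_bes (S nu) t) as H.
  auto_derive.
  - eexists. exact H.
  - replace (Derive (fun x => bes (S nu) x) t) with (- (bes (S (S nu)) t / (INR (S nu) + 1)))
      by (symmetry; apply is_derive_unique; exact H).
    rewrite (bes_recurrence nu t).
    change (match nu with O => 1 | S _ => INR nu + 1 end) with (INR (S nu)).
    rewrite !S_INR. field. lra.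
Qed.

Lemma bes_0 (nu : nat) : bes nu 0 = 1.
Proof.
  unfold bes. apply is_series_unique.
  assert (H : sums (fun j => RtoC ((- 0) ^ j * (INR (fact nu) / (INR (fact j) * INR (fact (nu + j)))))) (RtoC 1)).
  { replace (RtoC 1) with (csum (fun j => RtoC ((- 0) ^ j * (INR (fact nu) / (INR (fact j) * INR (fact (nu + j)))))) 1).
    - apply sums_finite. intros j Hj. rewrite Ropp_0, pow_i by lia. f_equal. ring.
    - cbn [csum]. rewrite Nat.add_0_r. simpl (fact 0). simpl (INR 1). simpl pow.
      replace (1 * (INR (fact nu) / (1 * INR (fact nu)))) with 1; [ring|].
      field. apply INR_fact_neq_0. }
  apply sums_Re_Im in H. apply H.
Qed.

Lemma derive_nonneg_incr (f df : R -> R) (a b : R) : a <= b ->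
  (forall t, a <= t <= b -> is_derive f t (df t)) -> (forall t, a <= t <= b -> 0 <= df t) -> f a <= f b.
Proof.
  intros Hab Hd Hp.
  destruct (MVT_gen f a b df) as [c [Hc E]].
  - intros x Hx. rewrite Rmin_left, Rmax_right in Hx by lra. apply Hd. lra.
  - intros x Hx. rewrite Rmin_left, Rmax_right in Hx by lra.
    apply derivable_continuous_pt. exists (df x). apply is_derive_Reals, Hd, Hx.
  - rewrite Rmin_left, Rmax_right in Hc by lra. specialize (Hp c Hc). nra.
Qed.

(** Let sg be the supremum of the times up to which u >= 0. The step upgrades u >= 0 on [t0, sg] to
    u >= g > 0 at sg, so continuity extends it beyond sg unless sg = t1. *)
Lemma real_induction (u g : R -> R) (t0 t1 : R) : t0 <= t1 ->
  (forall t, t0 <= t <= t1 -> continuity_pt u t) -> (forall t, t0 <= t <= t1 -> 0 < g t) ->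
  0 <= u t0 ->
  (forall tau, t0 <= tau <= t1 -> (forall s, t0 <= s <= tau -> 0 <= u s) -> g tau <= u tau) ->
  forall t, t0 <= t <= t1 -> g t <= u t.
Proof.
  intros H01 Hc Hg Hu0 Hstep.
  set (E := fun tau => t0 <= tau <= t1 /\ forall s, t0 <= s <= tau -> 0 <= u s).
  assert (HE0 : E t0).
  { split; [lra|]. intros s Hs. replace s with t0 by lra. exact Hu0. }
  destruct (completeness E) as [sg [Hub Hlub]].
  { exists t1. intros x [Hx _]. lra. }
  { exists t0. exact HE0. }
  assert (Hs0 : t0 <= sg) by (apply Hub, HE0).
  assert (Hs1 : sg <= t1) by (apply Hlub; intros x [Hx _]; lra).
  assert (Hbelow : forall s, t0 <= s < sg -> 0 <= u s).
  { intros s Hs. destruct (classic (exists x, E x /\ s < x)) as [[x [[_ Hx] Hsx]]|Hno].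
    - apply Hx. lra.
    - exfalso. assert (sg <= s); [|lra]. apply Hlub. intros x Hx.
      apply Rnot_lt_le. intros Hlt. apply Hno. exists x. split; assumption. }
  assert (Hcont : forall t, t0 <= t <= t1 -> forall eps, 0 < eps -> exists d, 0 < d /\
     forall s, Rabs (s - t) < d -> Rabs (u s - u t) < eps).
  { intros t Ht eps He. destruct (Hc t Ht eps He) as [d [Hd H]]. exists d. split; [exact Hd|].
    intros s Hs. destruct (Req_dec s t) as [->|Hne].
    - rewrite Rminus_diag, Rabs_R0. exact He.
    - apply H. split; [split; [exact I|lra]|exact Hs]. }
  assert (Husg : 0 <= u sg).
  { apply Rnot_lt_le. intros Hneg.
    destruct (Req_dec t0 sg) as [E0|E0]; [rewrite <- E0 in Hneg; lra|].
    destruct (Hcont sg ltac:(lra) (- u sg) ltac:(lra)) as [d [Hd H]].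
    set (s := Rmax t0 (sg - d / 2)).
    assert (Hs : t0 <= s < sg) by (unfold s; split; [apply Rmax_l|apply Rmax_lub_lt; lra]).
    assert (Hs' : sg - d / 2 <= s) by apply Rmax_r.
    specialize (H s ltac:(apply Rabs_def1; lra)). apply Rabs_def2 in H.
    specialize (Hbelow s Hs). lra. }
  assert (HEsg : E sg).
  { split; [lra|]. intros s Hs. destruct (Req_dec s sg) as [->|]; [exact Husg|apply Hbelow; lra]. }
  assert (Hsg1 : sg = t1).
  { apply Rle_antisym; [exact Hs1|]. apply Rnot_lt_le. intros Hlt.
    pose proof (Hstep sg ltac:(lra) (proj2 HEsg)) as Hpos. pose proof (Hg sg ltac:(lra)) as Hg0.
    destruct (Hcont sg ltac:(lra) (u sg) ltac:(lra)) as [d [Hd H]].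
    set (t := Rmin t1 (sg + d / 2)).
    assert (Ht1 : t <= t1) by apply Rmin_l. assert (Ht2 : t <= sg + d / 2) by apply Rmin_r.
    assert (Ht3 : sg < t) by (apply Rmin_glb_lt; lra).
    assert (E t); [|specialize (Hub t H0); lra].
    split; [lra|]. intros s Hs. destruct (Rle_dec s sg); [apply (proj2 HEsg); lra|].
    specialize (H s ltac:(apply Rabs_def1; lra)). apply Rabs_def2 in H. lra. }
  intros t Ht. apply Hstep; [exact Ht|]. intros s Hs. apply (proj2 HEsg). lra.
Qed.

(* A Riccati barrier: w bounds the logarithmic derivative -u'/u of u = bes nu, and G solves G' = - w G. *)
Lemma bes_barrier (nu : nat) (w dw G : R -> R) (t0 t1 : R) : 0 <= t0 -> t0 <= t1 ->
  (forall t, t0 <= t <= t1 -> is_derive w t (dw t)) ->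
  (forall t, t0 <= t <= t1 -> is_derive G t (- w t * G t)) ->
  (forall t, t0 <= t <= t1 -> 0 < G t) ->
  (forall t, t0 <= t <= t1 -> 0 <= t * (dw t - w t ^ 2) - 1 + (INR nu + 1) * w t) ->
  0 < bes nu t0 -> t0 ^ S nu * (bes (S nu) t0 / (INR nu + 1)) <= t0 ^ S nu * (w t0 * bes nu t0) ->
  (forall t, t0 <= t <= t1 -> bes nu t0 / G t0 * G t <= bes nu t) /\
  (forall t, t0 <= t <= t1 -> t ^ S nu * (bes (S nu) t / (INR nu + 1)) <= t ^ S nu * (w t * bes nu t)).
Proof.
  intros H0 H01 Hw HG HGpos Hbar Hu0 Hp0. pose proof (pos_INR nu) as Hnu.
  set (u := bes nu) in *. set (v := fun t => bes (S nu) t / (INR nu + 1)) in *.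
  assert (Hdu : forall t, is_derive u t (- v t)) by (intros; apply is_derive_bes).
  assert (Hdv : forall t, is_derive (fun t => t ^ S nu * v t) t (t ^ nu * u t)) by (intros; apply is_derive_pow_bes).
  assert (Hpart : forall tau, t0 <= tau <= t1 -> (forall s, t0 <= s <= tau -> 0 <= u s) ->
     tau ^ S nu * v tau <= tau ^ S nu * (w tau * u tau)).
  { intros tau Htau Hs.
    (* The integrating factor G cancels the terms in v: the derivative of G t^(nu+1) (w u - v) is
       t^nu G u times the barrier expression, nonnegative while u is. *)
    assert (HI := derive_nonneg_incr (fun t => G t * (t ^ S nu * (w t * u t) - t ^ S nu * v t))
       (fun t => t ^ nu * G t * u t * (t * (dw t - w t ^ 2) - 1 + (INR nu + 1) * w t)) t0 tau ltac:(lra)).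
    assert (Hle : 0 <= G tau * (tau ^ S nu * (w tau * u tau) - tau ^ S nu * v tau)).
    { eapply Rle_trans; [|apply HI].
      - apply Rmult_le_pos; [left; apply HGpos; lra|]. fold (v t0) in Hp0. lra.
      - intros t Ht.
        assert (D := is_derive_mult G (fun t => (t ^ S nu * (w t * u t) - t ^ S nu * v t)) t _
           _ (HG t ltac:(lra))
           (is_derive_minus (fun t => t ^ S nu * (w t * u t)) (fun t => t ^ S nu * v t) t _ _
              (is_derive_mult (fun t => t ^ S nu) (fun t => w t * u t) t _ _
                 (is_derive_pow (fun t => t) (S nu) t 1 (is_derive_id t))
                 (is_derive_mult w u t _ _ (Hw t ltac:(lra)) (Hdu t) Rmult_comm) Rmult_comm)
              (Hdv t)) Rmult_comm).
        replace (t ^ nu * G t * u t * (t * (dw t - w t ^ 2) - 1 + (INR nu + 1) * w t)) with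
          (plus (mult (- w t * G t) (t ^ S nu * (w t * u t) - t ^ S nu * v t))
             (mult (G t) (minus (plus (mult (INR (S nu) * 1 * t ^ Init.Nat.pred (S nu)) (w t * u t))
                (mult (t ^ S nu) (plus (mult (dw t) (u t)) (mult (w t) (- v t))))) (t ^ nu * u t)))).
        + exact D.
        + unfold plus, mult, minus, opp; simpl. unfold plus, opp; simpl.
          change (match nu with O => 1 | S _ => INR nu + 1 end) with (INR (S nu)). rewrite S_INR. ring.
      - intros t Ht. pose proof (HGpos t ltac:(lra)). specialize (Hs t Ht). specialize (Hbar t ltac:(lra)).
        repeat apply Rmult_le_pos; try lra. apply pow_le. lra. }
    pose proof (HGpos tau Htau). nra. }
  assert (Hlow : forall t, t0 <= t <= t1 -> u t0 / G t0 * G t <= u t).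
  { apply real_induction; [exact H01| | |lra|].
    - intros t _. apply derivable_continuous_pt. exists (- v t). apply is_derive_Reals, Hdu.
    - intros t Ht. pose proof (HGpos t Ht). pose proof (HGpos t0 ltac:(lra)). positivity.
    - intros tau Htau Hs.
      assert (Hwu : forall t, t0 <= t <= tau -> 0 < t -> v t <= w t * u t).
      { intros t Ht Ht0. apply Rmult_le_reg_l with (t ^ S nu); [apply pow_lt, Ht0|].
        apply Hpart; [lra|]. intros s Hs'. apply Hs. lra. }
      assert (Hmono : forall a, 0 < a -> t0 <= a <= tau -> u a / G a * G tau <= u tau).
      { intros a Ha Hat.
        assert (HI := derive_nonneg_incr (fun t => u t / G t)
           (fun t => (w t * u t - v t) / G t) a tau ltac:(lra)).
        assert (Hle : u a / G a <= u tau / G tau).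
        { apply HI.
          - intros t Ht. pose proof (HGpos t ltac:(lra)) as HGt.
            assert (D := is_derive_div u G t _ _ (Hdu t) (HG t ltac:(lra)) ltac:(lra)).
            replace ((w t * u t - v t) / G t) with ((- v t * G t - u t * (- w t * G t)) / G t ^ 2); [exact D|].
            field. lra.
          - intros t Ht. pose proof (HGpos t ltac:(lra)). pose proof (Hwu t ltac:(lra) ltac:(lra)).
            apply Rmult_le_pos; [lra|left; apply Rinv_0_lt_compat; assumption]. }
        pose proof (HGpos tau Htau). apply Rmult_le_compat_r with (r := G tau) in Hle; [|lra].
        unfold Rdiv in Hle at 2. rewrite Rmult_assoc, Rinv_l in Hle by lra. lra. }
      destruct (Req_dec tau t0) as [->|Hne].
      { right. field. pose proof (HGpos t0 ltac:(lra)). lra. }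
      assert (Hcont : continuity_pt (fun t => u t / G t * G tau) t0).
      { pose proof (HGpos t0 ltac:(lra)).
        apply derivable_continuous_pt. apply derivable_pt_mult; [|apply derivable_pt_const].
        apply derivable_pt_div; [exists (- v t0); apply is_derive_Reals, Hdu|
          exists (- w t0 * G t0); apply is_derive_Reals, HG; lra|lra]. }
      apply Rnot_lt_le. intros Hlt.
      destruct (Hcont (u t0 / G t0 * G tau - u tau) ltac:(lra)) as [d [Hd H]].
      set (a := Rmin tau (t0 + d / 2)).
      assert (Ha1 : a <= tau) by apply Rmin_l. assert (Ha2 : a <= t0 + d / 2) by apply Rmin_r.
      assert (Ha3 : t0 < a) by (apply Rmin_glb_lt; lra).
      specialize (H a). simpl in H. unfold R_dist in H.
      assert (H' := H ltac:(split; [split; [exact I|lra]|apply Rabs_def1; lra])).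
      apply Rabs_def2 in H'. specialize (Hmono a ltac:(lra) ltac:(lra)). lra. }
  split; [exact Hlow|]. intros t Ht. apply Hpart; [exact Ht|].
  intros s Hs. eapply Rle_trans; [|apply Hlow; lra].
  pose proof (HGpos s ltac:(lra)). pose proof (HGpos t0 ltac:(lra)).
  left. positivity.
Qed.

(** A constant barrier w is admissible up to t = (nu + 1)/w - 1/w^2, which is largest, namely (nu +
    1)^2 / 4, for w = 2/(nu + 1). The second conclusion is the starting condition for a further
    barrier. *)
Lemma bes_lower (nu : nat) (t : R) : 0 <= t <= (INR nu + 1) ^ 2 / 4 ->
  exp (- (2 / (INR nu + 1) * t)) <= bes nu t /\
  t ^ S nu * (bes (S nu) t / (INR nu + 1)) <= t ^ S nu * (2 / (INR nu + 1) * bes nu t).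
Proof.
  intros Ht. pose proof (pos_INR nu) as Hnu. set (c := 2 / (INR nu + 1)).
  destruct (bes_barrier nu (fun _ => c) (fun _ => 0) (fun t => exp (- (c * t))) 0 t) as [H1 H2]; try lra.
  - intros s _. apply (is_derive_const (K := R_AbsRing) (V := R_NormedModule)).
  - intros s _. auto_derive; [exact I|]. ring.
  - intros s _. apply exp_pos.
  - intros s Hs. replace (s * (0 - c ^ 2) - 1 + (INR nu + 1) * c) with (4 / (INR nu + 1) ^ 2 * ((INR nu + 1) ^ 2 / 4 - s)).
    + apply Rmult_le_pos; [positivity|lra].
    + unfold c. field. lra.
  - rewrite bes_0. lra.
  - rewrite pow_i by lia. lra.
  - split; [|apply H2; lra].
    specialize (H1 t ltac:(lra)). rewrite bes_0, Rmult_0_r, Ropp_0, exp_0 in H1.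
    replace (1 / 1 * exp (- (c * t))) with (exp (- (c * t))) in H1 by field. exact H1.
Qed.

(** As long as u >= 0, t^(nu+1) v increases from 0, so u' = -v <= 0. *)
Lemma bes_le_1 (nu : nat) (T : R) : 0 <= T -> (forall t, 0 <= t <= T -> 0 <= bes nu t) -> bes nu T <= 1.
Proof.
  intros HT H. pose proof (pos_INR nu) as Hnu.
  assert (Hv : forall t, 0 <= t <= T -> 0 <= t ^ S nu * (bes (S nu) t / (INR nu + 1))).
  { intros t Ht.
    assert (HI := derive_nonneg_incr (fun t => t ^ S nu * (bes (S nu) t / (INR nu + 1)))
      (fun t => t ^ nu * bes nu t) 0 t ltac:(lra) ltac:(intros; apply is_derive_pow_bes)).
    cbv beta in HI. rewrite (pow_i (S nu)), Rmult_0_l in HI by lia. apply HI.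
    intros s Hs. apply Rmult_le_pos; [apply pow_le; lra|apply H; lra]. }
  rewrite <- (bes_0 nu).
  assert (Hcont : continuity_pt (bes nu) 0).
  { apply derivable_continuous_pt. eexists. apply is_derive_Reals, is_derive_bes. }
  destruct (Req_dec T 0) as [->|Hne]; [lra|].
  apply Rnot_lt_le. intros Hlt.
  destruct (Hcont (bes nu T - bes nu 0) ltac:(lra)) as [d [Hd Hc]].
  set (a := Rmin T (d / 2)).
  assert (Ha1 : a <= T) by apply Rmin_l. assert (Ha2 : a <= d / 2) by apply Rmin_r.
  assert (Ha3 : 0 < a) by (apply Rmin_glb_lt; lra).
  specialize (Hc a). simpl in Hc. unfold R_dist in Hc.
  assert (H' := Hc ltac:(split; [split; [exact I|lra]|apply Rabs_def1; lra])).
  apply Rabs_def2 in H'.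
  assert (HI := derive_nonneg_incr (fun t => - bes nu t) (fun t => bes (S nu) t / (INR nu + 1)) a T Ha1).
  assert (- bes nu a <= - bes nu T); [|lra]. apply HI.
  - intros t Ht. rewrite <- (Ropp_involutive (_ / _)).
    apply (is_derive_opp (bes nu)). apply is_derive_bes.
  - intros t Ht. apply Rmult_le_reg_l with (t ^ S nu); [apply pow_lt; lra|].
    rewrite Rmult_0_r. apply Hv. lra.
Qed.

(** Continues [bes_lower] past T0 with w = 1/(A - t), which solves w' = w^2, agrees with 2/(nu + 1)
    at T0 and leaves the condition A - t <= nu + 1. The gain matters in weight 12, where the
    argument 4 pi^2 of the first coefficient exceeds 36. *)
Lemma bes_pos_ext (nu : nat) (t : R) :
  0 <= t < (INR nu + 1) ^ 2 / 4 + (INR nu + 1) / 2 -> 0 < bes nu t.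
Proof.
  intros Ht. pose proof (pos_INR nu) as Hnu.
  set (T0 := (INR nu + 1) ^ 2 / 4) in *. set (A := T0 + (INR nu + 1) / 2) in *.
  assert (HT0 : 0 < T0) by (unfold T0; positivity).
  destruct (Rle_dec t T0) as [Hle|Hgt].
  { eapply Rlt_le_trans; [apply exp_pos|apply bes_lower; unfold T0 in *; lra]. }
  destruct (bes_lower nu T0 ltac:(unfold T0 in *; lra)) as [B1 B2].
  assert (Hu0 : 0 < bes nu T0) by (eapply Rlt_le_trans; [apply exp_pos|exact B1]).
  destruct (bes_barrier nu (fun t => / (A - t)) (fun t => / (A - t) ^ 2) (fun t => A - t) T0 t) as [H1 _]; try lra.
  - intros s Hs. auto_derive; [lra|]. field. lra.
  - intros s Hs. auto_derive; [exact I|]. field. lra.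
  - intros s Hs. lra.
  - intros s Hs. rewrite pow_inv, Rminus_diag, Rmult_0_r.
    assert (A - s <= INR nu + 1) by (unfold A; lra).
    assert (1 <= (INR nu + 1) * / (A - s)); [|lra].
    apply Rmult_le_reg_r with (A - s); [lra|]. rewrite Rmult_assoc, Rinv_l by lra. lra.
  - replace (/ (A - T0)) with (2 / (INR nu + 1)) by (unfold A; field; lra). exact B2.
  - specialize (H1 t ltac:(lra)). eapply Rlt_le_trans; [|exact H1].
    assert (0 < A - T0) by (unfold A; lra). assert (0 < A - t) by lra. positivity.
Qed.

(** * The lower bound *)

Notation rser a := (qser (fun n => RtoC (a n))).

(* Coefficient sequences of forms of weight k; subexponential growth replaces holomorphy on the upper half-plane and at the cusp. *)
Definition qmf (k : nat) (a : nat -> R) : Prop :=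
  subexp (fun n => RtoC (a n)) /\
  forall z, inH z -> rser a (- / z)%C = (z ^ k * rser a z)%C.

Lemma qmf_of_modular_form (k : nat) (f : C -> C) (a : nat -> R) :
  is_modular_form k f -> has_q_expansion f a -> qmf k a.
Proof.
  intros [_ [_ [HS _]]] Ha.
  assert (Ha' : forall z, inH z -> sums (fun n => (RtoC (a n) * qpar z ^ n)%C) (f z)).
  { intros z Hz. refine (sums_ext _ _ _ _ (Ha z Hz)). intros n.
    exact (f_equal (Cmult (a n)) (pow_n_Cpow (qpar z) n)). }
  split.
  - exact (sums_subexp _ _ Ha').
  - assert (E : forall z, inH z -> rser a z = f z) by (intros z Hz; apply sums_CSeries, Ha', Hz).
    intros z Hz. rewrite !E by (assumption || apply inH_opp_Cinv, Hz).
    rewrite HS by exact Hz. rewrite pow_n_Cpow. reflexivity.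
Qed.

Lemma subexp_R (a : nat -> R) : subexp (fun n => RtoC (a n)) <->
  forall eps, 0 < eps -> exists K, forall n, Rabs (a n) <= K * exp (eps * INR n).
Proof.
  split; intros H eps He; destruct (H eps He) as [K HK]; exists K; intros n;
    specialize (HK n); rewrite Cmod_R in *; exact HK.
Qed.

Lemma rser_linear (a b : nat -> R) (x y : R) (z : C) :
  subexp (fun n => RtoC (a n)) -> subexp (fun n => RtoC (b n)) -> inH z ->
  rser (fun n => x * a n + y * b n) z = (x * rser a z + y * rser b z)%C.
Proof.
  intros Ha Hb Hz. unfold qser at 1. apply sums_CSeries.
  refine (sums_ext _ _ _ _ (sums_plus _ _ _ _ (sums_scal x _ _ (qser_sums _ z Ha Hz))
     (sums_scal y _ _ (qser_sums _ z Hb Hz)))).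
  intros n. cbv beta. rewrite RtoC_plus, !RtoC_mult. ring.
Qed.

Lemma qmf_linear (k : nat) (a b : nat -> R) (x y : R) :
  qmf k a -> qmf k b -> qmf k (fun n => x * a n + y * b n).
Proof.
  intros [Ha HSa] [Hb HSb]. split.
  - apply subexp_R. intros eps He.
    destruct (proj1 (subexp_R a) Ha eps He) as [K1 H1].
    destruct (proj1 (subexp_R b) Hb eps He) as [K2 H2].
    exists (Rabs x * K1 + Rabs y * K2). intros n.
    eapply Rle_trans; [apply Rabs_triang|]. rewrite !Rabs_mult.
    pose proof (Rmult_le_compat_l (Rabs x) _ _ (Rabs_pos x) (H1 n)).
    pose proof (Rmult_le_compat_l (Rabs y) _ _ (Rabs_pos y) (H2 n)). lra.
  - intros z Hz. rewrite !rser_linear by (assumption || apply inH_opp_Cinv, Hz).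
    rewrite HSa, HSb by exact Hz. ring.
Qed.

Definition axis (a : nat -> R) (y : R) : R := Series (fun n => a n * exp (- (2 * PI * y) * INR n)).

Lemma axis_series (a : nat -> R) (y : R) : subexp (fun n => RtoC (a n)) -> 0 < y ->
  is_series (fun n => a n * exp (- (2 * PI * y) * INR n)) (axis a y).
Proof.
  intros Ha Hy. destruct (subexp_bound _ y Ha Hy) as [K [_ HK]].
  apply Series_correct.
  apply (ex_series_dominated _ (fun n => K * exp (- (PI * y) * INR n))).
  - intros n. specialize (HK n y ltac:(lra)). rewrite Cmod_R in HK.
    change (Rabs (a n * exp (- (2 * PI * y) * INR n)) <= K * exp (- (PI * y) * INR n)).
    rewrite Rabs_mult, (Rabs_pos_eq (exp _)) by positivity. exact HK.
  - apply ex_series_exp_neg. pose proof PI_RGT_0. positivity.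
Qed.

Lemma rser_axis (a : nat -> R) (y : R) : subexp (fun n => RtoC (a n)) -> 0 < y ->
  rser a (0, y) = RtoC (axis a y).
Proof.
  intros Ha Hy. unfold qser. apply sums_CSeries.
  refine (sums_ext _ _ _ _ (sums_RtoC _ _ (axis_series a y Ha Hy))).
  intros n. cbv beta.
  replace (qpar (0, y)) with (RtoC (exp (- (2 * PI * y)))).
  - rewrite <- RtoC_pow, <- RtoC_mult, exp_pow_INR. reflexivity.
  - unfold qpar, cexp. apply C_ext; unfold Re, Im; simpl;
    rewrite !Rmult_0_l, !Rmult_0_r, Rplus_0_l, Rminus_0_l, ?cos_0, ?sin_0; ring.
Qed.

(** At z = iy the factor z^k is y^k, because 4 divides k. *)
Lemma axis_functional (k : nat) (a : nat -> R) (y : R) : (k mod 4 = 0)%nat -> qmf k a -> 0 < y ->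
  axis a (/ y) = y ^ k * axis a y.
Proof.
  intros H4 [Ha HS] Hy. apply RtoC_inj.
  assert (Hy' : 0 < / y) by positivity.
  rewrite RtoC_mult, <- !rser_axis by assumption.
  assert (Hz : inH (0, y)) by exact Hy.
  replace ((0, / y) : C) with (- / (0, y))%C.
  - rewrite HS by exact Hz. f_equal.
    rewrite (Nat.div_mod_eq k 4), H4, Nat.add_0_r, Cpow_mult_r, RtoC_pow, Cpow_mult_r. f_equal.
    apply C_ext; unfold Re, Im; simpl; ring.
  - apply C_ext; unfold Re, Im; simpl; field; lra.
Qed.

Lemma Series_term_le (p : nat -> R) (n : nat) : (forall i, 0 <= p i) -> ex_series p -> p n <= Series p.
Proof.
  intros Hp He. eapply Rle_trans; [|apply (partial_sum_le_Series p n Hp He)].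
  destruct n as [|n]; [simpl; lra|]. rewrite tech5.
  assert (0 <= sum_f_R0 p n) by (apply cond_pos_sum; exact Hp). lra.
Qed.

(** Nonnegative coefficients with a_m > 0 would keep f(i/Y) above a positive constant for Y >= 1,
    whereas f(i/Y) = Y^k f(iY) decays exponentially, as a_0 = 0. *)
Lemma cusp_form_nonneg_coef (k : nat) (a : nat -> R) (m : nat) : (k mod 4 = 0)%nat -> qmf k a ->
  a 0%nat = 0 -> (forall n, 0 <= a n) -> a m <= 0.
Proof.
  intros H4 Ha Ha0 Hpos. pose proof PI_RGT_0 as HPI. pose proof (proj1 Ha) as Hs.
  apply Rnot_lt_le. intros Hm.
  set (M := axis a 1).
  assert (Hterm : forall y n, 0 <= a n * exp (- (2 * PI * y) * INR n))
    by (intros; apply Rmult_le_pos; [apply Hpos|positivity]).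
  assert (Hup : forall Y, 1 <= Y -> axis a Y <= exp (- (2 * PI * (Y - 1))) * M).
  { intros Y HY. unfold M, axis. rewrite <- Series_scal_l. apply Series_le.
    - intros n. split; [apply Hterm|].
      destruct n as [|n]; [rewrite Ha0; lra|].
      replace (exp (- (2 * PI * (Y - 1))) * (a (S n) * exp (- (2 * PI * 1) * INR (S n))))
        with (a (S n) * (exp (- (2 * PI * (Y - 1))) * exp (- (2 * PI * 1) * INR (S n)))) by ring.
      apply Rmult_le_compat_l; [apply Hpos|]. rewrite <- exp_plus. apply exp_le_compat.
      rewrite S_INR. pose proof (pos_INR n). assert (0 <= PI * (Y - 1) * INR n) by positivity. nra.
    - apply ex_series_mult_l.
      eexists. apply axis_series; [exact Hs|lra]. }
  assert (Hlow : forall y, 0 < y -> a m * exp (- (2 * PI * y) * INR m) <= axis a y).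
  { intros y Hy. apply (Series_term_le (fun n => a n * exp (- (2 * PI * y) * INR n)) m).
    - intros; apply Hterm.
    - eexists. apply axis_series; assumption. }
  assert (HM : 0 < M).
  { eapply Rlt_le_trans; [|apply (Hlow 1); lra]. positivity. }
  set (K := INR (fact k) / PI ^ k * exp (2 * PI) * M).
  assert (HK : 0 < K) by (unfold K; pose proof (INR_fact_lt_0 k); positivity).
  set (c := a m * exp (- (2 * PI) * INR m)). assert (Hc : 0 < c) by (unfold c; positivity).
  assert (Hall : forall Y, 1 <= Y -> c <= K * exp (- (PI * Y))).
  { intros Y HY. assert (HiY : / Y <= 1) by (rewrite <- Rinv_1; apply Rinv_le_contravar; lra).
    assert (HiY0 : 0 < / Y) by positivity.
    apply Rle_trans with (axis a (/ Y)).
    - eapply Rle_trans; [|apply Hlow, HiY0]. unfold c. apply Rmult_le_compat_l; [lra|].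
      apply exp_le_compat. pose proof (pos_INR m). apply Rmult_le_compat_r; [assumption|]. nra.
    - rewrite (axis_functional k) by (assumption || lra).
      eapply Rle_trans; [apply Rmult_le_compat_l; [apply pow_le; lra|apply Hup, HY]|].
      pose proof (pow_le_exp k PI Y HPI ltac:(lra)) as Hp.
      replace (K * exp (- (PI * Y))) with
        (INR (fact k) / PI ^ k * exp (PI * Y) * (exp (- (2 * PI * (Y - 1))) * M)).
      + apply Rmult_le_compat_r; [positivity|exact Hp].
      + unfold K. replace (exp (- (PI * Y))) with (exp (PI * Y) * exp (- (2 * PI * Y)))
          by (rewrite <- exp_plus; f_equal; ring).
        replace (- (2 * PI * (Y - 1))) with (2 * PI + - (2 * PI * Y)) by ring.
        rewrite exp_plus. ring. }
  (* At this Y the inequality c (1 + PI Y) <= K, a consequence of [Hall], fails. *)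
  set (Y := 1 + K / (c * PI)).
  assert (HY : 1 <= Y) by (unfold Y; assert (0 < K / (c * PI)) by positivity; lra).
  specialize (Hall Y HY).
  pose proof (exp_ineq1_le (PI * Y)) as He.
  assert (Hinv : exp (- (PI * Y)) * exp (PI * Y) = 1) by (rewrite <- exp_plus, Rplus_opp_l; apply exp_0).
  pose proof (exp_pos (- (PI * Y))) as Hep.
  assert (E : PI * Y = PI + K / c) by (unfold Y; field; lra).
  assert (c * (1 + PI * Y) <= K).
  { apply Rle_trans with (c * exp (PI * Y)); [apply Rmult_le_compat_l; lra|].
    apply Rle_trans with (K * exp (- (PI * Y)) * exp (PI * Y)).
    - apply Rmult_le_compat_r; [left; apply exp_pos|exact Hall].
    - rewrite Rmult_assoc, Hinv. lra. }
  rewrite E in H.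
  assert (c * (1 + (PI + K / c)) = c + c * PI + K) by (field; lra). nra.
Qed.

(** If PI were at least 3.16, cos 1.58 would be nonnegative, but a Taylor polynomial that bounds it
    from above is negative there. *)
Lemma PI_upper : PI < 316 / 100.
Proof.
  pose proof PI_4. pose proof PI2_3_2.
  apply Rnot_le_lt. intros H1.
  assert (Hc : 0 <= cos (158 / 100)) by (apply cos_ge_0; lra).
  destruct (pre_cos_bound (158 / 100) 1 ltac:(lra) ltac:(lra)) as [_ Hu].
  unfold cos_approx, cos_term in Hu. cbn [sum_f_R0 Nat.mul Nat.add] in Hu.
  repeat match type of Hu with context [INR (fact ?n)] =>
    let v := eval vm_compute in (Z.of_nat (fact n)) in
    replace (INR (fact n)) with (IZR v) in Hu by (rewrite INR_IZR_INZ; reflexivity) end.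
  cbn [pow] in Hu. lra.
Qed.

Definition poincare_coef (nu m n : nat) : R := Re (pcoef nu m n).

Lemma qmf_poincare (nu m : nat) : (3 <= nu)%nat -> (S nu mod 4 = 0)%nat -> qmf (S nu) (poincare_coef nu m).
Proof.
  intros Hnu H4. assert (Hs : subexp (pcoef nu m)) by (apply subexp_pcoef; lia). split.
  - apply (subexp_le _ _ Hs). intros n. rewrite Cmod_R. apply re_le_Cmod.
  - apply qser_Re_S; [exact H4|exact Hs|]. intros z Hz. apply qser_pcoef_S; assumption.
Qed.

Lemma bes_unit_interval (nu : nat) (t : R) : 0 <= t <= (INR nu + 1) ^ 2 / 4 -> 0 <= bes nu t <= 1.
Proof.
  intros Ht.
  assert (H : forall s, 0 <= s <= t -> 0 <= bes nu s).
  { intros s Hs. eapply Rle_trans; [|apply bes_lower; lra]. left. apply exp_pos. }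
  split; [apply H; lra|apply bes_le_1; [lra|exact H]].
Qed.

(** For c >= 2 the Bessel argument is divided by c^2 >= 4, so the remainder needs only pi^2 n in the
    range of [bes_lower]. The c = 1 term is kept as it is, to be treated in two ways. *)
Lemma poincare_1_estimate (nu n : nat) : (2 <= nu)%nat -> PI ^ 2 * INR n <= (INR nu + 1) ^ 2 / 4 ->
  (if Nat.eq_dec n 1 then 1 else 0) + eisenstein_weight nu n * (bes nu (4 * PI ^ 2 * INR n) - 4 * / 2 ^ nu)
    <= poincare_coef nu 1 n.
Proof.
  intros Hnu Hn. pose proof PI_RGT_0 as HPI. pose proof (pos_INR n) as Hn0.
  assert (Hb : forall c, (2 <= c)%nat -> Rabs (bes nu (4 * PI ^ 2 * (INR 1 / INR c ^ 2) * INR n)) <= 1).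
  { intros c Hc. apply le_INR in Hc. change (INR 2) with 2 in Hc. change (INR 1) with 1.
    assert (Hc2 : 4 <= INR c ^ 2) by nra.
    assert (Hq : 0 < / INR c ^ 2 <= / 4) by (split; [positivity|apply Rinv_le_contravar; lra]).
    set (t := 4 * PI ^ 2 * (1 / INR c ^ 2) * INR n).
    assert (Ht : 0 <= t <= (INR nu + 1) ^ 2 / 4).
    { unfold t, Rdiv. rewrite Rmult_1_l. split; [positivity|].
      assert (0 <= PI ^ 2 * INR n) by positivity. nra. }
    pose proof (bes_unit_interval nu t Ht). rewrite Rabs_pos_eq; lra. }
  pose proof (pcoef_estimate nu 1 n Hnu Hb) as H. fold (poincare_coef nu 1 n) in H.
  apply Rabs_le_between in H. unfold kcoef in H. fold (eisenstein_weight nu n) in H.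
  replace (4 * PI ^ 2 * INR 1 * INR n) with (4 * PI ^ 2 * INR n) in H by (simpl; ring). lra.
Qed.

(** Relative to [eisenstein_weight], the c = 1 term is at least e^(-nu/2), because 2t/(nu + 1) <=
    nu/2 for t = 4 pi^2 n, and the terms with c >= 2 together are at most 4 / 2^nu. *)
Lemma poincare_1_pos (nu n : nat) : (11 <= nu)%nat -> (1 <= n)%nat ->
  INR n <= INR nu ^ 2 / (16 * PI ^ 2) -> 0 < poincare_coef nu 1 n.
Proof.
  intros Hnu Hn Hle. pose proof PI_RGT_0 as HPI. pose proof (pos_INR nu) as Hnu0.
  assert (Ht : 4 * PI ^ 2 * INR n <= INR nu ^ 2 / 4).
  { apply Rmult_le_compat_l with (r := 4 * PI ^ 2) in Hle; [|positivity].
    replace (4 * PI ^ 2 * (INR nu ^ 2 / (16 * PI ^ 2))) with (INR nu ^ 2 / 4) in Hle by (field; lra). exact Hle. }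
  assert (HPn : 0 <= PI ^ 2 * INR n) by (pose proof (pos_INR n); positivity).
  eapply Rlt_le_trans; [|apply poincare_1_estimate; [lia|nra]].
  assert (HW : 0 < eisenstein_weight nu n).
  { unfold eisenstein_weight. pose proof (INR_fact_lt_0 nu). assert (0 < INR n) by (apply lt_0_INR; lia). positivity. }
  assert (Hb : 4 * / 2 ^ nu < bes nu (4 * PI ^ 2 * INR n)).
  { destruct (bes_lower nu (4 * PI ^ 2 * INR n) ltac:(nra)) as [Hl _].
    eapply Rlt_le_trans; [|exact Hl].
    apply Rlt_le_trans with (exp (- (INR nu / 2))).
    2:{ apply exp_le_compat, Ropp_le_contravar.
        apply Rle_trans with (2 / (INR nu + 1) * (INR nu ^ 2 / 4)).
        - apply Rmult_le_compat_l; [positivity|exact Ht].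
        - apply Rmult_le_reg_r with (INR nu + 1); [lra|]. field_simplify; [nra|lra]. }
    (* Squared, and with e <= 3, this follows from 16 times 3^nu being less than 4^nu. *)
    assert (H2 : 4 * exp (INR nu / 2) < 2 ^ nu).
    { apply Rsqr_incrst_0; [|positivity|positivity].
      rewrite !Rsqr_pow2, Rpow_mult_distr, exp_pow_INR.
      replace (INR nu / 2 * INR 2) with (1 * INR nu) by (simpl; field). rewrite <- exp_pow_INR.
      rewrite <- pow_mult, Nat.mul_comm, pow_mult.
      apply Rle_lt_trans with (4 ^ 2 * 3 ^ nu).
      - apply Rmult_le_compat_l; [lra|]. apply pow_incr. split; [positivity|apply exp_le_3].
      - replace nu with (11 + (nu - 11))%nat by lia. rewrite !pow_add.
        assert (0 < 3 ^ (nu - 11)) by (apply pow_lt; lra).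
        assert (3 ^ (nu - 11) <= (2 ^ 2) ^ (nu - 11)) by (apply pow_incr; lra).
        simpl (3 ^ 11). simpl ((2 ^ 2) ^ 11). nra. }
    rewrite exp_Ropp. pose proof (exp_pos (INR nu / 2)).
    assert (0 < 2 ^ nu) by (apply pow_lt; lra).
    apply Rmult_lt_reg_r with (2 ^ nu * exp (INR nu / 2)); [positivity|].
    field_simplify; lra. }
  destruct (Nat.eq_dec n 1); nra.
Qed.

(** In weight 12 the range of [poincare_1_pos] is empty, so P_1 is shown to be nonzero separately:
    [bes_pos_ext] makes the c = 1 term positive, and the 1 from the row (0, 1) outweighs the
    remainder bound 8 pi^(nu+1) / nu!. *)
Lemma poincare_1_1_pos (nu : nat) : (11 <= nu)%nat -> 0 < poincare_coef nu 1 1.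
Proof.
  intros Hnu. pose proof PI_RGT_0 as HPI. pose proof PI_upper as HPu.
  pose proof (le_INR _ _ Hnu) as Hr. replace (INR 11) with 11 in Hr by (simpl; ring).
  assert (HP2 : PI ^ 2 < 10) by nra.
  eapply Rlt_le_trans; [|apply poincare_1_estimate; [lia|simpl INR; nra]].
  destruct (Nat.eq_dec 1 1) as [_|]; [|lia].
  change (INR 1) with 1. rewrite Rmult_1_r.
  assert (Hb : 0 < bes nu (4 * PI ^ 2)) by (apply bes_pos_ext; split; nra).
  assert (HW : eisenstein_weight nu 1 * (4 * / 2 ^ nu) < 1).
  { unfold eisenstein_weight. change (INR 1) with 1. rewrite pow1, Rmult_1_r.
    pose proof (INR_fact_lt_0 nu) as Hf. assert (H2 : 0 < 2 ^ nu) by (apply pow_lt; lra).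
    assert (Hmain : 8 * PI ^ S nu < INR (fact nu)).
    { replace nu with (11 + (nu - 11))%nat by lia. generalize (nu - 11)%nat as j. intros j.
      assert (Hup : 8 * (316 / 100) ^ S (11 + j) < INR (fact (11 + j))).
      { induction j as [|j IH].
        - rewrite Nat.add_0_r. rewrite !fact_simpl, !mult_INR. simpl. lra.
        - rewrite Nat.add_succ_r. rewrite fact_simpl, mult_INR.
          assert (12 <= INR (S (11 + j))) by (rewrite S_INR, plus_INR; pose proof (pos_INR j); simpl INR; lra).
          assert (0 < (316 / 100) ^ S (11 + j)) by (apply pow_lt; lra).
          change ((316 / 100) ^ S (S (11 + j))) with (316 / 100 * (316 / 100) ^ S (11 + j)). nra. }
      eapply Rle_lt_trans; [|exact Hup]. apply Rmult_le_compat_l; [lra|]. apply pow_incr. lra. }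
    rewrite Rpow_mult_distr. change (2 ^ S nu) with (2 * 2 ^ nu).
    apply Rmult_lt_reg_r with (INR (fact nu)); [exact Hf|].
    replace (2 * 2 ^ nu * PI ^ S nu / INR (fact nu) * (4 * / 2 ^ nu) * INR (fact nu)) with (8 * PI ^ S nu)
      by (field; lra). lra. }
  assert (HW0 : 0 <= eisenstein_weight nu 1).
  { unfold eisenstein_weight. pose proof (INR_fact_lt_0 nu). pose proof (pos_INR 1). positivity. }
  nra.
Qed.

Lemma first_neg_exists (a : nat -> R) (m : nat) : a m < 0 -> exists r, first_neg a r.
Proof.
  induction m as [m IH] using (well_founded_induction Wf_nat.lt_wf). intros Hm.
  destruct (classic (exists j, (j < m)%nat /\ a j < 0)) as [[j [Hj Ha]]|Hno].
  - exact (IH j Hj Ha).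
  - exists m. split; [exact Hm|]. intros j Hj. apply Rnot_lt_le. intros Ha. apply Hno. exists j. tauto.
Qed.

Lemma poincare_1_first_neg (nu : nat) : (11 <= nu)%nat -> (S nu mod 4 = 0)%nat ->
  exists r, first_neg (poincare_coef nu 1) r /\ INR nu ^ 2 / (16 * PI ^ 2) < INR r.
Proof.
  intros Hnu H4. assert (Hq := qmf_poincare nu 1 ltac:(lia) H4).
  assert (H0 : poincare_coef nu 1 0 = 0).
  { unfold poincare_coef. rewrite pcoef_0 by lia. reflexivity. }
  destruct (classic (exists m, poincare_coef nu 1 m < 0)) as [[m Hm]|Hno].
  - destruct (first_neg_exists _ m Hm) as [r Hr]. exists r. split; [exact Hr|].
    apply Rnot_le_lt. intros Hle. destruct Hr as [Hr _].
    destruct r as [|r]; [lra|].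
    pose proof (poincare_1_pos nu (S r) Hnu ltac:(lia) Hle). lra.
  - exfalso. pose proof (cusp_form_nonneg_coef (S nu) (poincare_coef nu 1) 1 H4 Hq H0) as H.
    pose proof (poincare_1_1_pos nu Hnu). assert (poincare_coef nu 1 1 <= 0); [|lra].
    apply H. intros n. apply Rnot_lt_le. intros Hn. apply Hno. exists n. exact Hn.
Qed.

(** * Forms with nonnegative coefficients *)

Lemma qpar_period_sub (z : C) (l : Z) : qpar (z - IZR l)%C = qpar z.
Proof.
  rewrite <- (qpar_add_IZR (z - IZR l) l). f_equal. ring.
Qed.

Lemma nearest_integer (x : R) : exists l : Z, Rabs (x - IZR l) <= / 2.
Proof.
  exists (up (x - / 2)). destruct (archimed (x - / 2)) as [H1 H2]. apply Rabs_le. lra.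
Qed.

(* Each inversion of a point with |Re z| <= 1/2 and Im z < 1/2 at least doubles the imaginary part, so the invariant function y^h |f| is bounded by its bound on y >= 1/2. *)
Lemma invariant_bound (h : nat) (a : nat -> R) (M : R) : qmf (2 * h) a ->
  (forall z, / 2 <= Im z -> Im z ^ h * Cmod (rser a z) <= M) ->
  forall z, inH z -> Im z ^ h * Cmod (rser a z) <= M.
Proof.
  intros [_ HS] HM.
  assert (H : forall N z, inH z -> / 2 <= 2 ^ N * Im z -> Im z ^ h * Cmod (rser a z) <= M).
  { induction N as [|N IH]; intros z Hz HN.
    - apply HM. simpl in HN. lra.
    - destruct (Rle_dec (/ 2) (Im z)) as [Hle|Hlt]; [apply HM, Hle|].
      destruct (nearest_integer (Re z)) as [l Hl].
      set (w := (z - IZR l)%C).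
      assert (Hw : Im w = Im z) by (unfold w, Im; simpl; ring).
      assert (HwH : inH w) by (unfold inH; rewrite Hw; exact Hz).
      assert (Hre : Rabs (Re w) <= / 2).
      { replace (Re w) with (Re z - IZR l) by (unfold w, Re; simpl; ring). exact Hl. }
      assert (Hper : rser a w = rser a z) by (unfold qser, w; rewrite (qpar_period_sub z l); reflexivity).
      assert (Hne := inH_neq_0 w HwH). assert (Hc := proj1 (Cmod_gt_0 w) Hne).
      assert (Hmod2 : Cmod w ^ 2 <= / 2).
      { rewrite Cmod2_alt. unfold inH in HwH. rewrite Hw in *. rewrite <- pow2_abs.
        pose proof (Rabs_pos (Re w)). nra. }
      assert (Hc2 : 0 < Cmod w ^ 2) by (apply pow_lt, Hc).
      assert (Him : Im (- / w)%C = Im z / Cmod w ^ 2) by (rewrite Im_opp_Cinv, Hw by exact Hne; reflexivity).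
      assert (Hbig : 2 * Im z <= Im (- / w)%C).
      { rewrite Him. apply Rmult_le_reg_r with (Cmod w ^ 2); [exact Hc2|].
        replace (Im z / Cmod w ^ 2 * Cmod w ^ 2) with (Im z) by (field; lra). unfold inH in Hz. nra. }
      assert (H2N : 0 < 2 ^ N) by (apply pow_lt; lra).
      assert (HI := IH (- / w)%C (inH_opp_Cinv w HwH) ltac:(simpl in HN; nra)).
      rewrite HS in HI by exact HwH. rewrite Cmod_mult, Cmod_pow, Hper, Him, pow_mult in HI.
      unfold Rdiv in HI. rewrite Rpow_mult_distr, pow_inv in HI.
      replace (Im z ^ h * / (Cmod w ^ 2) ^ h * ((Cmod w ^ 2) ^ h * Cmod (rser a z)))
        with (Im z ^ h * Cmod (rser a z)) in HI; [exact HI|].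
      field. apply pow_nonzero. lra. }
  intros z Hz. unfold inH in Hz.
  destruct (Pow_x_infinity 2 ltac:(rewrite Rabs_pos_eq; lra) (/ (2 * Im z))) as [N HN].
  apply (H N z Hz). specialize (HN N (le_n N)).
  rewrite Rabs_pos_eq in HN by (apply pow_le; lra).
  apply Rmult_le_reg_r with (/ Im z); [positivity|].
  rewrite Rmult_assoc, Rinv_r by lra. rewrite <- Rinv_mult. lra.
Qed.

(** The maximum is at x = h; the proof raises e^(x/h - 1) >= x/h to the power h. *)
Lemma pow_mult_exp_opp_le (h : nat) (x : R) : (1 <= h)%nat -> 0 <= x ->
  x ^ h * exp (- x) <= (INR h) ^ h * exp (- INR h).
Proof.
  intros Hh Hx. assert (Hh0 : 0 < INR h) by (apply lt_0_INR; lia).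
  pose proof (exp_ineq1_le (x / INR h - 1)) as H.
  assert (H1 : (x / INR h) ^ h <= exp (x / INR h - 1) ^ h).
  { apply pow_incr. split; [positivity|lra]. }
  rewrite exp_pow_INR in H1. replace ((x / INR h - 1) * INR h) with (x + - INR h) in H1 by (field; lra).
  rewrite exp_plus in H1.
  replace (x ^ h) with (INR h ^ h * (x / INR h) ^ h).
  2:{ rewrite <- Rpow_mult_distr. f_equal. field. lra. }
  apply Rle_trans with (INR h ^ h * (exp x * exp (- INR h)) * exp (- x)).
  - apply Rmult_le_compat_r; [positivity|]. apply Rmult_le_compat_l; [positivity|exact H1].
  - right. replace (INR h ^ h * (exp x * exp (- INR h)) * exp (- x)) with
      (INR h ^ h * exp (- INR h) * (exp x * exp (- x))) by ring.
    rewrite <- exp_plus, Rplus_opp_r, exp_0. ring.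
Qed.

(** Without constant term, |f| at height y >= 1/2 is at most e^(-2 pi (y - t)) D, so y^h |f| is
    bounded by M for y >= 1/2 and, by invariance, everywhere. The resulting coefficient bound is
    then optimised in y. *)
Lemma hecke_bound (h : nat) (a : nat -> R) (t D : R) (n : nat) : (1 <= h)%nat -> qmf (2 * h) a ->
  a 0%nat = 0 -> 0 < t <= / 2 ->
  axis (fun n => Rabs (a n)) t <= D -> Rabs (a n) <= INR n ^ h * (exp (2 * PI * t) * D).
Proof.
  intros Hh Ha Ha0 Ht HD. pose proof PI_RGT_0 as HPI.
  assert (Hs := proj1 Ha).
  assert (Hsabs : subexp (fun n => RtoC (Rabs (a n)))).
  { apply (subexp_le _ _ Hs). intros m. rewrite !Cmod_R, Rabs_Rabsolu. lra. }
  assert (Hax := axis_series _ t Hsabs ltac:(lra)).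
  assert (Hh0 : 0 < INR h) by (apply lt_0_INR; lia).
  assert (HD0 : 0 <= D).
  { eapply Rle_trans; [|exact HD]. eapply Rle_trans; [|apply (Series_term_le _ n)].
    - cbv beta. apply Rmult_le_pos; [apply Rabs_pos|positivity].
    - intros i. apply Rmult_le_pos; [apply Rabs_pos|positivity].
    - eexists; exact Hax. }
  destruct n as [|n]; [rewrite Ha0, Rabs_R0; simpl INR; rewrite pow_i by lia; lra|].
  assert (Hn0 : 0 < INR (S n)) by (apply lt_0_INR; lia).
  set (M := INR h ^ h * exp (- INR h) / (2 * PI) ^ h * (exp (2 * PI * t) * D)).
  assert (HM : forall z, / 2 <= Im z -> Im z ^ h * Cmod (rser a z) <= M).
  { intros z Hz. set (y := Im z) in *.
    assert (HzH : inH z) by (unfold inH; fold y; lra).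
    assert (B : Cmod (rser a z) <= exp (- (2 * PI * (y - t))) * D).
    { eapply Rle_trans; [|apply Rmult_le_compat_l; [left; apply exp_pos|exact HD]].
      unfold axis. rewrite <- Series_scal_l.
      apply (sums_bound _ _ _ (qser_sums _ z Hs HzH)).
      - intros m. rewrite Cmod_qterm, Cmod_R. fold y.
        destruct m as [|m]; [rewrite Ha0, Rabs_R0; lra|].
        replace (exp (- (2 * PI * (y - t))) * (Rabs (a (S m)) * exp (- (2 * PI * t) * INR (S m))))
          with (Rabs (a (S m)) * (exp (- (2 * PI * (y - t))) * exp (- (2 * PI * t) * INR (S m)))) by ring.
        apply Rmult_le_compat_l; [apply Rabs_pos|]. rewrite <- exp_plus. apply exp_le_compat.
        rewrite S_INR. pose proof (pos_INR m). assert (0 <= PI * (y - t) * INR m) by (positivity). nra.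
      - apply ex_series_mult_l. eexists; exact Hax. }
    pose proof (pow_mult_exp_opp_le h (2 * PI * y) Hh ltac:(positivity)) as He.
    rewrite Rpow_mult_distr in He.
    assert (Hp : 0 < (2 * PI) ^ h) by (apply pow_lt; lra).
    apply Rle_trans with (y ^ h * (exp (- (2 * PI * (y - t))) * D)).
    { apply Rmult_le_compat_l; [apply pow_le; lra|exact B]. }
    replace (- (2 * PI * (y - t))) with (- (2 * PI * y) + 2 * PI * t) by ring. rewrite exp_plus.
    unfold M. replace (y ^ h * (exp (- (2 * PI * y)) * exp (2 * PI * t) * D)) with
      ((2 * PI) ^ h * y ^ h * exp (- (2 * PI * y)) / (2 * PI) ^ h * (exp (2 * PI * t) * D)) by (field; lra).
    apply Rmult_le_compat_r; [positivity|]. apply Rmult_le_compat_r; [positivity|exact He]. }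
  (* At this height the exponential is e^(-h); it cancels, together with h^h and (2 pi)^h, against
     the constants in M and leaves n^h. *)
  set (y := INR h / (2 * PI * INR (S n))). assert (Hy : 0 < y) by (unfold y; positivity).
  assert (Hyh : 0 < y ^ h) by (apply pow_lt, Hy).
  assert (Hcoef := coef_bound (fun n => RtoC (a n)) (rser a) y (M / y ^ h) (S n)
     (fun z Hz => qser_sums _ z Hs Hz) Hy).
  assert (Hc : Cmod (a (S n)) * exp (- (2 * PI * y) * INR (S n)) <= M / y ^ h).
  { apply Hcoef. intros x. pose proof (invariant_bound h a M Ha HM (x, y) Hy) as Hb.
    change (Im (x, y)) with y in Hb.
    apply Rmult_le_reg_l with (y ^ h); [exact Hyh|].
    replace (y ^ h * (M / y ^ h)) with M by (field; lra). exact Hb. }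
  rewrite Cmod_R in Hc.
  replace (- (2 * PI * y) * INR (S n)) with (- INR h) in Hc by (unfold y; field; lra).
  apply Rmult_le_reg_r with (exp (- INR h)); [apply exp_pos|].
  eapply Rle_trans; [exact Hc|]. right.
  assert (Ey : y ^ h = INR h ^ h / ((2 * PI) ^ h * INR (S n) ^ h)).
  { unfold y, Rdiv. rewrite (Rpow_mult_distr (INR h)), pow_inv, (Rpow_mult_distr (2 * PI)). reflexivity. }
  rewrite Ey. unfold M.
  assert (0 < INR h ^ h) by (apply pow_lt, Hh0). assert (0 < (2 * PI) ^ h) by (apply pow_lt; lra).
  assert (0 < INR (S n) ^ h) by (apply pow_lt, Hn0).
  field. lra.
Qed.

Lemma eisenstein_0 (nu : nat) : (1 <= nu)%nat -> poincare_coef nu 0 0 = 1.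
Proof. intros H. unfold poincare_coef. rewrite pcoef_0 by exact H. reflexivity. Qed.

Lemma eisenstein_lower (nu n : nat) : (2 <= nu)%nat -> (1 <= n)%nat ->
  eisenstein_weight nu n * (1 - 4 * / 2 ^ nu) <= poincare_coef nu 0 n.
Proof.
  intros Hnu Hn.
  assert (Hz : forall c, 4 * PI ^ 2 * (INR 0 / INR c ^ 2) * INR n = 0)
    by (intros; simpl (INR 0); unfold Rdiv; ring).
  assert (Hb : forall c, (2 <= c)%nat -> Rabs (bes nu (4 * PI ^ 2 * (INR 0 / INR c ^ 2) * INR n)) <= 1).
  { intros c _. rewrite Hz, bes_0, Rabs_R1. lra. }
  pose proof (pcoef_estimate nu 0 n Hnu Hb) as H. fold (poincare_coef nu 0 n) in H.
  apply Rabs_le_between in H. destruct (Nat.eq_dec n 0); [lia|].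
  unfold kcoef in H. fold (eisenstein_weight nu n) in H.
  replace (4 * PI ^ 2 * INR 0 * INR n) with 0 in H by (simpl (INR 0); ring).
  rewrite bes_0 in H. lra.
Qed.

Lemma eisenstein_factor_pos (nu : nat) : (3 <= nu)%nat -> 0 < 1 - 4 * / 2 ^ nu.
Proof.
  intros Hnu. assert (2 ^ 3 <= 2 ^ nu) by (apply Rle_pow; [lra|exact Hnu]).
  assert (/ 2 ^ nu <= / 2 ^ 3) by (apply Rinv_le_contravar; [lra|assumption]). simpl in *. lra.
Qed.

Lemma eisenstein_weight_pos (nu n : nat) : (1 <= n)%nat -> 0 < eisenstein_weight nu n.
Proof.
  intros Hn. unfold eisenstein_weight. pose proof (INR_fact_lt_0 nu). pose proof PI_RGT_0.
  assert (0 < INR n) by (apply lt_0_INR; lia). positivity.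
Qed.

Lemma eisenstein_pos (nu n : nat) : (3 <= nu)%nat -> 0 < poincare_coef nu 0 n.
Proof.
  intros Hnu. destruct n as [|n]; [rewrite eisenstein_0 by lia; lra|].
  eapply Rlt_le_trans; [|apply eisenstein_lower; lia].
  apply Rmult_lt_0_compat; [apply eisenstein_weight_pos; lia|apply eisenstein_factor_pos, Hnu].
Qed.

(* Compare the values at i s and i / s: the terms with n >= 1 of the former are negligible. *)
Lemma axis_nonneg_bound (k : nat) (a : nat -> R) (s : R) : (k mod 4 = 0)%nat -> qmf k a ->
  a 0%nat = 1 -> (forall n, 0 <= a n) -> 1 <= s ->
  s ^ k * exp (- (2 * PI * s)) <= / 10 * exp (- (2 * PI * / s)) ->
  axis a (/ s) <= 10 / 9 * s ^ k.
Proof.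
  intros H4 Ha Ha0 Hpos Hs Hdom. pose proof PI_RGT_0 as HPI. pose proof (proj1 Ha) as Hsub.
  assert (His : 0 < / s <= 1).
  { split; [positivity|]. rewrite <- Rinv_1. apply Rinv_le_contravar; lra. }
  assert (H1 := axis_series a s Hsub ltac:(lra)).
  assert (H2 := axis_series a (/ s) Hsub ltac:(lra)).
  assert (Hsk : 0 < s ^ k) by (apply pow_lt; lra).
  assert (E := axis_functional k a s H4 Ha ltac:(lra)).
  (* As s^k f(is) = f(i/s), this inequality gives (9/10) f(i/s) <= s^k. *)
  assert (Hle : s ^ k * axis a s <= s ^ k + / 10 * axis a (/ s)).
  { unfold axis. rewrite (Series_incr_1 (fun n => a n * exp (- (2 * PI * s) * INR n))) by (eexists; exact H1).
    rewrite (Series_incr_1 (fun n => a n * exp (- (2 * PI * / s) * INR n))) by (eexists; exact H2).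
    rewrite Ha0. simpl (INR 0). rewrite !Rmult_0_r, exp_0, Rmult_1_r.
    assert (Ht : s ^ k * Series (fun n => a (S n) * exp (- (2 * PI * s) * INR (S n))) <=
       / 10 * Series (fun n => a (S n) * exp (- (2 * PI * / s) * INR (S n)))).
    { rewrite <- !Series_scal_l. apply Series_le.
      - intros n. split.
        + apply Rmult_le_pos; [lra|]. apply Rmult_le_pos; [apply Hpos|positivity].
        + replace (s ^ k * (a (S n) * exp (- (2 * PI * s) * INR (S n)))) with
            (a (S n) * (s ^ k * exp (- (2 * PI * s)) * exp (- (2 * PI * s) * INR n))).
          2:{ rewrite S_INR. replace (- (2 * PI * s) * (INR n + 1)) with (- (2 * PI * s) + - (2 * PI * s) * INR n) by ring.
              rewrite exp_plus. ring. }
          replace (/ 10 * (a (S n) * exp (- (2 * PI * / s) * INR (S n)))) with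
            (a (S n) * (/ 10 * exp (- (2 * PI * / s)) * exp (- (2 * PI * / s) * INR n))).
          2:{ rewrite S_INR. replace (- (2 * PI * / s) * (INR n + 1)) with (- (2 * PI * / s) + - (2 * PI * / s) * INR n) by ring.
              rewrite exp_plus. ring. }
          apply Rmult_le_compat_l; [apply Hpos|].
          apply Rmult_le_compat; [positivity|positivity|exact Hdom|].
          apply exp_le_compat. pose proof (pos_INR n). apply Rmult_le_compat_r; [assumption|]. nra.
      - apply ex_series_mult_l.
        apply (ex_series_incr_1 (fun n => a n * exp (- (2 * PI * / s) * INR n))). eexists; exact H2. }
    lra. }
  rewrite E in *. lra.
Qed.

(** Let g = f - E. Since |g_n| <= f_n + e_n, the axis bounds for f and for E add up to (20/9) s^k.
    Where f_n = 0 one has e_n = |g_n|, and division by n^h leaves the exponent k - 1 - h = h - 1. *)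
Lemma zero_coef_bound (h : nat) (a : nat -> R) (s : R) (n : nat) :
  (2 <= h)%nat -> (2 * h mod 4 = 0)%nat -> qmf (2 * h) a ->
  a 0%nat = 1 -> (forall n, 0 <= a n) -> 2 <= s ->
  s ^ (2 * h) * exp (- (2 * PI * s)) <= / 10 * exp (- (2 * PI * / s)) ->
  (1 <= n)%nat -> a n = 0 ->
  (2 * PI) ^ (2 * h) * INR n ^ (h - 1) * (1 - 4 * / 2 ^ (2 * h - 1)) <=
    exp (2 * PI * / s) * (20 / 9 * s ^ (2 * h)) * INR (fact (2 * h - 1)).
Proof.
  intros Hh H4 Ha Ha0 Hpos Hs Hdom Hn Han. pose proof PI_RGT_0 as HPI.
  set (nu := (2 * h - 1)%nat). assert (Hnu : S nu = (2 * h)%nat) by (unfold nu; lia).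
  assert (He : qmf (2 * h) (poincare_coef nu 0)).
  { rewrite <- Hnu. apply qmf_poincare; [unfold nu; lia|rewrite Hnu; exact H4]. }
  assert (Hepos : forall n, 0 <= poincare_coef nu 0 n) by (intros; left; apply eisenstein_pos; unfold nu; lia).
  assert (He0 : poincare_coef nu 0 0 = 1) by (apply eisenstein_0; unfold nu; lia).
  set (g := fun n => 1 * a n + -1 * poincare_coef nu 0 n).
  assert (Hg : qmf (2 * h) g) by (apply qmf_linear; assumption).
  assert (Hg0 : g 0%nat = 0) by (unfold g; rewrite Ha0, He0; ring).
  assert (Ht : 0 < / s <= / 2) by (split; [positivity|apply Rinv_le_contravar; lra]).
  assert (B1 := axis_nonneg_bound _ a s H4 Ha Ha0 Hpos ltac:(lra) Hdom).
  assert (B2 := axis_nonneg_bound _ _ s H4 He He0 Hepos ltac:(lra) Hdom).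
  assert (S1 := axis_series _ (/ s) (proj1 Ha) ltac:(lra)).
  assert (S2 := axis_series _ (/ s) (proj1 He) ltac:(lra)).
  assert (HD : axis (fun n => Rabs (g n)) (/ s) <= 20 / 9 * s ^ (2 * h)).
  { apply Rle_trans with (axis a (/ s) + axis (poincare_coef nu 0) (/ s)); [|lra].
    unfold axis. rewrite <- Series_plus by (eexists; [exact S1 || exact S2]).
    apply Series_le.
    - intros i. split; [apply Rmult_le_pos; [apply Rabs_pos|positivity]|].
      rewrite <- Rmult_plus_distr_r. apply Rmult_le_compat_r; [positivity|].
      specialize (Hpos i). specialize (Hepos i). unfold g. apply Rabs_le. lra.
    - eexists. apply (is_series_plus (K := R_AbsRing) (V := R_NormedModule)); [exact S1|exact S2]. }
  assert (Hhecke := hecke_bound h g (/ s) _ n ltac:(lia) Hg Hg0 Ht HD).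
  assert (Hgn : Rabs (g n) = poincare_coef nu 0 n).
  { unfold g. rewrite Han. replace (1 * 0 + -1 * poincare_coef nu 0 n) with (- poincare_coef nu 0 n) by ring.
    rewrite Rabs_Ropp. apply Rabs_pos_eq, Hepos. }
  rewrite Hgn in Hhecke.
  assert (Hlow := eisenstein_lower nu n ltac:(unfold nu; lia) Hn).
  assert (Hn0 : 0 < INR n) by (apply lt_0_INR; lia).
  pose proof (INR_fact_lt_0 nu) as Hf.
  assert (Hnh : 0 < INR n ^ h) by (apply pow_lt, Hn0).
  apply Rmult_le_reg_l with (INR n ^ h * / INR (fact nu)); [positivity|].
  replace (INR n ^ h * / INR (fact nu) * ((2 * PI) ^ (2 * h) * INR n ^ (h - 1) * (1 - 4 * / 2 ^ nu)))
    with (eisenstein_weight nu n * (1 - 4 * / 2 ^ nu)).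
  - eapply Rle_trans; [exact Hlow|]. eapply Rle_trans; [exact Hhecke|]. right. field. lra.
  - unfold eisenstein_weight. rewrite Hnu. replace nu with (h + (h - 1))%nat at 2 by (unfold nu; lia).
    rewrite pow_add. field. split; [apply pow_nonzero; lra|lra].
Qed.

(** * The last nonnegative form on a segment *)

Lemma finite_argmax (f : nat -> R) (N : nat) : exists m, (m <= N)%nat /\ forall n, (n <= N)%nat -> f n <= f m.
Proof.
  induction N as [|N [m [Hm H]]].
  - exists 0%nat. split; [lia|]. intros n Hn. replace n with 0%nat by lia. lra.
  - destruct (Rle_dec (f (S N)) (f m)) as [Hle|Hgt].
    + exists m. split; [lia|]. intros n Hn. destruct (Nat.eq_dec n (S N)) as [->|]; [assumption|apply H; lia].
    + exists (S N). split; [lia|]. intros n Hn. destruct (Nat.eq_dec n (S N)) as [->|]; [lra|].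
      specialize (H n ltac:(lia)). lra.
Qed.

(* Moving from the Eisenstein series towards the form a, stop at the last moment when all coefficients are nonnegative. *)
Lemma nonneg_form_with_zero_coef (h : nat) (a : nat -> R) (r : nat) :
  (2 <= h)%nat -> (2 * h mod 4 = 0)%nat -> qmf (2 * h) a -> first_neg a r -> (1 <= r)%nat ->
  exists b n, qmf (2 * h) b /\ b 0%nat = 1 /\ (forall m, 0 <= b m) /\ (r <= n)%nat /\ b n = 0.
Proof.
  intros Hh H4 Ha [Har Ham] Hr. pose proof PI_RGT_0 as HPI.
  set (nu := (2 * h - 1)%nat). assert (Hnu : S nu = (2 * h)%nat) by (unfold nu; lia).
  set (e := poincare_coef nu 0).
  assert (He : qmf (2 * h) e).
  { rewrite <- Hnu. apply qmf_poincare; [unfold nu; lia|rewrite Hnu; exact H4]. }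
  assert (Hepos : forall n, 0 < e n) by (intros; apply eisenstein_pos; unfold nu; lia).
  assert (He0 : e 0%nat = 1) by (apply eisenstein_0; unfold nu; lia).
  (* Adding [ep] times E halves a_r and makes every earlier coefficient positive, the constant term
     included. This covers cusp forms and later excludes indices below r. *)
  set (ep := - a r / (2 * e r)).
  assert (Hep : 0 < ep) by (unfold ep; specialize (Hepos r); apply Rdiv_lt_0_compat; lra).
  set (a' := fun n => 1 * a n + ep * e n).
  assert (Ha' : qmf (2 * h) a') by (apply qmf_linear; assumption).
  assert (Ha'r : a' r < 0).
  { unfold a'. replace (ep * e r) with (- a r / 2); [lra|]. unfold ep. field. specialize (Hepos r). lra. }
  assert (Ha'm : forall m, (m < r)%nat -> 0 < a' m).
  { intros m Hm. unfold a'. specialize (Ham m Hm). specialize (Hepos m). nra. }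
  set (al := a' 0%nat). assert (Hal : 0 < al) by (apply Ha'm; lia).
  set (g := fun n => 1 * a' n + - al * e n).
  assert (Hg : qmf (2 * h) g) by (apply qmf_linear; assumption).
  assert (Hg0 : g 0%nat = 0) by (unfold g; rewrite He0; fold al; ring).
  set (D := axis (fun n => Rabs (g n)) (/ 2)).
  assert (Hhecke : forall n, Rabs (g n) <= INR n ^ h * (exp (2 * PI * / 2) * D)).
  { intros n. apply hecke_bound; try assumption; [lia|lra|apply Rle_refl]. }
  set (K := exp (2 * PI * / 2) * D) in *.
  (* The form E + (t / al) g has m-th coefficient e_m (1 - t rho_m), so the coefficient with the
     largest rho is the one that vanishes at the last nonnegative moment t = 1/rho_n. *)
  set (rho := fun n => - g n / (al * e n)).
  assert (Hrho : forall n, a' n = al * e n * (1 - rho n)).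
  { intros n. unfold rho, g. field. specialize (Hepos n). lra. }
  set (w := (2 * PI) ^ S nu / INR (fact nu) * (1 - 4 * / 2 ^ nu)).
  assert (Hw : 0 < w).
  { unfold w. pose proof (INR_fact_lt_0 nu). apply Rmult_lt_0_compat; [positivity|apply eisenstein_factor_pos; unfold nu; lia]. }
  destruct (INR_unbounded (Rabs K / (al * w))) as [N0 HN0].
  (* The cuspidal part g_n = O(n^h) loses against e_n, of order at least n^(2h-1), so a maximum of
     rho above 1 can be sought among finitely many indices. *)
  assert (Hbig : forall n, (N0 <= n)%nat -> (1 <= n)%nat -> rho n <= 1).
  { intros n Hn Hn1. assert (Hn0 : 1 <= INR n) by (change 1 with (INR 1); apply le_INR, Hn1).
    unfold rho. apply Rmult_le_reg_r with (al * e n); [specialize (Hepos n); positivity|].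
    unfold Rdiv. rewrite Rmult_assoc, Rinv_l by (specialize (Hepos n); nra). rewrite Rmult_1_r, Rmult_1_l.
    apply Rle_trans with (INR n ^ h * Rabs K).
    - pose proof (Rle_abs (- g n)) as H1. rewrite Rabs_Ropp in H1. specialize (Hhecke n).
      pose proof (Rle_abs K). assert (0 <= INR n ^ h) by (apply pow_le; lra). nra.
    - assert (Hlow := eisenstein_lower nu n ltac:(unfold nu; lia) Hn1). fold e in Hlow.
      apply Rle_trans with (al * (w * INR n ^ nu)).
      + replace nu with (h + (h - 1))%nat at 1 by (unfold nu; lia). rewrite pow_add.
        assert (HK : Rabs K <= al * w * INR n).
        { apply le_INR in Hn. apply Rmult_le_reg_r with (/ (al * w)); [positivity|].
          replace (al * w * INR n * / (al * w)) with (INR n) by (field; lra). unfold Rdiv in HN0. lra. }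
        assert (Hp : INR n <= INR n ^ (h - 1)).
        { rewrite <- (pow_1 (INR n)) at 1. apply Rle_pow; [exact Hn0|lia]. }
        assert (0 <= INR n ^ h) by (apply pow_le; lra).
        apply Rle_trans with (INR n ^ h * (al * w * INR n)); [apply Rmult_le_compat_l; assumption|].
        replace (al * (w * (INR n ^ h * INR n ^ (h - 1)))) with (INR n ^ h * (al * w * INR n ^ (h - 1))) by ring.
        apply Rmult_le_compat_l; [assumption|]. apply Rmult_le_compat_l; [nra|exact Hp].
      + apply Rmult_le_compat_l; [lra|]. unfold w. unfold eisenstein_weight in Hlow.
        eapply Rle_trans; [|exact Hlow]. right. ring. }
  destruct (finite_argmax rho (N0 + r)) as [n [Hn Hmax]].
  assert (Hrhor : 1 < rho r).
  { rewrite (Hrho r) in Ha'r. specialize (Hepos r). assert (0 < al * e r) by positivity. nra. }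
  assert (Hrhon : 1 < rho n) by (specialize (Hmax r ltac:(lia)); lra).
  assert (Hall : forall m, rho m <= rho n).
  { intros m. destruct (Nat.le_gt_cases m (N0 + r)) as [Hm|Hm]; [apply Hmax, Hm|].
    specialize (Hbig m ltac:(lia) ltac:(lia)). lra. }
  set (b := fun m => 1 * e m + / (al * rho n) * g m).
  assert (Hb : forall m, b m = e m * (1 - rho m / rho n)).
  { intros m. unfold b, rho. specialize (Hepos m) as Hm. specialize (Hepos n) as Hn'.
    assert (Hgn : g n <> 0).
    { intros E. unfold rho in Hrhon. rewrite E in Hrhon. unfold Rdiv in Hrhon. lra. }
    field. repeat split; lra. }
  exists b, n. split; [apply qmf_linear; assumption|]. split; [|split; [|split]].
  - rewrite Hb, He0. unfold rho at 1. rewrite Hg0. field. split; [lra|]. specialize (Hepos 0%nat). lra.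
  - intros m. rewrite Hb. apply Rmult_le_pos; [left; apply Hepos|].
    specialize (Hall m). assert (rho m / rho n <= 1); [|lra].
    apply Rmult_le_reg_r with (rho n); [lra|]. unfold Rdiv. rewrite Rmult_assoc, Rinv_l by lra. lra.
  - apply Nat.le_ngt. intros Hlt. specialize (Ha'm n Hlt). rewrite Hrho in Ha'm.
    specialize (Hepos n). assert (0 < al * e n) by positivity. nra.
  - rewrite Hb. field. lra.
Qed.

(** * Numerical estimates *)

Lemma exp_partial_sum_le (x : R) (N : nat) : 0 <= x ->
  sum_f_R0 (fun n => x ^ n / INR (fact n)) N <= exp x.
Proof.
  intros Hx. rewrite <- (is_series_unique _ _ (is_series_exp x)).
  apply partial_sum_le_Series; [|eexists; apply is_series_exp].
  intros i. pose proof (INR_fact_lt_0 i). positivity.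
Qed.

Lemma exp_le_inv (x : R) : x < 1 -> exp x <= / (1 - x).
Proof.
  intros Hx. pose proof (exp_ineq1_le (- x)) as H. rewrite exp_Ropp in H. pose proof (exp_pos x).
  rewrite <- (Rinv_inv (exp x)). apply Rinv_le_contravar; lra.
Qed.

Lemma exp_1_lower : 2718 / 1000 <= exp 1.
Proof. eapply Rle_trans; [|apply (exp_partial_sum_le 1 7); lra]. simpl. lra. Qed.

(** Start from e^(1/128) <= 128/127; seven squarings, the intermediate ones rounded up, reach e. *)
Lemma exp_1_upper : exp 1 <= 273 / 100.
Proof.
  assert (H : exp (/ 128) <= 128 / 127) by (eapply Rle_trans; [apply exp_le_inv; lra|lra]).
  replace (exp 1) with (exp (/ 128) ^ 128).
  - pose proof (exp_pos (/ 128)) as Hp. set (x := exp (/ 128)) in *.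
    replace (x ^ 128) with (((((((x ^ 2) ^ 2) ^ 2) ^ 2) ^ 2) ^ 2) ^ 2) by (rewrite <- !pow_mult; reflexivity).
    assert (B1 : x ^ 2 <= 10158101 / 10000000) by nra. assert (P1 : 0 < x ^ 2) by positivity.
    set (x1 := x ^ 2) in *.
    assert (B2 : x1 ^ 2 <= 10318702 / 10000000) by nra. assert (P2 : 0 < x1 ^ 2) by positivity.
    set (x2 := x1 ^ 2) in *.
    assert (B3 : x2 ^ 2 <= 10647562 / 10000000) by nra. assert (P3 : 0 < x2 ^ 2) by positivity.
    set (x3 := x2 ^ 2) in *.
    assert (B4 : x3 ^ 2 <= 11337058 / 10000000) by nra. assert (P4 : 0 < x3 ^ 2) by positivity.
    set (x4 := x3 ^ 2) in *.
    assert (B5 : x4 ^ 2 <= 12852889 / 10000000) by nra. assert (P5 : 0 < x4 ^ 2) by positivity.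
    set (x5 := x4 ^ 2) in *.
    assert (B6 : x5 ^ 2 <= 16519676 / 10000000) by nra. assert (P6 : 0 < x5 ^ 2) by positivity.
    set (x6 := x5 ^ 2) in *.
    nra.
  - rewrite exp_pow_INR. f_equal. rewrite INR_IZR_INZ. simpl. lra.
Qed.

Lemma PI_lower : 312 / 100 < PI.
Proof.
  apply Rnot_le_lt. intros H1. pose proof PI2_3_2 as H2.
  assert (Hc : cos (156 / 100) <= 0) by (apply cos_le_0; lra).
  destruct (pre_cos_bound (156 / 100) 1 ltac:(lra) ltac:(lra)) as [Hu _].
  unfold cos_approx, cos_term in Hu. cbn [sum_f_R0 Nat.mul Nat.add] in Hu.
  repeat match type of Hu with context [INR (fact ?n)] =>
    let v := eval vm_compute in (Z.of_nat (fact n)) in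
    replace (INR (fact n)) with (IZR v) in Hu by (rewrite INR_IZR_INZ; reflexivity) end.
  cbn [pow] in Hu. lra.
Qed.

Lemma ln_12_bounds : 2404 / 1000 <= ln 12 <= 2486 / 1000.
Proof.
  pose proof exp_1_lower. pose proof exp_1_upper.
  split.
  - rewrite <- (ln_exp (2404 / 1000)). apply ln_le; [apply exp_pos|].
    replace (2404 / 1000) with (1 + 1 + 202 / 1000 + 202 / 1000) by field. rewrite !exp_plus.
    assert (exp (202 / 1000) <= 12532 / 10000) by (eapply Rle_trans; [apply exp_le_inv; lra|lra]).
    pose proof (exp_pos (202 / 1000)). pose proof (exp_pos 1).
    assert (exp 1 * exp 1 <= 273 / 100 * (273 / 100)) by (apply Rmult_le_compat; lra).
    assert (exp (202 / 1000) * exp (202 / 1000) <= 12532 / 10000 * (12532 / 10000)) by (apply Rmult_le_compat; lra).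
    rewrite Rmult_assoc.
    apply Rle_trans with (273 / 100 * (273 / 100) * (12532 / 10000 * (12532 / 10000))); [|lra].
    apply Rmult_le_compat; nra.
  - rewrite <- (ln_exp (2486 / 1000)). apply ln_le; [lra|].
    replace (2486 / 1000) with (1 + 1 + 486 / 1000) by field. rewrite !exp_plus.
    assert (16257 / 10000 <= exp (486 / 1000)).
    { eapply Rle_trans; [|apply (exp_partial_sum_le _ 6); lra]. simpl. lra. }
    assert (2718 / 1000 * (2718 / 1000) <= exp 1 * exp 1) by (apply Rmult_le_compat; lra).
    apply Rle_trans with (2718 / 1000 * (2718 / 1000) * (16257 / 10000)); [lra|].
    apply Rmult_le_compat; lra.
Qed.

Lemma ln_le_sub_1 (x : R) : 0 < x -> ln x <= x - 1.
Proof.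
  intros Hx. pose proof (exp_ineq1_le (ln x)) as H. rewrite exp_ln in H by exact Hx. lra.
Qed.

Lemma ln_tangent (x y : R) : 0 < x -> 0 < y -> ln y <= ln x + (y - x) / x.
Proof.
  intros Hx Hy. pose proof (ln_le_sub_1 (y / x) ltac:(positivity)) as H.
  rewrite ln_div in H by assumption. replace ((y - x) / x) with (y / x - 1) by (field; lra). lra.
Qed.

Definition loglog (k : R) : R := ln k + ln (ln k).

Lemma ln_ge_12 (k : R) : 12 <= k -> 2404 / 1000 <= ln k.
Proof.
  intros Hk. pose proof ln_12_bounds. pose proof (ln_le 12 k ltac:(lra) Hk). lra.
Qed.

(** Tangents to the concave logarithm at 12 and at ln 12; the slope in h is (1/6)(1 + 1/2.404),
    rounded up to 0.236. *)
Lemma loglog_upper (h : R) : 6 <= h -> loglog (2 * h) <= 34 / 10 + 236 / 1000 * (h - 6).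
Proof.
  intros Hh. pose proof ln_12_bounds as Hb. pose proof (ln_ge_12 (2 * h) ltac:(lra)) as Hk.
  pose proof (ln_tangent 12 (2 * h) ltac:(lra) ltac:(lra)) as H1.
  pose proof (ln_tangent (ln 12) (ln (2 * h)) ltac:(lra) ltac:(lra)) as H2.
  assert (H3 : ln (ln 12) <= 913 / 1000).
  { rewrite <- (ln_exp (913 / 1000)). apply ln_le; [lra|].
    apply Rle_trans with (2486 / 1000); [lra|].
    eapply Rle_trans; [|apply (exp_partial_sum_le _ 5); lra]. simpl. lra. }
  assert (H4 : (ln (2 * h) - ln 12) / ln 12 <= (2 * h - 12) / 12 / (2404 / 1000)).
  { apply Rle_trans with ((2 * h - 12) / 12 / ln 12).
    - apply Rmult_le_compat_r; [positivity|lra].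
    - apply Rmult_le_compat_l; [lra|]. apply Rinv_le_contravar; lra. }
  unfold loglog. lra.
Qed.

Lemma loglog_lower (k : R) : 12 <= k -> 323 / 100 <= loglog k.
Proof.
  intros Hk. pose proof (ln_ge_12 k Hk) as H. pose proof exp_1_upper as He.
  assert (H1 : 83 / 100 <= ln (ln k)).
  { rewrite <- (ln_exp (83 / 100)). apply ln_le; [apply exp_pos|].
    eapply Rle_trans; [|exact H].
    replace (83 / 100) with (1 + - (17 / 100)) by field. rewrite exp_plus, exp_Ropp.
    pose proof (exp_ineq1_le (17 / 100)) as H2. pose proof (exp_pos 1).
    assert (/ exp (17 / 100) <= / (117 / 100)) by (apply Rinv_le_contravar; lra).
    assert (0 < / exp (17 / 100)) by (apply Rinv_0_lt_compat, exp_pos).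
    apply Rle_trans with (273 / 100 * / (117 / 100)); [apply Rmult_le_compat; lra|lra]. }
  unfold loglog. lra.
Qed.

Lemma exp_loglog (k : R) : 12 <= k -> exp (loglog k - 1) = k * ln k / exp 1.
Proof.
  intros Hk. pose proof (ln_ge_12 k Hk).
  unfold loglog, Rminus. rewrite !exp_plus, exp_Ropp, !exp_ln by lra. reflexivity.
Qed.

(** From ln x <= x/e at x = ln k, and e + 1 <= 3.73. *)
Lemma loglog_sub_1_le (k : R) : 12 <= k -> (loglog k - 1) * exp 1 <= 373 / 100 * ln k.
Proof.
  intros Hk. pose proof (ln_ge_12 k Hk) as H. pose proof exp_1_upper. pose proof (exp_pos 1) as He.
  assert (H1 : ln (ln k) <= ln k / exp 1).
  { pose proof (ln_le_sub_1 (ln k / exp 1) ltac:(positivity)) as H1.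
    rewrite ln_div, ln_exp in H1 by lra. lra. }
  apply Rmult_le_compat_r with (r := exp 1) in H1; [|lra].
  replace (ln k / exp 1 * exp 1) with (ln k) in H1 by (field; lra). unfold loglog. nra.
Qed.

(* The height at which the form is compared with its transform under z -> -1/z. *)
Definition height (k : R) : R := k * (loglog k - 1) / (2 * PI).

Lemma height_ge_4 (k : R) : 12 <= k -> 4 <= height k.
Proof.
  intros Hk. pose proof (loglog_lower k Hk). pose proof PI_upper. pose proof PI_RGT_0.
  unfold height. apply Rmult_le_reg_r with (2 * PI); [lra|].
  replace (k * (loglog k - 1) / (2 * PI) * (2 * PI)) with (k * (loglog k - 1)) by (field; lra).
  nra.
Qed.

(** With L = [loglog k] the exponent is 4 pi^2 / (k (L - 1)) <= 3/2, and 4.52^2 >= 2.73^3 >= e^3. *)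
Lemma exp_inv_height (k : R) : 12 <= k -> exp (2 * PI * / height k) <= 452 / 100.
Proof.
  intros Hk. pose proof (loglog_lower k Hk). pose proof PI_upper. pose proof PI_RGT_0.
  pose proof exp_1_upper. pose proof (exp_pos 1).
  assert (Hsmall : 2 * PI * / height k <= 3 / 2).
  { unfold height. replace (2 * PI * / (k * (loglog k - 1) / (2 * PI))) with (4 * PI ^ 2 * / (k * (loglog k - 1)))
      by (field; lra).
    apply Rmult_le_reg_r with (k * (loglog k - 1)); [nra|].
    rewrite Rmult_assoc, Rinv_l by nra. nra. }
  apply Rle_trans with (exp (3 / 2)); [apply exp_le_compat, Hsmall|].
  apply Rsqr_incr_0_var; [|lra]. rewrite !Rsqr_pow2, exp_pow_INR.
  replace (3 / 2 * INR 2) with (1 + 1 + 1) by (simpl; field). rewrite !exp_plus.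
  assert (exp 1 * exp 1 <= 273 / 100 * (273 / 100)) by (apply Rmult_le_compat; lra).
  apply Rle_trans with (273 / 100 * (273 / 100) * (273 / 100)); [apply Rmult_le_compat; nra|lra].
Qed.

(** With L = [loglog] at k, e^(L-1) = k ln k / e, so the left side is q^k with q = (L - 1) e / (2 pi
    ln k). By [loglog_sub_1_le], q <= 0.61, and 0.61^12 is below 1/45.2. *)
Lemma height_dominates (k : nat) : (12 <= k)%nat ->
  height (INR k) ^ k * exp (- (2 * PI * height (INR k))) <= / 10 * exp (- (2 * PI * / height (INR k))).
Proof.
  intros Hkn. apply le_INR in Hkn as Hk. replace (INR 12) with 12 in Hk by (simpl; ring).
  pose proof (loglog_lower _ Hk) as HL. pose proof PI_upper. pose proof PI_lower.
  pose proof (ln_ge_12 _ Hk) as Hln. pose proof exp_1_upper. pose proof (exp_pos 1).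
  pose proof (exp_inv_height _ Hk) as Hi.
  set (K := INR k) in *. set (P := loglog K - 1) in *.
  assert (E : height K ^ k * exp (- (2 * PI * height K)) = (P * exp 1 / (2 * PI * ln K)) ^ k).
  { replace (- (2 * PI * height K)) with (- P * INR k) by (unfold height; fold K P; field; lra).
    rewrite <- exp_pow_INR, <- Rpow_mult_distr, exp_Ropp. f_equal.
    replace (exp P) with (K * ln K / exp 1) by (symmetry; apply exp_loglog, Hk). unfold height. fold P. field. lra. }
  rewrite E.
  set (q := P * exp 1 / (2 * PI * ln K)).
  assert (Hq : 0 <= q <= 61 / 100).
  { unfold q. split; [unfold P; positivity|].
    pose proof (loglog_sub_1_le K Hk) as Hle. fold P in Hle.
    apply Rmult_le_reg_r with (2 * PI * ln K); [positivity|].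
    unfold Rdiv at 1. rewrite Rmult_assoc, Rinv_l by nra. nra. }
  assert (Hqk : q ^ k <= (61 / 100) ^ 12).
  { replace k with (12 + (k - 12))%nat by lia. rewrite pow_add.
    rewrite <- (Rmult_1_r ((61 / 100) ^ 12)). apply Rmult_le_compat; try (apply pow_le; lra).
    - apply pow_incr. lra.
    - rewrite <- (pow1 (k - 12)). apply pow_incr. lra. }
  eapply Rle_trans; [exact Hqk|]. rewrite exp_Ropp.
  assert (/ (452 / 100) <= / exp (2 * PI * / height K)) by (apply Rinv_le_contravar; [apply exp_pos|exact Hi]).
  apply Rle_trans with (/ 10 * / (452 / 100)); [simpl; lra|]. lra.
Qed.

(** The quantity (k - 1)! (e/k)^k decreases because (1 + 1/k)^(k+1) >= e; 0.78 is an upper bound for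
    its value at k = 12. *)
Lemma fact_stirling (k : nat) : (12 <= k)%nat -> INR (fact (k - 1)) <= 78 / 100 * (INR k / exp 1) ^ k.
Proof.
  intros Hk. pose proof (exp_pos 1) as He. pose proof exp_1_upper as Heu.
  replace k with (12 + (k - 12))%nat by lia. generalize (k - 12)%nat as j. clear k Hk.
  induction j as [|j IH].
  - rewrite Nat.add_0_r. replace (INR (fact (12 - 1))) with 39916800.
    2:{ change (12 - 1)%nat with 11%nat. rewrite !fact_simpl, !mult_INR. simpl. lra. }
    replace (INR 12) with 12 by (simpl; ring).
    apply Rle_trans with (78 / 100 * (12 / (273 / 100)) ^ 12); [simpl; lra|].
    apply Rmult_le_compat_l; [lra|]. apply pow_incr. split; [lra|].
    apply Rmult_le_compat_l; [lra|]. apply Rinv_le_contravar; lra.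
  - rewrite Nat.add_succ_r. set (k := (12 + j)%nat) in *.
    assert (Hk : (12 <= k)%nat) by (unfold k; lia). clearbody k.
    replace (S k - 1)%nat with (S (k - 1)) by lia. rewrite fact_simpl, mult_INR.
    replace (S (k - 1)) with k by lia.
    assert (Hk0 : 0 < INR k) by (apply lt_0_INR; lia).
    apply Rle_trans with (INR k * (78 / 100 * (INR k / exp 1) ^ k)); [apply Rmult_le_compat_l; lra|].
    rewrite S_INR.
    assert (H1 : exp 1 <= ((INR k + 1) / INR k) ^ S k).
    { assert (H2 : exp (/ (INR k + 1)) <= (INR k + 1) / INR k).
      { eapply Rle_trans; [apply exp_le_inv|].
        - apply Rmult_lt_reg_r with (INR k + 1); [lra|]. rewrite Rinv_l by lra. lra.
        - right. field. lra. }
      replace (exp 1) with (exp (/ (INR k + 1)) ^ S k).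
      - apply pow_incr. split; [left; apply exp_pos|exact H2].
      - rewrite exp_pow_INR, S_INR. f_equal. field. lra. }
    assert (Hkk : 0 < (INR k / exp 1) ^ S k) by (apply pow_lt; positivity).
    replace (INR k * (78 / 100 * (INR k / exp 1) ^ k)) with (78 / 100 * ((INR k / exp 1) ^ S k * exp 1)).
    2:{ simpl pow. field. lra. }
    apply Rmult_le_compat_l; [lra|].
    replace ((INR k + 1) / exp 1) with (INR k / exp 1 * ((INR k + 1) / INR k)) by (field; lra).
    rewrite Rpow_mult_distr. apply Rmult_le_compat_l; [lra|exact H1].
Qed.

Lemma bernoulli (x : R) (n : nat) : 0 <= x -> 1 + INR n * x <= (1 + x) ^ n.
Proof. intros Hx. destruct (Req_dec x 0) as [->|]; [rewrite Rplus_0_r, pow1; lra|apply poly; lra]. Qed.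

(** From the base case h = 20 on, ((h + 1)/h)^6 <= (21/20)^6 < 3/2. *)
Lemma pow_growth (h : nat) : (20 <= h)%nat -> 194 / 100000 * INR h ^ 6 <= 57 * (3 / 2) ^ h.
Proof.
  intros Hh. replace h with (20 + (h - 20))%nat by lia. generalize (h - 20)%nat as j. clear h Hh.
  induction j as [|j IH].
  - simpl. lra.
  - rewrite Nat.add_succ_r. set (h := (20 + j)%nat) in *.
    assert (Hh : 20 <= INR h) by (unfold h; rewrite plus_INR; pose proof (pos_INR j); simpl; lra).
    clearbody h. rewrite S_INR. change ((3 / 2) ^ S h) with (3 / 2 * (3 / 2) ^ h).
    assert (H1 : (INR h + 1) ^ 6 <= 3 / 2 * INR h ^ 6); [|lra].
    apply Rle_trans with ((21 / 20 * INR h) ^ 6); [apply pow_incr; lra|].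
    rewrite Rpow_mult_distr. apply Rmult_le_compat_r; [apply pow_le; lra|simpl; lra].
Qed.

(** L/(L - 1) decreases and L^2 increases in L, so L may be replaced by its upper bound u + 1. For j
    >= 10, Bernoulli's inequality gives (1 + 1/u)^j >= 2.75, whose fourth power exceeds 57; the
    values j = 3, ..., 9 are computed. The constant 0.0172 exceeds 16/7316 times 4.52 (20/9) 0.78 /
    0.998, the losses accumulated in [zero_coef_index_le]. *)
Lemma key_inequality (j : nat) (L : R) : (3 <= j)%nat -> 1 < L -> L <= 34 / 10 + 236 / 1000 * (INR (2 * j) - 6) ->
  172 / 10000 * INR (2 * j) ^ 4 * L ^ 2 < (3 / 2) ^ (2 * j) * (L / (L - 1)) ^ (2 * (2 * j)).
Proof.
  intros Hj HL HU. set (h := (2 * j)%nat) in *. set (u := 24 / 10 + 236 / 1000 * (INR h - 6)).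
  assert (Hhr : 6 <= INR h) by (unfold h; replace 6 with (INR 6) by (simpl; ring); apply le_INR; lia).
  assert (Hu : 0 < u) by (unfold u; lra).
  assert (HLU : L <= u + 1) by (unfold u; lra).
  assert (H1 : 1 + / u <= L / (L - 1)).
  { replace (L / (L - 1)) with (1 + / (L - 1)) by (field; lra).
    apply Rplus_le_compat_l, Rinv_le_contravar; lra. }
  assert (Hu' : 0 < / u) by positivity.
  apply Rle_lt_trans with (172 / 10000 * INR h ^ 4 * (u + 1) ^ 2).
  { apply Rmult_le_compat_l; [positivity|]. apply pow_incr. lra. }
  apply Rlt_le_trans with ((3 / 2) ^ h * (1 + / u) ^ (2 * h)).
  2:{ apply Rmult_le_compat_l; [positivity|]. apply pow_incr. lra. }
  destruct (Nat.le_gt_cases 10 j) as [Hbig|Hsmall].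
  - assert (Hh20 : 20 <= INR h) by (unfold h; replace 20 with (INR 20) by (simpl; ring); apply le_INR; lia).
    assert (B : 57 < (1 + / u) ^ (2 * h)).
    { replace (2 * h)%nat with (j * 4)%nat by (unfold h; lia). rewrite pow_mult.
      assert (B1 : 275 / 100 <= (1 + / u) ^ j).
      { eapply Rle_trans; [|apply bernoulli; lra].
        assert (175 / 100 <= INR j * / u); [|lra].
        apply Rmult_le_reg_r with u; [exact Hu|]. rewrite Rmult_assoc, Rinv_l by lra.
        assert (E : INR h = 2 * INR j) by (unfold h; rewrite mult_INR; reflexivity). unfold u. lra. }
      apply Rlt_le_trans with ((275 / 100) ^ 4); [simpl; lra|apply pow_incr; lra]. }
    assert (G := pow_growth h ltac:(unfold h; lia)).
    assert (H32 : 0 < (3 / 2) ^ h) by positivity.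
    apply Rle_lt_trans with (57 * (3 / 2) ^ h); [|nra].
    eapply Rle_trans; [|exact G].
    apply Rle_trans with (172 / 10000 * INR h ^ 4 * (3352 / 10000 * INR h) ^ 2).
    + apply Rmult_le_compat_l; [positivity|]. apply pow_incr. unfold u. lra.
    + replace (172 / 10000 * INR h ^ 4 * (3352 / 10000 * INR h) ^ 2) with
        (172 / 10000 * (3352 / 10000) ^ 2 * INR h ^ 6) by ring.
      apply Rmult_le_compat_r; [positivity|simpl; lra].
  - assert (Hc : j = 3%nat \/ j = 4%nat \/ j = 5%nat \/ j = 6%nat \/ j = 7%nat \/ j = 8%nat \/ j = 9%nat) by lia.
    unfold u, h. clear - Hc.
    destruct Hc as [->|[->|[->|[->|[->|[->| ->]]]]]]; rewrite !mult_INR; simpl INR; simpl Nat.mul; simpl; lra.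
Qed.

(** * The theorem *)

(** If n exceeded the bound B, [zero_coef_bound] with Stirling's estimate would bound (2 pi)^k
    B^(h-1) by a constant times s^k (k/e)^k. Multiplied by B, the left side is exactly Q^h (L/(L -
    1))^k times s^k (k/e)^k, and that factor exceeds the constant times B by [key_inequality]. *)
Lemma zero_coef_index_le (k : nat) (a : nat -> R) (n : nat) : (12 <= k)%nat -> (k mod 4 = 0)%nat ->
  qmf k a -> a 0%nat = 1 -> (forall n, 0 <= a n) -> (1 <= n)%nat -> a n = 0 ->
  INR n <= / 7316 * INR k ^ 4 * loglog (INR k) ^ 2.
Proof.
  intros Hk H4 Ha Ha0 Hpos Hn Han.
  assert (HK : 12 <= INR k) by (replace 12 with (INR 12) by (simpl; ring); apply le_INR, Hk).
  pose proof (loglog_lower _ HK) as HLlow.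
  set (j := (k / 4)%nat). set (h := (2 * j)%nat).
  assert (Ek : k = (2 * h)%nat).
  { unfold h, j. pose proof (Nat.div_mod_eq k 4). lia. }
  assert (Hj : (3 <= j)%nat) by lia.
  pose proof (height_ge_4 _ HK) as Hs. pose proof (height_dominates k Hk) as Hdom.
  pose proof (exp_inv_height _ HK) as Hexp.
  set (s := height (INR k)) in *. set (L := loglog (INR k)) in *.
  pose proof PI_lower as HPl. pose proof exp_1_lower as Hel. pose proof PI_RGT_0 as HPI.
  assert (HLup : L <= 34 / 10 + 236 / 1000 * (INR h - 6)).
  { unfold L. rewrite Ek, mult_INR. apply loglog_upper. rewrite Ek, mult_INR in HK. simpl in HK. simpl in *. lra. }
  pose proof (key_inequality j L Hj ltac:(lra) HLup) as Hkey. fold h in Hkey.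
  rewrite Ek in Ha, Hdom.
  pose proof (zero_coef_bound h a s n ltac:(unfold h; lia) ltac:(rewrite <- Ek; exact H4) Ha Ha0 Hpos
    ltac:(lra) Hdom Hn Han) as Hz.
  rewrite <- Ek in Hz.
  apply Rnot_lt_le. intros Hlt. set (B := / 7316 * INR k ^ 4 * L ^ 2) in *.
  assert (HB : 0 < B) by (unfold B; positivity).
  assert (HBn : B ^ (h - 1) <= INR n ^ (h - 1)) by (apply pow_incr; lra).
  assert (Hdelta : 998 / 1000 <= 1 - 4 * / 2 ^ (k - 1)).
  { assert (2 ^ 11 <= 2 ^ (k - 1)) by (apply Rle_pow; [lra|lia]).
    assert (/ 2 ^ (k - 1) <= / 2 ^ 11) by (apply Rinv_le_contravar; [simpl; lra|assumption]).
    simpl (2 ^ 11) in *. lra. }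
  pose proof (fact_stirling k Hk) as Hst.
  assert (Hsk : 0 < s ^ k) by (apply pow_lt; lra).
  assert (Hek : 0 < (INR k / exp 1) ^ k) by (apply pow_lt; positivity).
  assert (Hpik : 0 < (2 * PI) ^ k) by (apply pow_lt; lra).
  assert (HBh : 0 < B ^ (h - 1)) by (apply pow_lt, HB).
  assert (H1 : (2 * PI) ^ k * B ^ (h - 1) * (998 / 1000) <=
     452 / 100 * (20 / 9 * s ^ k) * (78 / 100 * (INR k / exp 1) ^ k)).
  { apply Rle_trans with ((2 * PI) ^ k * INR n ^ (h - 1) * (1 - 4 * / 2 ^ (k - 1))).
    - apply Rmult_le_compat; [positivity|lra| |exact Hdelta]. apply Rmult_le_compat_l; lra.
    - eapply Rle_trans; [exact Hz|]. apply Rmult_le_compat; [positivity|apply pos_INR| |exact Hst].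
      apply Rmult_le_compat_r; [positivity|exact Hexp]. }
  set (P := L - 1) in *.
  assert (HP : 0 < P) by (unfold P; lra).
  (* Here B^h = (k^4 L^2 / 7316)^h meets s^k (k/e)^k = (k^2 (L - 1) / (2 pi e))^k; together with (2
     pi)^k the constants combine into Q^h. *)
  set (Q := (4 * PI ^ 2 * exp 1) ^ 2 / 7316).
  assert (HQ : 3 / 2 <= Q).
  { unfold Q. apply Rmult_le_reg_r with 7316; [lra|]. unfold Rdiv at 2. rewrite Rmult_assoc, Rinv_l, Rmult_1_r by lra.
    assert (H2 : (312 / 100) ^ 2 <= PI ^ 2) by (apply pow_incr; lra).
    assert (H3 : 4 * (312 / 100) ^ 2 * (2718 / 1000) <= 4 * PI ^ 2 * exp 1) by (apply Rmult_le_compat; simpl in *; lra).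
    apply Rle_trans with ((4 * (312 / 100) ^ 2 * (2718 / 1000)) ^ 2); [simpl; lra|].
    apply pow_incr. split; [simpl; lra|exact H3]. }
  set (X := (INR k * P / (2 * PI)) ^ k * (INR k / exp 1) ^ k).
  assert (HX : 0 < X) by (unfold X; positivity).
  assert (E : B * ((2 * PI) ^ k * B ^ (h - 1)) = X * (Q ^ h * (L / P) ^ k)).
  { replace (B * ((2 * PI) ^ k * B ^ (h - 1))) with ((2 * PI) ^ k * B ^ h).
    2:{ replace h with (S (h - 1)) at 1 by (unfold h; lia). simpl pow. ring. }
    assert (Hgen : forall K : R, ((2 * PI) ^ (2 * h) * (/ 7316 * K ^ 4 * L ^ 2) ^ h =
      (K * P / (2 * PI)) ^ (2 * h) * (K / exp 1) ^ (2 * h) * (Q ^ h * (L / P) ^ (2 * h)))).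
    { intros K. rewrite !pow_mult, <- !Rpow_mult_distr. f_equal. unfold Q. field. lra. }
    specialize (Hgen (INR k)). rewrite <- Ek in Hgen. exact Hgen. }
  assert (H2 : X * (Q ^ h * (L / P) ^ k) * (998 / 1000) <= B * (452 / 100 * (20 / 9) * (78 / 100)) * X).
  { rewrite <- E. unfold X. change (INR k * P / (2 * PI)) with s.
    apply Rmult_le_compat_l with (r := B) in H1; [|lra]. lra. }
  assert (H3 : Q ^ h * (L / P) ^ k * (998 / 1000) <= B * (452 / 100 * (20 / 9) * (78 / 100))).
  { apply Rmult_le_reg_l with X; [exact HX|]. lra. }
  assert (HQh : (3 / 2) ^ h <= Q ^ h) by (apply pow_incr; lra).
  assert (HLP : 0 < (L / P) ^ k) by (apply pow_lt; positivity).
  assert (H5 : (3 / 2) ^ h * (L / P) ^ (2 * h) <= Q ^ h * (L / P) ^ k).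
  { rewrite <- Ek. apply Rmult_le_compat_r; [lra|exact HQh]. }
  assert (E2 : B = / 7316 * (16 * INR h ^ 4) * L ^ 2).
  { assert (EK : INR k = 2 * INR h) by (rewrite Ek, mult_INR; simpl; ring).
    unfold B. rewrite EK. ring. }
  assert (0 < INR h ^ 4 * L ^ 2).
  { assert (0 < INR h) by (apply lt_0_INR; unfold h; lia). positivity. }
  rewrite E2 in H3. set (Y := INR h ^ 4 * L ^ 2) in *.
  replace (172 / 10000 * INR h ^ 4 * L ^ 2) with (172 / 10000 * Y) in Hkey by (unfold Y; ring).
  replace (/ 7316 * (16 * INR h ^ 4) * L ^ 2) with (/ 7316 * 16 * Y) in H3 by (unfold Y; ring).
  lra.
Qed.

Lemma first_neg_le (k : nat) (a : nat -> R) (r : nat) : (12 <= k)%nat -> (k mod 4 = 0)%nat ->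
  qmf k a -> first_neg a r -> INR r <= / 7316 * INR k ^ 4 * loglog (INR k) ^ 2.
Proof.
  intros Hk H4 Ha Hr.
  assert (HK : 12 <= INR k) by (replace 12 with (INR 12) by (simpl; ring); apply le_INR, Hk).
  pose proof (loglog_lower _ HK) as HL.
  (* A first negative index 0 lies below the positive bound; from here on the constant term is
     nonnegative. *)
  destruct r as [|r]; [simpl INR; positivity|].
  assert (Ek : k = (2 * (k / 2))%nat).
  { pose proof (Nat.div_mod_eq k 4). pose proof (Nat.div_mod_eq k 2).
    pose proof (Nat.mod_upper_bound k 2). lia. }
  destruct (nonneg_form_with_zero_coef (k / 2) a (S r)) as [b [n [Hb [Hb0 [Hbpos [Hrn Hbn]]]]]];
    try (rewrite <- Ek; assumption); try assumption; try lia.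
  rewrite <- Ek in Hb.
  apply Rle_trans with (INR n); [apply le_INR, Hrn|].
  apply (zero_coef_index_le k b n); try assumption. lia.
Qed.

Lemma bounded_nat_set_max (S : nat -> Prop) (B : R) (r0 : nat) : S r0 -> (forall r, S r -> INR r <= B) ->
  exists A, S A /\ forall r, S r -> (r <= A)%nat.
Proof.
  intros H0 HB. destruct (INR_unbounded B) as [N HN].
  assert (H : forall d r, S r -> (N <= r + d)%nat -> exists A, S A /\ forall r, S r -> (r <= A)%nat).
  { induction d as [|d IH]; intros r Hr Hd.
    - exfalso. specialize (HB r Hr). assert (INR N <= INR r) by (apply le_INR; lia). lra.
    - destruct (classic (exists r', S r' /\ (r < r')%nat)) as [[r' [Hr' Hlt]]|Hno].
      + apply (IH r' Hr'). lia.
      + exists r. split; [exact Hr|]. intros r' Hr'. apply Nat.le_ngt. intros Hlt. apply Hno. exists r'. tauto. }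
  apply (H N r0 H0). lia.
Qed.

Theorem theorem1 (k : nat) (hk : (12 <= k)%nat) (h4 : (k mod 4 = 0)%nat) :
  exists A : nat, is_A k A /\
    (INR k - 1) ^ 2 / (16 * PI ^ 2) < INR A /\
    INR A <= / 7316 * INR k ^ 4 * (ln (INR k) + ln (ln (INR k))) ^ 2.
Proof.
  destruct k as [|nu]; [lia|].
  destruct (poincare_1_first_neg nu ltac:(lia) h4) as [r0 [Hr0 Hlow]].
  assert (Hq := qmf_poincare nu 1 ltac:(lia) h4).
  destruct (qser_modular_form (S nu) (poincare_coef nu 1) (proj1 Hq) (proj2 Hq)) as [Hmf Hexp].
  assert (Hup : forall f a r, is_modular_form (S nu) f -> has_q_expansion f a -> first_neg a r ->
     INR r <= / 7316 * INR (S nu) ^ 4 * loglog (INR (S nu)) ^ 2).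
  { intros f a r Hf Ha Hr. apply (first_neg_le (S nu) a r hk h4); [|exact Hr].
    exact (qmf_of_modular_form _ _ _ Hf Ha). }
  (* The upper bound holds for every form, so the set of first negative indices is bounded; as it
     contains [r0], it has a maximum, which inherits both bounds. *)
  destruct (bounded_nat_set_max
    (fun r => exists f a, is_modular_form (S nu) f /\ has_q_expansion f a /\ first_neg a r)
    (/ 7316 * INR (S nu) ^ 4 * loglog (INR (S nu)) ^ 2) r0) as [A [HA Hmax]].
  - exists (rser (poincare_coef nu 1)), (poincare_coef nu 1). auto.
  - intros r [f [a [Hf [Ha Hr]]]]. exact (Hup f a r Hf Ha Hr).
  - exists A. split; [split|split].
    + exact HA.
    + intros f a r Hf Ha Hr. apply Hmax. exists f, a. auto.
    + assert (Hle : (r0 <= A)%nat) by (apply Hmax; exists (rser (poincare_coef nu 1)), (poincare_coef nu 1); auto).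
      apply le_INR in Hle. rewrite S_INR. replace (INR nu + 1 - 1) with (INR nu) by ring. lra.
    + destruct HA as [f [a [Hf [Ha Hr]]]]. exact (Hup f a A Hf Ha Hr).
Qed.
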